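(* The problem \textsc{Inclusion Dependency} is $\mathsf{W}[3]$-complete when parameterized by $k$. This remains true for the restricted variant \textsc{Inclusion Dependency}$_{\text{Identity}}$, in which both databases are over the same schema and only the identity mapping between columns is allowed.
   Context: A relational schema is a non-empty finite set of attributes; a row over schema $R$ is a tuple $r$ indexed by $R$; a database over $R$ is a finite set of rows; $r[X]$ is the projection of $r$ onto $X\subseteq R$ and $\mathfrak{r}[X]$ the collection of these projections for $r\in\mathfrak{r}$. Given databases $\mathfrak{r}$ over $R$ and $\mathfrak{s}$ over $S$, a pair $(X,\sigma)$ with $X\subseteq R$ and $\sigma:X\to S$ injective is an inclusion dependency (IND) if for every $r\in\mathfrak{r}$ there is $s\in\mathfrak{s}$ with $r[a]=s[\sigma(a)]$ for all $a\in X$; its size is $|X|$. \textsc{Inclusion Dependency}: given $\mathfrak{r}$ over $R$, $\mathfrak{s}$ over $S$, and $k\ge 0$ (the parameter), is there $X\subseteq R$ with $|X|=k$ and an injective $\sigma:X\to S$ such that $(X,\sigma)$ is an IND? \textsc{Inclusion Dependency}$_{\text{Identity}}$: given $\mathfrak{r},\mathfrak{s}$ over the same schema $R$ and $k$ (the parameter), is there $X\subseteq R$ with $|X|=k$ such that $(X,\mathrm{id}_X)$ is an IND, i.e. $\mathfrak{r}[X]\subseteq\mathfrak{s}[X]$? A parameterized reduction from $\Pi$ to $\Pi'$ is an algorithm running in time $f(k)\cdot\mathrm{poly}(|I|)$ for computable $f$ that maps $(I,k)$ to $(I',k')$ with $k'\le g(k)$ for computable $g$ and $(I,k)\in\Pi\iff(I',k')\in\Pi'$.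 A Boolean formula is $t$-normalized if it is a conjunction of disjunctions of conjunctions \dots of literals with $t$ levels in total. \textsc{Weighted $t$-normalized Satisfiability}: given a $t$-normalized formula and $k$ (the parameter), is there a satisfying assignment with exactly $k$ variables true? For $t\ge2$, $\mathsf{W}[t]$ is the class of parameterized problems with a parameterized reduction to this problem; $\mathsf{W}[t]$-complete means in $\mathsf{W}[t]$ and every problem of $\mathsf{W}[t]$ parameterized-reduces to it. *)

(* Defs.v *)
From mathcomp Require Import all_boot.
Set Implicit Arguments. Unset Strict Implicit. Unset Printing Implicit Defensive.

(* 1. Machine model: deterministic single-tape Turing machines with a finite *)
(*    state set and a finite tape alphabet.  Symbol 0 = blank, 1 = bit false, *)
(*    2 = bit true, further symbols are work symbols.  Start state is 0; the  *)
(*    machine halts when the transition function is undefined.               *)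

Inductive move := MoveL | MoveR | Stay.

Record TM := mkTM {
  tm_nstates : nat;
  tm_nsyms : nat;
  tm_delta : 'I_tm_nstates.+1 -> 'I_tm_nsyms.+3 ->
             option ('I_tm_nstates.+1 * 'I_tm_nsyms.+3 * move) }.

Definition tm_state (M : TM) := 'I_(tm_nstates M).+1.
Definition tm_sym (M : TM) := 'I_(tm_nsyms M).+3.

Definition blank_sym (M : TM) : tm_sym M := inord 0.
Definition bit_sym (M : TM) (b : bool) : tm_sym M := inord (if b then 2 else 1).

(* configuration: state, reversed left part, scanned symbol, right part *)
Record config (M : TM) := Config {
  c_state : tm_state M;
  c_left : seq (tm_sym M);
  c_head : tm_sym M;
  c_right : seq (tm_sym M) }.

Definition step (M : TM) (c : config M) : option (config M) :=
  match tm_delta (c_state c) (c_head c) with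
  | None => None
  | Some (q, a, mv) =>
      Some (match mv with
            | Stay => Config q (c_left c) a (c_right c)
            | MoveL => match c_left c with
                       | [::] => Config q [::] (blank_sym M) (a :: c_right c)
                       | b :: l => Config q l b (a :: c_right c)
                       end
            | MoveR => match c_right c with
                       | [::] => Config q (a :: c_left c) (blank_sym M) [::]
                       | b :: r => Config q (a :: c_left c) b r
                       end
            end)
  end.

Fixpoint run (M : TM) (n : nat) (c : config M) : config M :=
  match n with
  | 0 => c
  | n'.+1 => match step c with None => c | Some c' => run n' c' end
  end.

Definition halted (M : TM) (c : config M) : bool := if step c is None then true else false.

Definition init_config (M : TM) (x : seq bool) : config M :=
  match x with
  | [::] => Config (ord0 : tm_state M) [::] (blank_sym M) [::]
  | b :: x' => Config (ord0 : tm_state M) [::] (bit_sym M b) (map (bit_sym M) x')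
  end.

Fixpoint read_bits (M : TM) (s : seq (tm_sym M)) : seq bool :=
  match s with
  | [::] => [::]
  | a :: s' => if nat_of_ord a == 1 then false :: read_bits s'
               else if nat_of_ord a == 2 then true :: read_bits s'
               else [::]
  end.

Definition output (M : TM) (c : config M) : seq bool := read_bits (c_head c :: c_right c).

Definition computes_within (M : TM) (x : seq bool) (t : nat) (y : seq bool) : Prop :=
  let c := run t (init_config M x) in halted c /\ output c = y.

Definition computable (f : nat -> nat) : Prop :=
  exists M : TM, forall k, exists t, computes_within M (nseq k true) t (nseq (f k) true).

Definition pproblem := seq bool -> nat -> Prop.

Definition enc_pair (x : seq bool) (k : nat) : seq bool := nseq k true ++ false :: x.

Definition fpt_reduction (Q Q' : pproblem) : Prop :=
  exists (M : TM) (f g : nat -> nat) (c : nat),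
    computable f /\ computable g /\
    forall x k, exists x' k',
      computes_within M (enc_pair x k) (f k * (size x).+1 ^ c) (enc_pair x' k') /\
      k' <= g k /\ (Q x k <-> Q' x' k').

(* 3. Encodings (prefix-free, binary numbers).                              *)

Fixpoint binrev (fuel n : nat) : seq bool :=
  match fuel with
  | 0 => [::]
  | fuel'.+1 => if n is 0 then [::] else odd n :: binrev fuel' n./2
  end.
Definition bits (n : nat) : seq bool := binrev n n.

Definition enc_nat (n : nat) : seq bool :=
  flatten [seq [:: true; b] | b <- bits n] ++ [:: false].

Definition enc_list (A : Type) (enc : A -> seq bool) (l : seq A) : seq bool :=
  flatten [seq true :: enc a | a <- l] ++ [:: false].

(* 4. Databases and inclusion dependencies.                                 *)
(*    Schema R = 'I_n (n >= 1 attributes), values are natural numbers,      *)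
(*    a row is a list of length n (r[a] = nth 0 r a), a database is a       *)
(*    duplicate-free list of rows.                                          *)

Definition db_wf (n : nat) (d : seq (seq nat)) : bool :=
  (0 < n) && uniq d && all (fun r => size r == n) d.

Definition enc_db (d : seq (seq nat)) : seq bool := enc_list (enc_list enc_nat) d.

Definition is_IND (n m : nat) (r s : seq (seq nat)) (X : {set 'I_n})
  (sigma : 'I_n -> 'I_m) : Prop :=
  {in X &, injective sigma} /\
  forall row, row \in r -> exists2 row', row' \in s &
    forall a, a \in X -> nth 0 row a = nth 0 row' (sigma a).

Definition ID_problem : pproblem := fun x k =>
  exists n m (r s : seq (seq nat)),
    [/\ db_wf n r, db_wf m s,
        x = enc_nat n ++ enc_nat m ++ enc_db r ++ enc_db s &
        exists (X : {set 'I_n}) (sigma : 'I_n -> 'I_m),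
          #|X| = k /\ is_IND r s X sigma].

Definition ID_identity_problem : pproblem := fun x k =>
  exists n (r s : seq (seq nat)),
    [/\ db_wf n r, db_wf n s,
        x = enc_nat n ++ enc_db r ++ enc_db s &
        exists X : {set 'I_n}, #|X| = k /\ is_IND r s X id].

(* 5. Weighted 3-normalized Satisfiability and W[3].                        *)
(*    A 3-normalized formula: conjunction of disjunctions of conjunctions   *)
(*    of literals; a literal is (variable, polarity).                       *)

Definition literal := (nat * bool)%type.
Definition formula3 := seq (seq (seq literal)).

Definition enc_lit (l : literal) : seq bool := enc_nat l.1 ++ [:: l.2].
Definition enc_formula3 (phi : formula3) : seq bool :=
  enc_list (enc_list (enc_list enc_lit)) phi.

Definition vars3 (phi : formula3) : seq nat := map fst (flatten (flatten phi)).

Definition sat3 (T : seq nat) (phi : formula3) : bool :=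
  all (fun D => has (fun C => all (fun l => (l.1 \in T) == l.2) C) D) phi.

Definition WSat3 : pproblem := fun x k =>
  exists phi : formula3, x = enc_formula3 phi /\
    exists T : seq nat, [/\ uniq T, size T = k, {subset T <= vars3 phi} & sat3 T phi].

Definition W3 (Q : pproblem) : Prop := fpt_reduction Q WSat3.

Definition W3_complete (Q : pproblem) : Prop :=
  W3 Q /\ forall Q' : pproblem, W3 Q' -> fpt_reduction Q' Q.

(* Main.v *)
(* Membership: introduce a variable x_(a,b) for every pair of columns, and say *)

(* Membership. An IND of size k is a set of k pairs of columns, no two of which share a column on
   either side ([has_ind]). Each row of the first database asks for some row of the second such that
   all pairs on which the two rows differ are left out: a disjunction of conjunctions of negative
   literals, so three levels in total ([wsat_ind_formula]).

   Hardness. The intermediate problem is [avoidable]: choose a given number of columns so that every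
   family D contains a set C disjoint from the choice. Databases express this directly. Left row d
   and right row (d, e) differ exactly in the columns of the e-th set of the d-th family, and every
   cell names its column and d; agreement is therefore possible only between equal columns and equal
   d, and the column map is forced to be the identity on the chosen columns ([avoidable_IND],
   [IND_avoidable]). Thus one construction serves both problems. To remove positive literals, order
   the variables as 1, ..., N. A choice of K true variables is a chain 0 = q_0 < q_1 < ... < q_K <
   q_(K+1) = N+1, recorded by its K+1 steps (i, q_i, q_(i+1)). A variable is true iff no step jumps
   over it and false iff no step starts or ends in it, so either literal only forbids steps. That
   the steps form a chain is again a condition on pairs that must not be chosen together
   ([avoidable_gap_system], [wsat_gap_system], [gap_system_wsat]). There are polynomially many
   possible steps, and the parameter grows from K to K+1.

   Machines. [PT n] is a class of polynomial-time functions on trees, realised by machines that keep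
   four stacks on one tape. Every given machine can be simulated on the same stacks, so an arbitrary
   parameterized reduction can be followed by a [PT] function ([sim_then_PT], [fpt_poly_trans]).
   Membership composes the identity reduction with such a function, and completeness composes a
   given reduction to [WSat3] with one. Numbers in the inputs are binary while numbers of [PT]
   functions are unary; the reductions therefore treat input numbers as bit strings and never
   evaluate them. *)
(* that two chosen pairs never share a column and that each row of the first    *)
(* database has a row of the second with which it agrees on all chosen pairs;   *)
(* agreement is a conjunction of negative literals, so the formula is           *)
(* 3-normalized.  Hardness: choosing variables v_1 < ... < v_k amounts to       *)
(* choosing the k+1 gaps (i, v_i, v_(i+1)), and in terms of gaps both x and     *)
(* not x are conjunctions of negative literals (no gap jumps over x; no gap     *)
(* ends in x).  The resulting antimonotone formula becomes a pair of databases  *)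
(* with one column per gap, one left row per disjunction and one right row per  *)
(* conjunction, which differs from the left row exactly in the forbidden        *)
(* columns.  As distinct columns share no value, column maps are identities.    *)
(*   Machines: the class PT of functions on tree-encoded data contains the      *)
(* basic operations and is closed under iteration with polynomially bounded     *)
(* intermediate results.  Any machine can be simulated on the stacks on which   *)
(* PT functions are computed, so a reduction can be followed by a PT function,  *)
(* and computable time bounds are closed under PT operations on numbers.        *)
Require Import Defs.
From mathcomp Require Import all_boot perm zify.
Set Implicit Arguments. Unset Strict Implicit. Unset Printing Implicit Defensive.

(** * Labelled Turing machines and their composition *)

Section Machines.
Variable n : nat.

Definition sym := 'I_n.+3.+2.
Definition FB : sym := ord0.
Definition b0 : sym := @Ordinal n.+3.+2 1 isT.
Definition b1 : sym := @Ordinal n.+3.+2 2 isT.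
Definition SEP : sym := @Ordinal n.+3.+2 3 isT.
Definition bitsym (b : bool) : sym := if b then b1 else b0.
Definition content (a : sym) := (a != FB) && (a != SEP).

(* Cells left of the head, nearest first, and cells from the head on; beyond *)
(* the lists the tape is blank.                                              *)
Definition tape := (seq sym * seq sym)%type.

Definition act (a : sym) (mv : move) (t : tape) : tape :=
  match mv with
  | MoveR => (a :: t.1, behead t.2)
  | MoveL => (behead t.1, head FB t.1 :: a :: behead t.2)
  | Stay => (t.1, a :: behead t.2)
  end.

(** A machine halts with a label in [L]. Labels pass the outcome of a test on to the next machine
    without writing it on the tape. *)
Record mach (L : Type) := Mach {
  mst : finType;
  m0 : mst;
  md : mst -> sym -> (mst * sym * move) + L }.

Inductive ev L (M : mach L) : mst M -> tape -> nat -> L -> tape -> Prop :=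
| ev_halt q t l : md q (head FB t.2) = inr l -> ev q t 0 l t
| ev_step q t q' a mv k l t' : md q (head FB t.2) = inl (q', a, mv) ->
    ev q' (act a mv t) k l t' -> ev q t k.+1 l t'.

Definition ret (L : Type) (l : L) : mach L :=
  @Mach L unit tt (fun _ _ => inr l).

Lemma ev_ret L (l : L) t : ev (m0 (ret l)) t 0 l t.
Proof. exact: ev_halt. Qed.

Definition auto (S L : finType) (f : S -> sym -> sym * move * (S + L)) (s : S) :
  mach L :=
  @Mach L (S + L)%type (inl s) (fun q a =>
    match q with
    | inl s => inl ((f s a).2, (f s a).1.1, (f s a).1.2)
    | inr l => inr l
    end).

Section Auto.
Variables (S L : finType) (f : S -> sym -> sym * move * (S + L)).

Lemma ev_auto_stop s0 s (t : tape) a mv l :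
  f s (head FB t.2) = (a, mv, inr l) ->
  @ev _ (auto f s0) (inl s) t 1 l (act a mv t).
Proof. by move=> E; apply: ev_step; rewrite /= ?E //; apply: ev_halt. Qed.

Lemma ev_auto_step s0 s s' (t t' : tape) a mv k l :
  f s (head FB t.2) = (a, mv, inl s') ->
  @ev _ (auto f s0) (inl s') (act a mv t) k l t' ->
  @ev _ (auto f s0) (inl s) t k.+1 l t'.
Proof. by move=> E H; apply: ev_step; rewrite /= ?E. Qed.
End Auto.

(** The hand-over from [M1] to [M2] is itself one step, which rewrites the scanned symbol. This
    accounts for the additional step in [ev_bind] and for tapes being determined only up to
    [teq]. *)
Definition bind (L1 : finType) (L2 : Type) (M1 : mach L1) (M2 : L1 -> mach L2) :
  mach L2 :=
  @Mach L2 (mst M1 + {l : L1 & mst (M2 l)})%type (inl (m0 M1)) (fun q a =>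
    match q with
    | inl q => match md q a with
               | inl (q', a', mv) => inl (inl q', a', mv)
               | inr l => inl (inr (Tagged (fun l => mst (M2 l)) (m0 (M2 l))), a, Stay)
               end
    | inr (existT l q) =>
               match md q a with
               | inl (q', a', mv) => inl (inr (Tagged (fun l => mst (M2 l)) q'), a', mv)
               | inr l => inr l
               end
    end).

(* Writing the scanned symbol back only materialises an implicit blank. *)
Definition teq (t t' : tape) :=
  t.1 = t'.1 /\ head FB t.2 :: behead t.2 = head FB t'.2 :: behead t'.2.

Lemma teq_act t t' a mv : teq t t' -> act a mv t = act a mv t'.
Proof. case: t t' => [l s] [l' s'] [/= -> E].
by have /= H := congr1 behead E; case: mv; rewrite /act /= H.
Qed.


Lemma ev_teq L (M : mach L) q t k l t1 t2 :
  ev (M := M) q t k l t1 -> teq t t2 ->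
  exists2 t3, ev (M := M) q t2 k l t3 & teq t1 t3.
Proof.
case=> [q' t' l' E|q' t' q2 a mv k' l' t'' E H] [E1 E2].
  by exists t2; [apply: ev_halt; case: E2 => <- _ | split].
exists t'' => //; apply: (@ev_step _ _ _ _ q2 a mv); first by case: E2 => <- _.
by rewrite -(@teq_act t').
Qed.

Lemma teq_stay t : teq t (act (head FB t.2) Stay t).
Proof. by []. Qed.

Lemma teq_trans t1 t2 t3 : teq t1 t2 -> teq t2 t3 -> teq t1 t3.
Proof. by move=> [a b] [c d]; split; [rewrite a | rewrite b]. Qed.

Lemma ev_bind (L1 : finType) L2 (M1 : mach L1) (M2 : L1 -> mach L2)
    t k1 l1 t1 k2 l2 t2 :
  ev (m0 M1) t k1 l1 t1 -> ev (m0 (M2 l1)) t1 k2 l2 t2 ->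
  exists2 t3, ev (m0 (bind M1 M2)) t (k1 + k2.+1) l2 t3 & teq t2 t3.
Proof.
move=> H1 H2.
have [t3 H3 E3] := ev_teq H2 (teq_stay t1).
exists t3 => //.
have right q t' k l t'' : ev (M := M2 l1) q t' k l t'' ->
    @ev _ (bind M1 M2) (inr (Tagged (fun l => mst (M2 l)) q)) t' k l t''.
  elim=> {k l q t' t''} [q t' l E|q t' q' a mv k l t'' E _ IH].
    by apply: ev_halt; rewrite /= E.
  by apply: ev_step IH; rewrite /= E.
have left q t' k t'' : ev (M := M1) q t' k l1 t'' ->
    ev (m0 (M2 l1)) (act (head FB t''.2) Stay t'') k2 l2 t3 ->
    @ev _ (bind M1 M2) (inl q) t' (k + k2.+1) l2 t3.
  move El: {1}l1 => l H; elim: H El =>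
    {k q t' t''} [q t' l' E|q t' q' a mv k l' t'' E _ IH] El H.
    by apply: ev_step (right _ _ _ _ _ H); rewrite /= E El.
  by apply: ev_step (IH El H); rewrite /= E.
exact: left H3.
Qed.

Definition iterm (S : finType) (L : Type) (B : S -> mach (S + L)) (s : S) : mach L :=
  @Mach L {s : S & mst (B s)} (Tagged (fun s => mst (B s)) (m0 (B s))) (fun q a =>
    match q with
    | existT s q => match md q a with
        | inl (q', a', mv) => inl (Tagged (fun s => mst (B s)) q', a', mv)
        | inr (inl s') => inl (Tagged (fun s => mst (B s)) (m0 (B s')), a, Stay)
        | inr (inr l) => inr l
        end
    end).

Section Iter.
Variables (S : finType) (L : Type) (B : S -> mach (S + L)).

Lemma iter_embed s0 s x q t k t' : ev (M := B s) q t k x t' ->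
  forall l k2 t2,
  match x with
  | inr l' => l' = l /\ k2 = 0 /\ t2 = t'
  | inl s' => exists2 k', k2 = k'.+1 &
      @ev _ (iterm B s0) (Tagged (fun s => mst (B s)) (m0 (B s')))
         (act (head FB t'.2) Stay t') k' l t2
  end -> @ev _ (iterm B s0) (Tagged (fun s => mst (B s)) q) t (k + k2) l t2.
Proof.
elim=> {x q t k t'} [q t [s'|l'] E|q t q' a mv k x t' E _ IH] l k2 t2.
- by case=> k' -> H; apply: ev_step H; rewrite /= E.
- by case=> <- [-> ->]; apply: ev_halt; rewrite /= E.
by move/IH => H; apply: ev_step H; rewrite /= E.
Qed.

Lemma ev_iter_stop s t k l t' :
  ev (m0 (B s)) t k (inr l) t' -> ev (m0 (iterm B s)) t k l t'.
Proof.
by move=> H; rewrite -[k]addn0; apply: (@iter_embed s s _ _ _ _ _ H l 0 t').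
Qed.

Lemma ev_iter_step s s' t k t1 k2 l t2 :
  ev (m0 (B s)) t k (inl s') t1 -> ev (m0 (iterm B s')) t1 k2 l t2 ->
  exists2 t3, ev (m0 (iterm B s)) t (k + k2.+1) l t3 & teq t2 t3.
Proof.
move=> H1 H2.
have [t3 H3 E3] := ev_teq H2 (teq_stay t1).
exists t3 => //; apply: (@iter_embed s s _ _ _ _ _ H1 l k2.+1 t3); exists k2 => //.
have gen q t' k' l' t'' : ev (M := iterm B s') q t' k' l' t'' ->
    @ev _ (iterm B s) q t' k' l' t''.
  elim=> {q t' k' l' t''} [q t' l' E|q t' q' a mv k' l' t'' E _ IH].
    exact: ev_halt.
  exact: ev_step IH.
exact: gen H3.
Qed.
End Iter.

End Machines.

(** * Machines on four stacks *)

Section Registers.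
Variable n : nat.
Local Notation sym := (sym n).
Local Notation mach := (mach n).
Local Notation tape := (tape n).
Local Notation FB := (FB n).
Local Notation SEP := (SEP n).

Lemma teq_sym (t t' : tape) : teq t t' -> teq t' t.
Proof. by case. Qed.

(** Time is bounded from above only and the final tape is known up to [teq]; both are stable under
    composition. *)
Definition tev L (M : mach L) (t : tape) k l (t' : tape) :=
  exists t'' k', [/\ k' <= k, ev (m0 M) t k' l t'' & teq t'' t'].

Lemma ev_tev L (M : mach L) t k l t' : ev (m0 M) t k l t' -> tev M t k l t'.
Proof. by exists t', k. Qed.

Lemma tev_teql L (M : mach L) t1 t2 k l t' : teq t1 t2 -> tev M t2 k l t' -> tev M t1 k l t'.
Proof.
move=> E [t'' [k' [H1 H2 H3]]].
have [t3 H4 H5] := ev_teq H2 (teq_sym E).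
by exists t3, k'; split=> //; apply: teq_trans (teq_sym H5) H3.
Qed.

Lemma tev_teqr L (M : mach L) t k l t1 t2 : teq t1 t2 -> tev M t k l t1 -> tev M t k l t2.
Proof. by move=> E [t'' [k' [H1 H2 H3]]]; exists t'', k'; split=> //; apply: teq_trans E. Qed.

Lemma tev_le L (M : mach L) t k k' l t' : k <= k' -> tev M t k l t' -> tev M t k' l t'.
Proof.
by move=> E [t'' [k1 [H1 H2 H3]]]; exists t'', k1; split=> //; apply: leq_trans E.
Qed.

Lemma tev_bind (L1 : finType) L2 (M1 : mach L1) (M2 : L1 -> mach L2)
    t k1 l1 t1 k2 l2 t2 :
  tev M1 t k1 l1 t1 -> tev (M2 l1) t1 k2 l2 t2 ->
  tev (bind M1 M2) t (k1 + k2).+1 l2 t2.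
Proof.
move=> [t1' [k1' [? H1 E1]]] H2; have [t2' [k2' [? {}H2 E2]]] := tev_teql E1 H2.
have [t3 H3 E3] := ev_bind H1 H2.
exists t3, (k1' + k2'.+1); split=> //; first lia.
exact: teq_trans (teq_sym E3) E2.
Qed.

(** The registers lie left of the head, each preceded on the tape by its [SEP]. The first move is
    unconditional because after an earlier skip the head still stands on the [SEP] of the block just
    crossed. *)
Definition skip_left : mach unit :=
  auto (fun (s : bool) (a : sym) =>
    if s && (a == SEP) then (a, Stay, inr tt) else (a, MoveL, inl true)) false.

Lemma skip_left_ev w l (s : seq sym) : all (@content n) w ->
  tev skip_left (w ++ SEP :: l, s) (size w).+2 tt
     (l, SEP :: rev w ++ head FB s :: behead s).
Proof.
move=> Hw; apply: ev_tev; rewrite /skip_left.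
apply: (@ev_auto_step _ _ _ _ _ _ true _ _ (head FB s) MoveL) => //.
elim: w s (head FB s) Hw => [|x w IH] s a /= Hw.
  by have := @ev_auto_stop n bool unit (fun (s : bool) (a : sym) =>
    if s && (a == SEP) then (a, Stay, inr tt) else (a, MoveL, inl true)) false true
    (l, SEP :: a :: behead s) SEP Stay tt; apply.
case/andP: Hw => /andP [_ /negbTE Hx] Hw.
apply: (@ev_auto_step _ _ _ _ _ _ true _ _ x MoveL) => /=; first by rewrite Hx.
have := IH (x :: a :: behead s) x Hw.
by rewrite rev_cons cat_rcons.
Qed.

Fixpoint skipn (i : nat) : mach unit :=
  if i is i'.+1 then bind skip_left (fun _ => skipn i') else ret n tt.

Definition flat (ws : seq (seq sym)) : seq sym := flatten [seq w ++ [:: SEP] | w <- ws].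

Lemma flat_cons w ws : flat (w :: ws) = w ++ SEP :: flat ws.
Proof. by rewrite /flat /= -catA. Qed.

Lemma flat_cat ws ws' : flat (ws ++ ws') = flat ws ++ flat ws'.
Proof. by rewrite /flat map_cat flatten_cat. Qed.

Lemma skipn_ev ws l (s : seq sym) : all (all (@content n)) ws ->
  tev (skipn (size ws)) (flat ws ++ l, s) (3 * size (flat ws)) tt
     (l, rev (flat ws) ++ head FB s :: behead s).
Proof.
elim: ws s => [|w ws IH] s /=.
  by exists (l, s), 0; split=> //; apply: ev_ret.
case/andP=> Hw Hws; rewrite flat_cons -catA /=.
apply: (@tev_le _ _ _ ((size w).+2 + 3 * size (flat ws)).+1).
  rewrite size_cat /=; lia.
apply: tev_bind; first exact: skip_left_ev.
apply: tev_teqr (IH _ Hws).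
by rewrite rev_cat rev_cons -!cats1 -!catA.
Qed.

(** Insertion of a symbol: the symbol in hand is exchanged with the scanned one up to the first
    blank, so that the head ends to the right of all registers again. *)
Definition carry (a : sym) : mach unit :=
  auto (fun (c a : sym) =>
    if a == FB then (c, MoveR, inr tt) else (c, MoveR, inl a)) a.

Lemma carry_ev c l u F : all (fun a => a != FB) u -> all (pred1 FB) F ->
  tev (carry c) (l, u ++ F) (size u).+1 tt (rev (c :: u) ++ l, behead F).
Proof.
rewrite /carry => Hu HF; apply: ev_tev => /=; move: {1}c => c0.
elim: u c l Hu => [|x u IH] c l /=.
  move=> _; apply: (@ev_auto_stop n _ _ _ c0 c (l, F) c MoveR) => /=.
  by case: F HF => [|y F] //= /andP [-> _].
case/andP=> /negbTE Hx Hu.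
apply: (@ev_auto_step _ _ _ _ _ _ x _ _ c MoveR) => /=; first by rewrite Hx.
by rewrite rev_cons cat_rcons; apply: IH.
Qed.

Definition go_right : mach unit :=
  auto (fun (c : unit) (a : sym) =>
    if a == FB then (a, Stay, inr tt) else (a, MoveR, inl tt)) tt.

Lemma go_right_ev l u F : all (fun a => a != FB) u -> all (pred1 FB) F ->
  tev go_right (l, u ++ F) (size u).+1 tt (rev u ++ l, F).
Proof.
rewrite /go_right => Hu HF.
apply: (@tev_teqr _ _ _ _ _ (rev u ++ l, FB :: behead F)).
  by case: F HF => [|y F] //= /andP [/eqP -> _].
apply: ev_tev => /=.
elim: u l Hu => [|x u IH] l /=.
  move=> _; have := @ev_auto_stop n _ _ (fun (c : unit) (a : sym) =>
    if a == FB then (a, Stay, inr tt) else (a, MoveR, inl tt)) tt tt (l, F) FB Stay tt.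
  apply; by case: F HF => [|y F] //= /andP [/eqP -> _].
case/andP=> /negbTE Hx Hu.
apply: (@ev_auto_step _ _ _ _ _ _ tt _ _ x MoveR) => /=; first by rewrite Hx.
by rewrite rev_cons cat_rcons; apply: IH.
Qed.

(* States: None stands on the cell to overwrite, Some None reads its right   *)
(* neighbour, Some (Some a) writes the symbol a just read one cell leftwards. *)
Definition delete_step (c : option (option sym)) (a : sym) :
    sym * move * (option (option sym) + unit) :=
  match c with
  | None => (a, MoveR, inl (Some None))
  | Some None => (a, MoveL, inl (Some (Some a)))
  | Some (Some b) => if b == FB then (FB, Stay, inr tt) else (b, MoveR, inl None)
  end.

Definition delete : mach unit := auto delete_step None.

Lemma delete_ev l x u F : all (fun a => a != FB) u -> all (pred1 FB) F ->
  tev delete (l, x :: u ++ F) (3 * (size u).+1) tt (rev u ++ l, FB :: FB :: behead F).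
Proof.
rewrite /delete => Hu HF; apply: ev_tev => /=.
have EF : head FB F = FB by case: F HF => [|y F] //= /andP [/eqP -> _].
elim: u x l Hu => [|y u IH] x l /=.
  move=> _; apply: (@ev_auto_step _ _ _ _ _ _ (Some None) _ _ x MoveR) => //=.
  apply: (@ev_auto_step _ _ _ _ _ _ (Some (Some FB)) _ _ FB MoveL) => //=.
    by rewrite EF.
  exact: (@ev_auto_stop n _ _ delete_step None (Some (Some FB)) (l,
    x :: FB :: behead F) FB Stay tt).
case/andP=> /negbTE Hx Hu.
rewrite (_ : 3 * (size u).+2 = (3 * (size u).+1).+3); last lia.
apply: (@ev_auto_step _ _ _ _ _ _ (Some None) _ _ x MoveR) => //=.
apply: (@ev_auto_step _ _ _ _ _ _ (Some (Some y)) _ _ y MoveL) => //=.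
apply: (@ev_auto_step _ _ _ _ _ _ None _ _ y MoveR) => //=; first by rewrite Hx.
by rewrite rev_cons cat_rcons; apply: IH.
Qed.

(** On an empty register the head returns to the cell it came from; otherwise it remains on the top
    symbol, which is the cell that [delete] overwrites. *)
Definition peek : mach (option sym) :=
  auto (fun (s : bool) (a : sym) =>
    if s then (if a == SEP then (a, MoveR, inr None) else (a, Stay, inr (Some a)))
    else (a, MoveL, inl true)) false.

Lemma peek_some x l (s : seq sym) : x != SEP ->
  tev peek (x :: l, s) 2 (Some x) (l, x :: head FB s :: behead s).
Proof.
move=> /negbTE Hx; apply: ev_tev.
apply: (@ev_auto_step _ _ _ _ _ _ true _ _ (head FB s) MoveL) => //=.
have := @ev_auto_stop n _ _ (fun (s : bool) (a : sym) =>
    if s then (if a == SEP then (a, MoveR, inr None) else (a, Stay, inr (Some a)))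
    else (a, MoveL, inl true)) false true (l, x :: head FB s :: behead s) x Stay (Some x).
by apply; rewrite /= Hx.
Qed.

Lemma peek_none l (s : seq sym) :
  tev peek (SEP :: l, s) 2 None (SEP :: l, head FB s :: behead s).
Proof.
apply: ev_tev.
apply: (@ev_auto_step _ _ _ _ _ _ true _ _ (head FB s) MoveL) => //=.
exact: (@ev_auto_stop n _ _ (fun (s : bool) (a : sym) =>
    if s then (if a == SEP then (a, MoveR, inr None) else (a, Stay, inr (Some a)))
    else (a, MoveL, inl true)) false true (l, SEP :: head FB s :: behead s) SEP MoveR None).
Qed.

Definition push (i : nat) (a : sym) : mach unit := bind (skipn i) (fun _ => carry a).

Definition pop (i : nat) : mach (option sym) :=
  bind (skipn i) (fun _ => bind peek (fun o =>
    bind (if o is Some _ then delete else go_right) (fun _ => ret n o))).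

Definition rep (t : tape) (regs : seq (seq sym)) :=
  [/\ t.1 = flat regs, all (pred1 FB) t.2 & all (all (@content n)) regs].

Lemma rep_teq t t' regs : teq t t' -> rep t regs -> rep t' regs.
Proof.
case: t t' => [l s] [l' s'] [/= -> E] [/= -> H1 H2]; split=> //=.
have : all (pred1 FB) (head FB s' :: behead s').
  by rewrite -E; case: s H1 {E}.
by case: s' {E}.
Qed.

Lemma flat_noFB ws : all (all (@content n)) ws -> all (fun a => a != FB) (flat ws).
Proof.
elim: ws => //= w ws IH /andP [Hw /IH H]; rewrite flat_cons all_cat /= H andbT.
by apply: sub_all Hw => x /andP [].
Qed.

(** The cost [k] counts stack operations and hand-overs. Each takes time linear in the tape and
    lengthens it by at most one cell. The bound [Z] on the tape over the whole run is fixed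
    beforehand, so that costs of consecutive programs simply add up. *)
Definition runs L (M : mach L) (regs : seq (seq sym)) k l regs' :=
  forall Z t, rep t regs -> size (flat regs) + k <= Z ->
  exists t' k', [/\ ev (m0 M) t k' l t', rep t' regs', k' <= k * (10 * Z + 20)
    & size (flat regs') <= size (flat regs) + k].

Lemma tev_runs L (M : mach L) regs l regs' :
  (forall t, rep t regs -> exists2 t',
    tev M t (10 * size (flat regs) + 20) l t' & rep t' regs') ->
  size (flat regs') <= (size (flat regs)).+1 ->
  runs M regs 1 l regs'.
Proof.
move=> H Hs Z t Ht HZ; have [t' [t'' [k' [? H1 E1]]] H2] := H t Ht.
exists t'', k'; split=> //; last by lia.
  exact: rep_teq (teq_sym E1) H2.
lia.
Qed.

Lemma runs_ret L (l : L) regs : runs (ret n l) regs 0 l regs.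
Proof. by move=> Z t Ht HZ; exists t, 0; split=> //; [apply: ev_ret | lia]. Qed.

Lemma runs_le L (M : mach L) regs k k' l regs' : k <= k' ->
  runs M regs k l regs' -> runs M regs k' l regs'.
Proof.
move=> Hk H Z t Ht HZ; have [|t' [k1 [H1 H2 H3 H4]]] := H Z t Ht; first lia.
by exists t', k1; split=> //; nia.
Qed.

Lemma runs_bind (L1 : finType) L2 (M1 : mach L1) (M2 : L1 -> mach L2) r k1 l1 r1 k2 l2 r2 :
  runs M1 r k1 l1 r1 -> runs (M2 l1) r1 k2 l2 r2 -> runs (bind M1 M2) r (k1 + k2).+1 l2 r2.
Proof.
move=> H1 H2 Z t Ht HZ.
have [|t1 [k1' [E1 R1 T1 S1]]] := H1 Z t Ht; first lia.
have [|t2 [k2' [E2 R2 T2 S2]]] := H2 Z t1 R1; first lia.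
have [t3 E3 Q3] := ev_bind E1 E2.
exists t3, (k1' + k2'.+1); split=> //; [exact: rep_teq R2|nia|lia].
Qed.

Lemma runs_iter_stop (S : finType) L (B : S -> mach (S + L)) s r k l r' :
  runs (B s) r k (inr l) r' -> runs (iterm B s) r k l r'.
Proof.
move=> H Z t Ht HZ; have [t' [k' [H1 H2 H3 H4]]] := H Z t Ht HZ.
by exists t', k'; split=> //; apply: ev_iter_stop.
Qed.

Lemma runs_iter_step (S : finType) L (B : S -> mach (S + L)) s s' r k1 r1 k2 l r2 :
  runs (B s) r k1 (inl s') r1 -> runs (iterm B s') r1 k2 l r2 ->
  runs (iterm B s) r (k1 + k2).+1 l r2.
Proof.
move=> H1 H2 Z t Ht HZ.
have [|t1 [k1' [E1 R1 T1 S1]]] := H1 Z t Ht; first lia.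
have [|t2 [k2' [E2 R2 T2 S2]]] := H2 Z t1 R1; first lia.
have [t3 E3 Q3] := ev_iter_step E1 E2.
exists t3, (k1' + k2'.+1); split=> //; [exact: rep_teq R2|nia|lia].
Qed.

Lemma runs_size L (M : mach L) r k l r' : all (all (@content n)) r ->
  runs M r k l r' -> size (flat r') <= size (flat r) + k.
Proof.
move=> Hr H; have [||t' [k' []]] := H (size (flat r) + k) (flat r, [::]) => //.
Qed.

Lemma regs_split (regs : seq (seq sym)) i : i < size regs ->
  exists ws w ws', [/\ regs = ws ++ w :: ws', size ws = i & w = nth [::] regs i].
Proof.
move=> Hi; exists (take i regs), (nth [::] regs i), (drop i.+1 regs).
by rewrite -drop_nth // cat_take_drop size_takel // ltnW.
Qed.

Lemma runs_push regs i a : i < size regs -> content a ->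
  runs (push i a) regs 1 tt (set_nth [::] regs i (a :: nth [::] regs i)).
Proof.
move=> Hi Ha; have [ws [w [ws' [E Ews Ew]]]] := regs_split Hi.
rewrite -Ew {Ew}; subst regs.
have -> : set_nth [::] (ws ++ w :: ws') i (a :: w) = ws ++ (a :: w) :: ws'.
  by rewrite set_nthE Hi -Ews take_size_cat // drop_cat ltnNge leqnSn /= subSnn /= drop0.
apply: tev_runs; last by rewrite !(size_cat, flat_cat, flat_cons) /= ?size_cat /=; lia.
move=> [l s] [/= -> Hs Hc].
have /andP [Hws Hw] : all (all (@content n)) ws && all (all (@content n)) (w :: ws').
  by rewrite -all_cat.
exists (flat (ws ++ (a :: w) :: ws'), behead s); last first.
  split=> //=; first by case: s Hs => //= ? ? /andP [].
  by rewrite all_cat Hws /= Ha.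
rewrite !flat_cat !size_cat -Ews.
apply: (@tev_le _ _ _ (3 * size (flat ws) + (size (rev (flat ws))).+1).+1).
  rewrite size_rev; lia.
apply: tev_bind; first exact: skipn_ev.
apply: tev_teqr; last first.
  apply: carry_ev; first by rewrite all_rev flat_noFB.
  by case: s Hs.
by rewrite rev_cons revK cat_rcons !flat_cons.
Qed.

Lemma runs_pop regs i : i < size regs ->
  runs (pop i) regs 1 (ohead (nth [::] regs i)) (set_nth [::] regs i (behead
    (nth [::] regs i))).
Proof.
move=> Hi; have [ws [w [ws' [E Ews Ew]]]] := regs_split Hi.
rewrite -Ew {Ew}; subst regs.
have -> : set_nth [::] (ws ++ w :: ws') i (behead w) = ws ++ (behead w) :: ws'.
  by rewrite set_nthE Hi -Ews take_size_cat // drop_cat ltnNge leqnSn /= subSnn /= drop0.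
apply: tev_runs; last first.
  by rewrite !(size_cat, flat_cat, flat_cons) /= ?size_cat ?size_behead /=; lia.
move=> [l s] [/= -> Hs Hc].
have /and3P [Hws Hw Hws'] : [&& all (all (@content n)) ws,
  all (@content n) w & all (all (@content n)) ws'].
  by rewrite all_cat /= in Hc.
have [s' Hs' {}H] : exists2 s', all (pred1 FB) s' & 
    tev (pop i) (flat (ws ++ w :: ws'), s) (10 * size (flat (ws ++ w :: ws')) + 20) (ohead w)
     (flat (ws ++ behead w :: ws'), s'); last first.
  exists (flat (ws ++ behead w :: ws'), s') => //.
  split=> //=; rewrite all_cat Hws /= Hws' andbT; by case: (w) Hw => //= ? ? /andP [].
have Hs2 : all (pred1 FB) (head FB s :: behead s) by case: (s) Hs.
have Hrev : all (fun a => a != FB) (rev (flat ws)) by rewrite all_rev flat_noFB.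
rewrite !flat_cat !size_cat -Ews.
case: w Hw Hc {Hi} => [|x w] /= Hw Hc.
  exists (head FB s :: behead s) => //.
  apply: (@tev_le _ _ _ (3 * size (flat ws) + (2 + ((size (rev (flat ws))).+1 + 0).+1).+1).+1).
    rewrite size_rev; lia.
  apply: tev_bind; first exact: skipn_ev.
  apply: tev_bind; first exact: peek_none.
  apply: tev_bind; last by apply: ev_tev; apply: ev_ret.
  apply: tev_teqr; last first.
    apply: tev_teql; last exact: (@go_right_ev (SEP :: flat ws') (rev (flat ws))
      (head FB s :: behead s)).
    by split; rewrite /=; case: (rev (flat ws)).
  by rewrite revK.
exists (FB :: FB :: behead s); first by case: (s) Hs => [|? ?] //= /andP [].
apply: (@tev_le _ _ _ (3 * size (flat ws) + (2 + ((3 * (size (rev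
  (flat ws))).+1) + 0).+1).+1).+1).
  rewrite size_rev; lia.
apply: tev_bind; first exact: skipn_ev.
rewrite flat_cons; apply: tev_bind; first by apply: peek_some; case/andP: Hw => /andP [].
apply: tev_bind; last by apply: ev_tev; apply: ev_ret.
apply: tev_teqr; last first.
  apply: tev_teql; last exact: (@delete_ev (w ++ SEP :: flat ws') x (rev (flat ws))
    (head FB s :: behead s)).
    by split; rewrite /=; case: (rev (flat ws)).
by rewrite revK flat_cons.
Qed.

End Registers.

(** * Trees on a stack *)

Inductive tree := Leaf | Node of tree & tree.

Fixpoint tree_size (t : tree) : nat := if t is Node a b then
  (tree_size a + tree_size b).+1 else 1.

Ltac rle := eapply runs_le; last first.
Ltac rb H := eapply runs_bind; [exact: H |].

Section Programs.
Variable n : nat.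
Local Notation sym := (sym n).
Local Notation mach := (mach n).
Local Notation b0 := (b0 n).
Local Notation b1 := (b1 n).
Local Notation ret := (@ret n _).
Local Notation push := (@push n).
Local Notation pop := (@pop n).
Local Notation content := (@content n).

(** Polish notation delimits itself, so trees can lie on one stack without separators. *)
Fixpoint pol (t : tree) : seq sym :=
  if t is Node a b then b1 :: pol a ++ pol b else [:: b0].

Lemma size_pol t : size (pol t) = tree_size t.
Proof. by elim: t => //= a <- b <-; rewrite size_cat. Qed.

Lemma tree_size_gt0 t : 0 < tree_size t.
Proof. by case: t. Qed.

Lemma pol_content t : all content (pol t).
Proof. by elim: t => //= a Ha b Hb; rewrite all_cat Ha Hb. Qed.

Lemma pol_cat_inj t t' s s' : pol t ++ s = pol t' ++ s' -> t = t' /\ s = s'.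
Proof.
elim: t t' s s' => [|a IHa b IHb] [|a' b'] s s' //=; first by case.
by case; rewrite -!catA => /IHa [-> /IHb [-> ->]].
Qed.

Lemma pol_inj : injective pol.
Proof. by move=> t t' H; case: (@pol_cat_inj t t' [::] [::]); rewrite ?cats0. Qed.

(* Register 0 is a work register, 1 the stack of trees, 2 and 3 are work registers. *)
Definition foreach (i : nat) (f : sym -> mach unit) : mach unit :=
  iterm (fun _ : unit => bind (pop i) (fun o =>
    if o is Some a then bind (f a) (fun _ => ret (inl tt)) else ret (inr tt))) tt.

(** [st d w] describes the registers when the symbols [d] have been processed, the latest first, and
    [w] is still in register [i]. *)
Lemma foreach_runs i f (st : seq sym -> seq sym -> seq (seq sym)) k d w :
  (forall d w, i < size (st d w)) -> (forall d w, nth [::] (st d w) i = w) ->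
  (forall d x w, content x ->
    runs (f x) (set_nth [::] (st d (x :: w)) i w) k tt (st (x :: d) w)) ->
  (forall d, set_nth [::] (st d [::]) i [::] = st d [::]) ->
  all content w ->
  runs (foreach i f) (st d w) ((k + 4) * size w + 2) tt (st (catrev w d) [::]).
Proof.
move=> Hi Hn Hf H0; elim: w d => [|x w IH] d /=.
  move=> _; rle; first apply: runs_iter_stop.
    have Hp := runs_pop (Hi d [::]); rewrite Hn /= H0 in Hp.
    rb Hp; exact: runs_ret.
  lia.
case/andP=> Hx /IH{}IH; rle; first apply: runs_iter_step (IH _).
  have Hp := runs_pop (Hi d (x :: w)); rewrite Hn /= in Hp.
  rb Hp; rb (Hf d x w Hx); exact: runs_ret.
lia.
Qed.

Definition clear (i : nat) : mach unit := foreach i (fun _ => ret tt).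

Lemma clear0_runs A V B C : all content A ->
  runs (clear 0) [:: A; V; B; C] (4 * size A + 2) tt [:: [::]; V; B; C].
Proof.
move=> HA.
have := @foreach_runs 0 (fun _ => ret tt) (fun _ w => [:: w; V; B; C]) 0 [::] A.
by apply=> // *; apply: runs_ret.
Qed.

Lemma clear2_runs A V B C : all content B ->
  runs (clear 2) [:: A; V; B; C] (4 * size B + 2) tt [:: A; V; [::]; C].
Proof.
move=> HA.
have := @foreach_runs 2 (fun _ => ret tt) (fun _ w => [:: A; V; w; C]) 0 [::] B.
by apply=> // *; apply: runs_ret.
Qed.

Lemma clear3_runs A V B C : all content C ->
  runs (clear 3) [:: A; V; B; C] (4 * size C + 2) tt [:: A; V; B; [::]].
Proof.
move=> HA.
have := @foreach_runs 3 (fun _ => ret tt) (fun _ w => [:: A; V; B; w]) 0 [::] C.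
by apply=> // *; apply: runs_ret.
Qed.

Definition pour (i j : nat) : mach unit := foreach i (push j).

Lemma pour01_runs A V B C : all content A ->
  runs (pour 0 1) [:: A; V; B; C] (5 * size A + 2) tt [:: [::]; rev A ++ V; B; C].
Proof.
move=> HA; have := @foreach_runs 0 (push 1) (fun d w => [:: w; d ++ V; B; C]) 1 [::] A.
apply=> // d x w Hx; exact: (@runs_push n [:: w; d ++ V; B; C] 1 x).
Qed.

Lemma pour02_runs A V B C : all content A ->
  runs (pour 0 2) [:: A; V; B; C] (5 * size A + 2) tt [:: [::]; V; rev A ++ B; C].
Proof.
move=> HA; have := @foreach_runs 0 (push 2) (fun d w => [:: w; V; d ++ B; C]) 1 [::] A.
apply=> // d x w Hx; exact: (@runs_push n [:: w; V; d ++ B; C] 2 x).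
Qed.

Lemma pour20_runs A V B C : all content B ->
  runs (pour 2 0) [:: A; V; B; C] (5 * size B + 2) tt [:: rev B ++ A; V; [::]; C].
Proof.
move=> HA; have := @foreach_runs 2 (push 0) (fun d w => [:: d ++ A; V; w; C]) 1 [::] B.
apply=> // d x w Hx; exact: (@runs_push n [:: d ++ A; V; w; C] 0 x).
Qed.

Lemma pour23_runs A V B C : all content B ->
  runs (pour 2 3) [:: A; V; B; C] (5 * size B + 2) tt [:: A; V; [::]; rev B ++ C].
Proof.
move=> HA; have := @foreach_runs 2 (push 3) (fun d w => [:: A; V; w; d ++ C]) 1 [::] B.
apply=> // d x w Hx; exact: (@runs_push n [:: A; V; w; d ++ C] 3 x).
Qed.

Lemma pour31_runs A V B C : all content C ->
  runs (pour 3 1) [:: A; V; B; C] (5 * size C + 2) tt [:: A; rev C ++ V; B; [::]].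
Proof.
move=> HA; have := @foreach_runs 3 (push 1) (fun d w => [:: A; d ++ V; B; w]) 1 [::] C.
apply=> // d x w Hx; exact: (@runs_push n [:: A; d ++ V; B; w] 1 x).
Qed.

Definition copy : mach unit :=
  foreach 0 (fun a => bind (push 1 a) (fun _ => push 2 a)).

Lemma copy_runs A V B C : all content A ->
  runs copy [:: A; V; B; C] (7 * size A + 2) tt [:: [::]; rev A ++ V; rev A ++ B; C].
Proof.
move=> HA; have := @foreach_runs 0 (fun a => bind (push 1 a) (fun _ => push 2 a))
   (fun d w => [:: w; d ++ V; d ++ B; C]) 3 [::] A.
apply=> // d x w Hx; apply: (runs_bind (k1 := 1) (k2 := 1)).
  exact: (@runs_push n [:: w; d ++ V; d ++ B; C] 1 x).
exact: (@runs_push n [:: w; x :: d ++ V; d ++ B; C] 2 x).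
Qed.

(* Register 3 holds one mark for each subtree still to be read. *)
Definition take_loop : mach unit :=
  iterm (fun _ : unit => bind (pop 3) (fun o =>
    if o is Some _ then bind (pop 1) (fun o' =>
      if o' is Some a then bind (push 0 a) (fun _ =>
        if a == b1 then bind (push 3 b1) (fun _ => bind (push 3 b1) (fun _ => ret (inl tt)))
        else ret (inl tt)) else ret (inr tt)) else ret (inr tt))) tt.

Lemma take_loop_runs t A V B C k R :
  runs take_loop [:: rev (pol t) ++ A; V; B; C] k tt R ->
  runs take_loop [:: A; pol t ++ V; B; b1 :: C] (12 * size (pol t) + k) tt R.
Proof.
elim: t A V C k => [|a IHa b IHb] A V C k H /=.
  rle; first apply: runs_iter_step H.
    rb (@runs_pop n [:: A; b0 :: V; B; b1 :: C] 3 isT).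
    rb (@runs_pop n [:: A; b0 :: V; B; C] 1 isT).
    rb (@runs_push n [:: A; V; B; C] 0 b0 isT isT).
    exact: runs_ret.
  lia.
have {}H : runs take_loop [:: b1 :: A; pol a ++ pol b ++ V; B; b1 :: b1 :: C]
  (12 * size (pol a) + (12 * size (pol b) + k)) tt R.
  by apply/IHa/IHb; rewrite catA -rev_cat -cat_rcons -rev_cons.
rle; first apply: runs_iter_step H.
  rewrite -catA.
  rb (@runs_pop n [:: A; b1 :: pol a ++ pol b ++ V; B; b1 :: C] 3 isT).
  rb (@runs_pop n [:: A; b1 :: pol a ++ pol b ++ V; B; C] 1 isT).
  rb (@runs_push n [:: A; pol a ++ pol b ++ V; B; C] 0 b1 isT isT).
  rb (@runs_push n [:: b1 :: A; pol a ++ pol b ++ V; B; C] 3 b1 isT isT).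
  rb (@runs_push n [:: b1 :: A; pol a ++ pol b ++ V; B; b1 :: C] 3 b1 isT isT).
  exact: runs_ret.
rewrite size_cat; lia.
Qed.

Definition take_tree : mach unit := bind (push 3 b1) (fun _ => take_loop).

Lemma take_tree_runs t A V B :
  runs take_tree [:: A; pol t ++ V; B; [::]] (16 * tree_size t) tt
    [:: rev (pol t) ++ A; V; B; [::]].
Proof.
rle.
  rb (@runs_push n [:: A; pol t ++ V; B; [::]] 3 b1 isT isT).
  apply: take_loop_runs; apply: runs_iter_stop.
  rb (@runs_pop n [:: rev (pol t) ++ A; V; B; [::]] 3 isT); exact: runs_ret.
by rewrite size_pol; have := tree_size_gt0 t; lia.
Qed.

Lemma take_tree_runs0 t V B :
  runs take_tree [:: [::]; pol t ++ V; B; [::]] (16 * tree_size t) tt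
    [:: rev (pol t); V; B; [::]].
Proof. by have := @take_tree_runs t [::] V B; rewrite cats0. Qed.

Definition state (V : seq sym) : seq (seq sym) := [:: [::]; V; [::]; [::]].

Definition drop_tree : mach unit := bind take_tree (fun _ => clear 0).

Lemma rev_pol_content t : all content (rev (pol t)).
Proof. by rewrite all_rev pol_content. Qed.

Lemma drop_tree_runs t V :
  runs drop_tree (state (pol t ++ V)) (32 * tree_size t) tt (state V).
Proof.
rle; first by rb (@take_tree_runs0 t V [::]); apply/clear0_runs/rev_pol_content.
by rewrite size_rev size_pol; have := tree_size_gt0 t; lia.
Qed.

Definition dup_tree : mach unit :=
  bind take_tree (fun _ => bind copy (fun _ => bind (pour 2 0) (fun _ => pour 0 1))).

Lemma dup_tree_runs t V :
  runs dup_tree (state (pol t ++ V)) (64 * tree_size t) tt (state (pol t ++ pol t ++ V)).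
Proof.
rle.
  rb (@take_tree_runs0 t V [::]).
  rb (@copy_runs _ V [::] [::] (rev_pol_content t)); rewrite revK cats0.
  rb (@pour20_runs [::] (pol t ++ V) _ [::] (pol_content t)); rewrite cats0.
  have := @pour01_runs _ (pol t ++ V) [::] [::] (rev_pol_content t).
  rewrite revK; exact.
by rewrite !size_rev size_pol; have := tree_size_gt0 t; lia.
Qed.

Definition swap_tree : mach unit :=
  bind take_tree (fun _ => bind (pour 0 2) (fun _ => bind take_tree (fun _ =>
  bind (pour 2 3) (fun _ => bind (pour 3 1) (fun _ => pour 0 1))))).

Lemma swap_tree_runs a b V :
  runs swap_tree (state (pol a ++ pol b ++ V)) (64 * (tree_size a + tree_size b)) tt
    (state (pol b ++ pol a ++ V)).
Proof.
rle.
  rb (@take_tree_runs0 a (pol b ++ V) [::]).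
  rb (@pour02_runs _ (pol b ++ V) [::] [::] (rev_pol_content a)); rewrite revK cats0.
  rb (@take_tree_runs0 b V (pol a)).
  rb (@pour23_runs (rev (pol b)) V _ [::] (pol_content a)); rewrite cats0.
  rb (@pour31_runs (rev (pol b)) V [::] _ (rev_pol_content a)); rewrite revK.
  have := @pour01_runs _ (pol a ++ V) [::] [::] (rev_pol_content b).
  rewrite revK; exact.
by rewrite !size_rev !size_pol; have := tree_size_gt0 a; have := tree_size_gt0 b; lia.
Qed.

Definition compare_loop : mach bool :=
  iterm (fun _ : unit => bind (pop 0) (fun o => bind (pop 3) (fun o' =>
    match o, o' with
    | None, None => ret (inr true)
    | Some x, Some y => ret (if x == y then inl tt else inr false)
    | _, _ => ret (inr false)
    end))) tt.

(** The loop stops at the first difference and leaves unspecified remainders; knowing their size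
    suffices to clear them afterwards. *)
Lemma compare_loop_runs w w' V B : all content w -> all content w' ->
  exists r r', [/\ runs compare_loop [:: w; V; B; w'] (5 * (size w).+1) (w == w')
     [:: r; V; B; r'], all content r, all content r', size r <= size w & size r' <= size w'].
Proof.
elim: w w' => [|x w IH] [|y w'] Hw Hw'.
- exists [::], [::]; split=> //; rle; first apply: runs_iter_stop.
    rb (@runs_pop n [:: [::]; V; B; [::]] 0 isT).
    rb (@runs_pop n [:: [::]; V; B; [::]] 3 isT); exact: runs_ret.
  lia.
- exists [::], w'; split=> //; last by case/andP: Hw'.
  rle; first apply: runs_iter_stop.
    rb (@runs_pop n [:: [::]; V; B; y :: w'] 0 isT).
    rb (@runs_pop n [:: [::]; V; B; y :: w'] 3 isT); exact: runs_ret.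
  lia.
- exists w, [::]; split=> //; last by case/andP: Hw.
  rle; first apply: runs_iter_stop.
    rb (@runs_pop n [:: x :: w; V; B; [::]] 0 isT).
    rb (@runs_pop n [:: w; V; B; [::]] 3 isT); exact: runs_ret.
  lia.
case/andP: Hw => Hx Hw; case/andP: Hw' => Hy Hw'.
rewrite eqseq_cons; case: (altP (x =P y)) => Exy.
  have [r [r' [H H1 H2 H3 H4]]] := IH w' Hw Hw'.
  exists r, r'; split=> //=; try lia.
  rle; first apply: runs_iter_step H.
    rb (@runs_pop n [:: x :: w; V; B; y :: w'] 0 isT).
    rb (@runs_pop n [:: w; V; B; y :: w'] 3 isT) => /=.
    rewrite Exy eqxx; exact: runs_ret.
  lia.
exists w, w'; split=> //=.
rle; first apply: runs_iter_stop.
  rb (@runs_pop n [:: x :: w; V; B; y :: w'] 0 isT).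
  rb (@runs_pop n [:: w; V; B; y :: w'] 3 isT) => /=.
  rewrite (negbTE Exy); exact: runs_ret.
lia.
Qed.

Definition bool_tree (b : bool) : tree := if b then Node Leaf Leaf else Leaf.

Definition push_bool (b : bool) : mach unit :=
  bind (push 1 b0) (fun _ => if b then bind (push 1 b0) (fun _ => push 1 b1) else ret tt).

Lemma push_bool_runs b V :
  runs (push_bool b) (state V) 6 tt (state (pol (bool_tree b) ++ V)).
Proof.
case: b; rle.
- rb (@runs_push n (state V) 1 b0 isT isT).
  rb (@runs_push n (state (b0 :: V)) 1 b0 isT isT).
  exact: (@runs_push n (state (b0 :: b0 :: V)) 1 b1 isT isT).
- by [].
- rb (@runs_push n (state V) 1 b0 isT isT); exact: runs_ret.
by [].
Qed.

Definition eq_tree : mach unit :=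
  bind take_tree (fun _ => bind (pour 0 2) (fun _ => bind take_tree (fun _ =>
  bind (pour 2 3) (fun _ => bind compare_loop (fun b =>
  bind (clear 0) (fun _ => bind (clear 3) (fun _ => push_bool b))))))).

Lemma eq_tree_runs a b V (c : bool) : (c <-> a = b) ->
  runs eq_tree (state (pol a ++ pol b ++ V)) (64 * (tree_size a + tree_size b)) tt
    (state (pol (bool_tree c) ++ V)).
Proof.
move=> Hc.
have [r [r' [H H1 H2 H3 H4]]] :=
  @compare_loop_runs (rev (pol b)) (rev (pol a)) V [::] (rev_pol_content b) (rev_pol_content a).
have Ec : (rev (pol b) == rev (pol a)) = c.
  apply/eqP/idP => [/(congr1 rev)|/Hc -> //].
  by rewrite !revK => /pol_inj E; apply/Hc.
rewrite Ec in H.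
rle.
  rb (@take_tree_runs0 a (pol b ++ V) [::]).
  rb (@pour02_runs _ (pol b ++ V) [::] [::] (rev_pol_content a)); rewrite revK cats0.
  rb (@take_tree_runs0 b V (pol a)).
  rb (@pour23_runs (rev (pol b)) V _ [::] (pol_content a)); rewrite cats0.
  rb H.
  rb (@clear0_runs _ V [::] r' H1).
  rb (@clear3_runs [::] V [::] _ H2).
  exact: push_bool_runs.
move: H3 H4; rewrite !size_rev !size_pol.
by have := tree_size_gt0 a; have := tree_size_gt0 b; lia.
Qed.

Definition pop_bool : mach bool :=
  bind (pop 1) (fun o => if o == Some b1 then
    bind (pop 1) (fun _ => bind (pop 1) (fun _ => ret true)) else ret false).

Lemma pop_bool_runs b V :
  runs pop_bool (state (pol (bool_tree b) ++ V)) 6 b (state V).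
Proof.
case: b; rle.
- rb (@runs_pop n (state (b1 :: b0 :: b0 :: V)) 1 isT).
  rb (@runs_pop n (state (b0 :: b0 :: V)) 1 isT).
  rb (@runs_pop n (state (b0 :: V)) 1 isT); exact: runs_ret.
- by [].
- rb (@runs_pop n (state (b0 :: V)) 1 isT); exact: runs_ret.
by [].
Qed.

Definition peek_leaf : mach bool :=
  bind (pop 1) (fun o => let a := odflt b0 o in
    bind (push 1 a) (fun _ => ret (a == b0))).

Definition is_leaf t := if t is Leaf then true else false.

Lemma peek_leaf_runs t V :
  runs peek_leaf (state (pol t ++ V)) 4 (is_leaf t) (state (pol t ++ V)).
Proof.
case: t => [|a b]; rle.
- rb (@runs_pop n (state (b0 :: V)) 1 isT).
  rb (@runs_push n (state V) 1 b0 isT isT); exact: runs_ret.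
- by [].
- rb (@runs_pop n (state (b1 :: (pol a ++ pol b) ++ V)) 1 isT).
  rb (@runs_push n (state ((pol a ++ pol b) ++ V)) 1 b1 isT isT); exact: runs_ret.
by [].
Qed.

End Programs.

(** * Polynomial-time functions on encoded data *)

Class Enc (T : Type) := tenc : T -> tree.
Instance enc_unit : Enc unit := fun _ => Leaf.
Instance enc_bool : Enc bool := bool_tree.
Instance enc_prod A B `{Enc A} `{Enc B} : Enc (A * B) :=
  fun p => Node (tenc p.1) (tenc p.2).
Instance enc_seq A `{Enc A} : Enc (seq A) :=
  fix f s := if s is x :: s' then Node (tenc x) (f s') else Leaf.
(** Unary numbers: a number used as a counter then contributes its value to the size that time
    bounds refer to. *)
Instance enc_natural : Enc nat :=
  fix f m := if m is m'.+1 then Node Leaf (f m') else Leaf.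

Class EncInj (T : Type) (e : Enc T) := tenc_inj : injective (tenc (T := T)).
Arguments EncInj T {e}.
Instance enc_inj_bool : EncInj bool.
Proof. by case; case. Qed.
Instance enc_inj_prod A B {ea : Enc A} {eb : Enc B} {ia : EncInj A} {ib : EncInj B} : EncInj
  (A * B).
Proof. by case=> [a b] [a' b'] [/ia -> /ib ->]. Qed.
Instance enc_inj_seq A {ea : Enc A} {ia : EncInj A} : EncInj (seq A).
Proof. by elim=> [|x s IH] [|y t] //= [/ia -> /IH ->]. Qed.
Instance enc_inj_nat : EncInj nat.
Proof. by elim=> [|x IH] [|y] //= [/IH ->]. Qed.

Definition esz T `{Enc T} (x : T) := tree_size (tenc x).

Lemma esz_pair A B `{Enc A} `{Enc B} (a : A) (b : B) : esz (a, b) = (esz a + esz b).+1.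
Proof. by []. Qed.

Lemma esz_cons A `{Enc A} (a : A) (s : seq A) : esz (a :: s) = (esz a + esz s).+1.
Proof. by []. Qed.

Lemma esz_nil A `{Enc A} : esz (@nil A) = 1.
Proof. by []. Qed.

Lemma esz_gt0 T `{Enc T} (x : T) : 0 < esz x.
Proof. exact: tree_size_gt0. Qed.

Lemma esz_bool (b : bool) : esz b <= 3.
Proof. by case: b. Qed.

(** * Arithmetic of bounds [(s + 2) ^ c]; the base is at least 2, so constants move into the
    exponent *)

Lemma pow_add s a b : (s + 2) ^ a + (s + 2) ^ b <= (s + 2) ^ (a + b + 1).
Proof.
rewrite !expnD expn1; have := expn_gt0 (s + 2) a; have := expn_gt0 (s + 2) b.
rewrite addn2 /=; nia.
Qed.

Lemma pow_le s a b : a <= b -> (s + 2) ^ a <= (s + 2) ^ b.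
Proof. by move=> H; apply: leq_pexp2l => //; rewrite addn2. Qed.

Lemma pow_const s c : 2 ^ c <= (s + 2) ^ c.
Proof. by case: c => // c; rewrite leq_exp2r // addn2. Qed.

Lemma pow_mul c s a : 2 ^ c * (s + 2) ^ a <= (s + 2) ^ (c + a).
Proof. by rewrite expnD leq_mul2r pow_const orbT. Qed.

Lemma pow_mono s t c : s <= t -> (s + 2) ^ c <= (t + 2) ^ c.
Proof. by case: c => // c H; rewrite leq_exp2r // leq_add2r. Qed.

Lemma pow_comp s m a b : m <= (s + 2) ^ a -> (m + 2) ^ b <= (s + 2) ^ ((a + 2) * b).
Proof.
case: b => [|b] H; first by rewrite muln0.
rewrite expnM leq_exp2r //; apply: leq_trans (leq_add H (leqnn 2)) _.
by rewrite expnD; have := expn_gt0 (s + 2) a; rewrite addn2 /= => ?; rewrite -addn2; nia.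
Qed.

Section PolyTime.
Variable n : nat.
Local Notation sym := (sym n).
Local Notation mach := (mach n).
Local Notation pol := (@pol n).
Local Notation state := (@state n).

(** The arbitrary rest [V] of the stack is preserved, so other values can be kept below the argument
    while a subprogram runs. *)
Definition PTm X Y `{Enc X} `{Enc Y} (f : X -> Y) (M : mach unit) c :=
  forall x V, runs M (state (pol (tenc x) ++ V)) ((esz x + 2) ^ c) tt
                (state (pol (tenc (f x)) ++ V)).

(* A variant, so that unification never unfolds it. *)
Variant PT X Y `{Enc X} `{Enc Y} (f : X -> Y) : Prop := PT_intro of (exists M c, PTm f M c).

Lemma PTm_out X Y `{Enc X} `{Enc Y} (f : X -> Y) M c :
  PTm f M c -> forall x, esz (f x) <= esz x + (esz x + 2) ^ c.
Proof.
move=> H1 x; have R := runs_size _ (H1 x [::]).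
move: R; rewrite !cats0 /= andbT pol_content => /(_ isT).
by rewrite /flat /= !size_cat /= !size_pol -/(esz _) -/(esz _); lia.
Qed.

Lemma PTm_bound X Y `{Enc X} `{Enc Y} (f : X -> Y) M c :
  PTm f M c -> forall x, esz (f x) <= (esz x + 2) ^ (c + 2).
Proof.
move=> /PTm_out H1 x; apply: leq_trans (H1 x) _.
set s := esz x; have := pow_add s 1 c; rewrite expn1 (_ : 1 + c + 1 = c + 2); lia.
Qed.

Lemma PT_bound X Y `{Enc X} `{Enc Y} (f : X -> Y) :
  PT f -> exists c, forall x, esz (f x) <= (esz x + 2) ^ c.
Proof. by case=> -[M [c /PTm_bound Hf]]; exists (c + 2). Qed.

Lemma PT_repr X Y Z `{Enc X} `{Enc Y} `{Enc Z} (f : X -> Y) (g : X -> Z) :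
  (forall x, tenc (f x) = tenc (g x)) -> PT f -> PT g.
Proof. by move=> E [[M [c Hf]]]; split; exists M, c => x V; rewrite -E. Qed.

Lemma PT_ext X Y `{Enc X} `{Enc Y} (f g : X -> Y) : f =1 g -> PT f -> PT g.
Proof. by move=> E; apply: PT_repr => x; rewrite E. Qed.

Lemma PT_id X `{Enc X} : PT (fun x : X => x).
Proof. by split; exists (ret n tt), 0 => x V; rle; first exact: runs_ret. Qed.

Lemma PT_comp X Y Z `{Enc X} `{Enc Y} `{Enc Z} (f : X -> Y) (g : Y -> Z) :
  PT f -> PT g -> PT (fun x => g (f x)).
Proof.
move=> [[M [c Hf]]] [[M' [c' Hg]]].
split; exists (bind M (fun _ => M')), (c + (c + 2 + 2) * c' + 2) => x V.
rle; first by rb (Hf x V); exact: (Hg (f x) V).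
have := pow_comp c' (PTm_bound Hf x) => H2.
move: H2; set s := esz x => H2.
have := pow_add s c ((c + 2 + 2) * c').
have := pow_add s (c + (c + 2 + 2) * c' + 1) 0; rewrite addn0 expn0.
rewrite (_ : c + (c + 2 + 2) * c' + 1 + 1 = c + (c + 2 + 2) * c' + 2); lia.
Qed.

Lemma lin_bound s k c : k <= 2 ^ c -> k * s.+1 <= (s + 2) ^ c.+1.
Proof.
move=> H; rewrite expnSr; apply: leq_mul; last by lia.
exact: leq_trans H (pow_const _ _).
Qed.

Lemma PT_pair X Y Z `{Enc X} `{Enc Y} `{Enc Z} (f : X -> Y) (g : X -> Z) :
  PT f -> PT g -> PT (fun x => (f x, g x)).
Proof.
move=> [[M [c Hf]]] [[M' [c' Hg]]].
split; exists (bind (@dup_tree n) (fun _ => bind M (fun _ => bind (@swap_tree n) (fun _ =>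
  bind M' (fun _ => bind (@swap_tree n) (fun _ => push 1 (b1 n))))))), (c + c' + 20) => x V.
rewrite (_ : pol (tenc (f x, g x)) ++ V = b1 n :: pol (tenc (f x)) ++ pol (tenc (g x)) ++ V);
  last by rewrite /= -catA.
rle.
  rb (@dup_tree_runs n (tenc x) V).
  rb (Hf x (pol (tenc x) ++ V)).
  rb (@swap_tree_runs n (tenc (f x)) (tenc x) V).
  rb (Hg x (pol (tenc (f x)) ++ V)).
  rb (@swap_tree_runs n (tenc (g x)) (tenc (f x)) V).
  exact: (@runs_push n (state (pol (tenc (f x)) ++ pol (tenc (g x)) ++ V)) 1 (b1 n) isT isT).
have := PTm_out Hf x; have := PTm_out Hg x; rewrite -!/(esz _).
set s := esz x; set p := (s + 2) ^ c; set q := (s + 2) ^ c' => H2 H3.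
apply: (@leq_trans (2 ^ 9 * (p + q + s + 2))).
  rewrite (_ : 2 ^ 9 = 512) //; lia.
have H4 : p + q + s + 2 <= (s + 2) ^ (c + c' + 3).
  have := pow_add s c c'; have := pow_add s (c + c' + 1) 1.
  rewrite expn1 (_ : c + c' + 1 + 1 + 1 = c + c' + 3) -/p -/q; lia.
apply: leq_trans (_ : 2 ^ 9 * (s + 2) ^ (c + c' + 3) <= _).
  by rewrite leq_mul2l H4 orbT.
apply: leq_trans (pow_mul _ _ _) _; apply: pow_le; lia.
Qed.

Lemma PT_fst_ X Y `{Enc X} `{Enc Y} : PT (fun p : X * Y => p.1).
Proof.
split; exists (bind (pop n 1) (fun _ => bind (@swap_tree n) (fun _ => @drop_tree n))), 8 =>
  -[a b] V.
rle.
  rb (@runs_pop n (state (pol (tenc (a, b)) ++ V)) 1 isT) => /=.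
  rewrite -catA; rb (@swap_tree_runs n (tenc a) (tenc b) V).
  exact: (@drop_tree_runs n (tenc b) (pol (tenc a) ++ V)).
apply: leq_trans (@lin_bound (esz (a, b)) 128 7 isT).
by rewrite esz_pair -!/(esz _); lia.
Qed.

Lemma PT_snd_ X Y `{Enc X} `{Enc Y} : PT (fun p : X * Y => p.2).
Proof.
split; exists (bind (pop n 1) (fun _ => @drop_tree n)), 8 => -[a b] V.
rle.
  rb (@runs_pop n (state (pol (tenc (a, b)) ++ V)) 1 isT) => /=.
  rewrite -catA; exact: (@drop_tree_runs n (tenc a) (pol (tenc b) ++ V)).
apply: leq_trans (@lin_bound (esz (a, b)) 128 7 isT).
by rewrite esz_pair -!/(esz _); lia.
Qed.

Fixpoint push_seq (s : seq sym) : mach unit :=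
  if s is a :: s' then bind (push_seq s') (fun _ => push 1 a) else ret n tt.

Lemma push_seq_runs s V : all (@content n) s ->
  runs (push_seq s) (state V) (2 * size s) tt (state (s ++ V)).
Proof.
elim: s => [|a s IH] /=; first by move=> _; apply: runs_ret.
case/andP=> Ha /IH {}IH; rle; first by rb IH; exact: (@runs_push n (state (s ++ V)) 1 a).
lia.
Qed.

Lemma PT_const X Y `{Enc X} `{Enc Y} (y : Y) : PT (fun _ : X => y).
Proof.
split; exists (bind (@drop_tree n) (fun _ => push_seq (pol (tenc y)))), (6 + esz y) => x V.
rle.
  rb (@drop_tree_runs n (tenc x) V); exact: push_seq_runs (pol_content _ _).
rewrite size_pol -!/(esz _).
apply: leq_trans (_ : 2 ^ (5 + esz y) * (esz x + 2) ^ 1 <= _); last first.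
  by apply: leq_trans (pow_mul _ _ _) _; apply: pow_le; lia.
rewrite expn1 expnD; have : esz y < 2 ^ esz y by apply: ltn_expl.
rewrite (_ : 2 ^ 5 = 32) //; nia.
Qed.

(** The tree of a list is a leaf iff the list is empty, and the tree of [x :: s] is that of the pair
    [(x, s)]. The branch is thus decided by one symbol, and a non-empty list is handed to [g] as it
    stands. *)
Lemma PT_case_seq E X Z `{Enc E} `{Enc X} `{Enc Z} (l : E -> seq X) (f : E -> Z)
    (g : E -> X -> seq X -> Z) :
  PT l -> PT f -> PT (fun p : E * (X * seq X) => g p.1 p.2.1 p.2.2) ->
  PT (fun e => if l e is x :: s then g e x s else f e).
Proof.
move=> [[Ml [cl Hl]]] [[Mf [cf Hf]]] [[Mg [cg Hg]]].
split; exists (bind (@dup_tree n) (fun _ => bind Ml (fun _ => bind (@peek_leaf n) (fun b =>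
  if b then bind (pop n 1) (fun _ => Mf) else
  bind (@swap_tree n) (fun _ => bind (push 1 (b1 n)) (fun _ => Mg)))))),
  (cl + cf + (cl + 5) * cg + 30) => e V.
set s := esz e; set m := esz (l e).
have Hm : m <= s + (s + 2) ^ cl := PTm_out Hl e.
set p := (s + 2) ^ cl; set q := (s + 2) ^ cf; set r := (s + 2) ^ ((cl + 5) * cg).
have Hr : (s + m + 3) ^ cg <= r.
  have -> : s + m + 3 = (s + m + 1) + 2 by lia.
  rewrite /r (_ : (cl + 5) * cg = (cl + 3 + 2) * cg); last by lia.
  apply: pow_comp.
  have := pow_add s cl 2; rewrite (_ : cl + 2 + 1 = cl + 3); last lia.
  have : s * 2 + 1 <= (s + 2) ^ 2 by rewrite (_ : (s + 2) ^ 2 = (s + 2) * (s + 2)) //; nia.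
  rewrite -/p; move: Hm; rewrite -/p; lia.
have bound : 2 ^ 9 * (p + q + r + s + 2) <= (s + 2) ^ (cl + cf + (cl + 5) * cg + 30).
  apply: leq_trans (_ : 2 ^ 9 * (s + 2) ^ (cl + cf + (cl + 5) * cg + 10) <= _); last first.
    by apply: leq_trans (pow_mul _ _ _) _; apply: pow_le; lia.
  rewrite leq_mul2l /=.
  have := pow_add s cl cf; have := pow_add s (cl + cf + 1) ((cl + 5) * cg).
  have := pow_add s (cl + cf + 1 + (cl + 5) * cg + 1) 1; rewrite expn1 -/p -/q -/r.
  have : (s + 2) ^ (cl + cf + 1 + (cl + 5) * cg + 1 + 1 + 1) <= (s + 2) ^ (cl + cf +
    (cl + 5) * cg + 10).
    by apply: pow_le; lia.
  lia.
apply: (runs_le bound).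
case El : (l e) => [|x l'].
  rle.
    rb (@dup_tree_runs n (tenc e) V).
    rb (Hl e (pol (tenc e) ++ V)); rewrite El.
    rb (@peek_leaf_runs n Leaf (pol (tenc e) ++ V)).
    rb (@runs_pop n (state (pol Leaf ++ pol (tenc e) ++ V)) 1 isT).
    exact: (Hf e V).
  rewrite -!/(esz _) (_ : 2 ^ 9 = 512) // /=; rewrite -/s -/p -/q; lia.
rle.
  rb (@dup_tree_runs n (tenc e) V).
  rb (Hl e (pol (tenc e) ++ V)); rewrite El.
  rb (@peek_leaf_runs n (tenc (x :: l')) (pol (tenc e) ++ V)).
  rb (@swap_tree_runs n (tenc (x :: l')) (tenc e) V).
  rb (@runs_push n (state (pol (tenc e) ++ pol (tenc (x :: l')) ++ V)) 1 (b1 n) isT isT).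
  have := Hg (e, (x, l')) V.
  rewrite (_ : pol (tenc (e, (x, l'))) ++ V = b1 n :: pol (tenc e) ++ pol (tenc
    (x :: l')) ++ V);
    last by rewrite /= -catA.
  exact.
rewrite (_ : 2 ^ 9 = 512) //.
have -> : esz (e, (x, l')) + 2 = s + m + 3.
  by rewrite esz_pair /m El -/s (_ : esz (x, l') = esz (x :: l')) //; lia.
rewrite -!/(esz _) -El -/s -/m -/p; lia.
Qed.

(** The bound on all intermediate values keeps the loop polynomial: a step that squares the size of
    its argument would make iteration explode. *)
Lemma PT_iter E X `{Enc E} `{Enc X} (h : E -> X) (test : X -> bool) (step : X -> X)
    (N : E -> nat) c :
  PT h -> PT test -> PT step ->
  (forall e i, i < N e -> test (iter i step (h e))) ->
  (forall e, test (iter (N e) step (h e)) = false) ->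
  (forall e, N e <= (esz e + 2) ^ c) ->
  (forall e i, i <= N e -> esz (iter i step (h e)) <= (esz e + 2) ^ c) ->
  PT (fun e => iter (N e) step (h e)).
Proof.
move=> [[Mh [ch Hh]]] [[Mt [ct Ht]]] [[Ms [cs Hs]]] Hin Hout HN Hsz.
pose M := iterm (fun _ : unit => bind (@dup_tree n) (fun _ => bind Mt (fun _ =>
  bind (@pop_bool n) (fun b => if b then bind Ms (fun _ => ret n (inl tt))
  else ret n (inr tt))))) tt.
pose C := c + (c + 2) * ct + (c + 2) * cs + 2.
split; exists (bind Mh (fun _ => M)), (ch + (c + 1 + 7 + C) + 2) => x V; set s := esz x.
(* [K] bounds the cost of one round: copying the value, testing the copy, performing the step, and
   control. *)
pose K := 2 ^ 7 * (s + 2) ^ C.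
have HK : forall i, i <= N x ->
    64 * esz (iter i step (h x)) + (esz (iter i step (h x)) + 2) ^ ct + 
      (esz (iter i step (h x)) + 2) ^ cs + 20 <= K.
  move=> i Hi; have := Hsz x i Hi; rewrite -/s => H1.
  have := pow_comp ct H1; have := pow_comp cs H1.
  have := pow_add s c ((c + 2) * ct).
  have := pow_add s (c + (c + 2) * ct + 1) ((c + 2) * cs).
  rewrite (_ : c + (c + 2) * ct + 1 + (c + 2) * cs + 1 = C) /K; last by rewrite /C; lia.
  have : 0 < (s + 2) ^ C by rewrite expn_gt0 addn2.
  rewrite (_ : 2 ^ 7 = 128) //; lia.
(* Induction on the number [j] of rounds still to come. *)
have main : forall j, j <= N x ->
    runs M (state (pol (tenc (iter (N x - j) step (h x))) ++ V)) (K * j.+1) tt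
      (state (pol (tenc (iter (N x) step (h x))) ++ V)).
  elim=> [|j IH] Hj.
    rewrite subn0 muln1; rle; first apply: runs_iter_stop.
      rb (@dup_tree_runs n (tenc (iter (N x) step (h x))) V).
      rb (Ht (iter (N x) step (h x)) (pol (tenc (iter (N x) step (h x))) ++ V)).
      rewrite Hout; rb (@pop_bool_runs n false (pol (tenc (iter (N x) step (h x))) ++ V)).
      exact: runs_ret.
    by have := HK _ (leqnn _); rewrite -!/(esz _); lia.
  set y := iter (N x - j.+1) step (h x).
  have Ey : iter (N x - j) step (h x) = step y by rewrite /y -iterS; congr iter; lia.
  have Ty : test y by apply: Hin; lia.
  have {}IH := IH (ltnW Hj); rewrite Ey in IH.
  rle; first apply: runs_iter_step IH.
    rb (@dup_tree_runs n (tenc y) V).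
    rb (Ht y (pol (tenc y) ++ V)).
    rewrite Ty; rb (@pop_bool_runs n true (pol (tenc y) ++ V)).
    rb (Hs y V); exact: runs_ret.
  have := HK (N x - j.+1) (leq_subr _ _); rewrite -/y -!/(esz _); nia.
have := main (N x) (leqnn _); rewrite subnn => H1.
rle; first by rb (Hh x V); exact: H1.
have H2 : K * (N x).+1 <= (s + 2) ^ (c + 1 + 7 + C).
  rewrite /K; apply: leq_trans (_ : (2 ^ 7 * (s + 2) ^ C) * (s + 2) ^ (c + 1) <= _).
    rewrite leq_mul2l; apply/orP; right.
    have := HN x; rewrite -/s; have := pow_add s c 0; rewrite expn0 addn0; lia.
  rewrite -mulnA -expnD; apply: leq_trans (pow_mul _ _ _) _; apply: pow_le; lia.
move: H2; move: (c + 1 + 7 + C) => d H2.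
have := pow_add s ch d; have := pow_add s (ch + d + 1) 0.
rewrite expn0 addn0 (_ : ch + d + 1 + 1 = ch + d + 2) -/s; lia.
Qed.

Lemma PT_eq_ X {eX : Enc X} {iX : EncInj X} (eqX : X -> X ->
  bool) : (forall x y, reflect (x = y) (eqX x y)) ->
  PT (fun p : X * X => eqX p.1 p.2).
Proof.
move=> Hr.
split; exists (bind (pop n 1) (fun _ => @eq_tree n)), 8 => -[a b] V.
rle.
  rb (@runs_pop n (state (pol (tenc (a, b)) ++ V)) 1 isT) => /=.
  rewrite -catA; apply: (@eq_tree_runs n (tenc a) (tenc b) V (eqX a b)).
  by split=> [/Hr -> //|/iX ->]; apply/Hr.
apply: leq_trans (@lin_bound (esz (a, b)) 128 7 isT).
by rewrite esz_pair -!/(esz _); lia.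
Qed.

End PolyTime.

(** * Bounded iteration over lists *)

Lemma esz_cat A `{Enc A} (s t : seq A) : (esz (s ++ t)).+1 = esz s + esz t.
Proof. by elim: s => //= x s IH; rewrite !esz_cons /= addSn -addnA -IH addnS. Qed.

Lemma esz_take A `{Enc A} i (s : seq A) : esz (take i s) <= esz s.
Proof.
rewrite -{2}(cat_take_drop i s); generalize (esz_cat (take i s) (drop i s)).
generalize (esz_gt0 (drop i s)); lia.
Qed.

Lemma esz_drop A `{Enc A} i (s : seq A) : esz (drop i s) <= esz s.
Proof.
rewrite -{2}(cat_take_drop i s); generalize (esz_cat (take i s) (drop i s)).
generalize (esz_gt0 (take i s)); lia.
Qed.

Lemma size_esz A `{Enc A} (s : seq A) : size s < esz s.
Proof. by elim: s => // x s; rewrite esz_cons /=; lia. Qed.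

Lemma esz_nat (m : nat) : esz m = m.*2.+1.
Proof. by elim: m => // m IH; rewrite /esz /= -/(tenc m) -/(esz m) IH doubleS; lia. Qed.

(** Values with the same tree need no conversion. Through [PT_repr], numbers and booleans thus
    inherit loops and case distinctions from lists. *)
Lemma tenc_nat (m : nat) : tenc m = tenc (nseq m tt).
Proof. by elim: m => // m IH; rewrite -[LHS]/(Node Leaf (tenc m)) IH. Qed.

Lemma tenc_bool (b : bool) : tenc b = tenc (nseq b tt).
Proof. by case: b. Qed.

Definition PB E `{Enc E} (F : E -> nat) := exists c, forall e, F e <= (esz e + 2) ^ c.

Section PB.
Context {E : Type} `{Enc E}.

Lemma PB_le (F G : E -> nat) : (forall e, F e <= G e) -> PB G -> PB F.
Proof. by move=> HF [c Hc]; exists c => e; apply: leq_trans (HF e) (Hc e). Qed.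

Lemma PB_const k : PB (fun _ : E => k).
Proof.
exists k => e; apply: leq_trans (pow_const _ _); apply: ltnW; exact: ltn_expl.
Qed.

Lemma PB_add F G : PB F -> PB G -> PB (fun e : E => F e + G e).
Proof.
case=> c Hc [d Hd]; exists (c + d + 1) => e; set s := esz e.
have := pow_add s c d; have := Hc e; have := Hd e; rewrite -/s; lia.
Qed.

Lemma PB_mul F G : PB F -> PB G -> PB (fun e : E => F e * G e).
Proof. by case=> c Hc [d Hd]; exists (c + d) => e; rewrite expnD leq_mul. Qed.

Lemma PB_pow F c : PB F -> PB (fun e : E => (F e + 2) ^ c).
Proof. by case=> d Hd; exists ((d + 2) * c) => e; apply: pow_comp. Qed.

Lemma PB_self : PB (fun e : E => esz e).
Proof. by exists 1 => e; rewrite expn1 leq_addr. Qed.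
End PB.

Section Library.
Variable n : nat.
Local Notation PT := (@PT n _ _ _ _).

Lemma PB_PT E X `{Enc E} `{Enc X} (f : E -> X) : PT f -> PB (fun e => esz (f e)).
Proof. exact: PT_bound. Qed.

Section Ctx.
Context {E : Type} `{Enc E}.

Lemma PT_fst X Y `{Enc X} `{Enc Y} (a : E -> X * Y) : PT a -> PT (fun e => (a e).1).
Proof. by move=> Ha; exact: (PT_comp Ha (PT_fst_ n)). Qed.

Lemma PT_snd X Y `{Enc X} `{Enc Y} (a : E -> X * Y) : PT a -> PT (fun e => (a e).2).
Proof. by move=> Ha; exact: (PT_comp Ha (PT_snd_ n)). Qed.

Lemma PT_app1 X Z `{Enc X} `{Enc Z} (f : X -> Z) (a : E -> X) :
  PT f -> PT a -> PT (fun e => f (a e)).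
Proof. by move=> Hf Ha; exact: (PT_comp Ha Hf). Qed.

Lemma PT_app2 X Y Z `{Enc X} `{Enc Y} `{Enc Z} (f : X -> Y -> Z) (a : E -> X) (b : E -> Y) :
  PT (fun p : X * Y => f p.1 p.2) -> PT a -> PT b -> PT (fun e => f (a e) (b e)).
Proof. by move=> Hf Ha Hb; exact: (PT_comp (PT_pair Ha Hb) Hf). Qed.

Lemma PT_app3 X Y Z T `{Enc X} `{Enc Y} `{Enc Z} `{Enc T} (f : X -> Y -> Z -> T)
    (a : E -> X) (b : E -> Y) (c : E -> Z) :
  PT (fun p : X * Y * Z => f p.1.1 p.1.2 p.2) -> PT a -> PT b -> PT c ->
  PT (fun e => f (a e) (b e) (c e)).
Proof. by move=> Hf Ha Hb Hc; exact: (PT_comp (PT_pair (PT_pair Ha Hb) Hc) Hf). Qed.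

Lemma PT_cons X `{Enc X} (a : E -> X) (l : E -> seq X) :
  PT a -> PT l -> PT (fun e => a e :: l e).
Proof. by move=> Ha Hl; apply: PT_repr (PT_pair Ha Hl). Qed.

End Ctx.

Section Ctx.
Context {E : Type} `{Enc E}.

Lemma PT_if X `{Enc X} (b : E -> bool) (f g : E -> X) :
  PT b -> PT f -> PT g -> PT (fun e => if b e then f e else g e).
Proof.
move=> Hb Hf Hg.
have Hl : PT (fun e => nseq (b e) tt) by apply: PT_repr Hb => e; rewrite tenc_bool.
have Hf' : PT (fun p : E * (unit * seq unit) => f p.1).
  by exact: (PT_comp (PT_fst_ n) Hf).
by apply: PT_ext (PT_case_seq (g := fun e _ _ => f e) Hl Hg Hf') => e; case: (b e).
Qed.

Lemma PT_and (a b : E -> bool) : PT a -> PT b -> PT (fun e => a e && b e).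
Proof. by move=> Ha Hb; apply: PT_if => //; apply: PT_const. Qed.

Lemma PT_or (a b : E -> bool) : PT a -> PT b -> PT (fun e => a e || b e).
Proof. by move=> Ha Hb; apply: PT_if => //; apply: PT_const. Qed.

Lemma PT_neg (a : E -> bool) : PT a -> PT (fun e => ~~ a e).
Proof. by move=> Ha; apply: PT_if => //; apply: PT_const. Qed.

Lemma PT_impl (a b : E -> bool) : PT a -> PT b -> PT (fun e => a e ==> b e).
Proof. by move=> Ha Hb; apply: PT_if => //; apply: PT_const. Qed.

Lemma PT_S (a : E -> nat) : PT a -> PT (fun e => (a e).+1).
Proof.
move=> Ha; apply: (@PT_repr n _ _ _ _ _ _ (fun e => (tt, a e))) => //.
by apply: PT_pair => //; apply: PT_const.
Qed.

Lemma PT_nseq (a : E -> nat) : PT a -> PT (fun e => nseq (a e) tt).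
Proof. by apply: PT_repr => e; rewrite tenc_nat. Qed.

Lemma PT_pred (a : E -> nat) : PT a -> PT (fun e => (a e).-1).
Proof.
move=> Ha.
have Hg : PT (fun p : E * (unit * seq unit) => p.2.2) by do 2 apply: PT_snd; apply: PT_id.
have := PT_case_seq (g := fun _ _ s => s) (PT_nseq Ha) (PT_const n [::]) Hg.
by apply: PT_repr => e; case: (a e) => // m /=; rewrite tenc_nat.
Qed.

Lemma PT_eq {X : eqType} {eX : Enc X} {iX : EncInj X} (a b : E -> X) :
  PT a -> PT b -> PT (fun e => a e == b e).
Proof. by move=> Ha Hb; apply: PT_app2 Ha Hb; apply: PT_eq_ => x y; apply: eqP. Qed.

End Ctx.

Section Ctx.
Context {E : Type} `{Enc E}.

(** A loop whose state consists of the environment, the accumulator and the rest of the list; after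
    [i] rounds the accumulator is the fold over [take i]. *)
Lemma PT_foldl_bd A X `{Enc A} `{Enc X} (f : E -> A -> X -> A) (a : E -> A) (l : E -> seq X)
    (F : E -> nat) :
  PT (fun p : E * A * X => f p.1.1 p.1.2 p.2) -> PT a -> PT l -> PB F ->
  (forall e i, i <= size (l e) -> esz (foldl (f e) (a e) (take i (l e))) <= F e) ->
  PT (fun e => foldl (f e) (a e) (l e)).
Proof.
move=> Hf Ha Hl HF Hbd.
pose h e := (e, a e, l e).
pose step (st : E * A * seq X) :=
  if st.2 is x :: s then (st.1.1, f st.1.1 st.1.2 x, s) else st.
pose test (st : E * A * seq X) := if st.2 is _ :: _ then true else false.
have Hit e i : i <= size (l e) ->
    iter i step (h e) = (e, foldl (f e) (a e) (take i (l e)), drop i (l e)).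
  elim: i => [|i IH] Hi; first by rewrite take0 drop0.
  rewrite iterS IH; last exact: ltnW.
  case El : (l e) Hi => [//|x0 l0] Hi; rewrite -El in Hi *.
  rewrite (take_nth x0) // -cats1 foldl_cat /=.
  by rewrite (drop_nth x0) //.
have Hh : PT h by apply: PT_pair => //; apply: PT_pair => //; apply: PT_id.
have Htest : PT test.
  apply: (PT_case_seq (g := fun _ _ _ => true)); last exact: PT_const.
    by apply: PT_snd; apply: PT_id.
  exact: PT_const.
have Hstep : PT step.
  apply: (PT_case_seq (g := fun st x s => (st.1.1, f st.1.1 st.1.2 x, s))).
  - by apply: PT_snd; apply: PT_id.
  - exact: PT_id.
  have K1 : PT (fun p : E * A * seq X * (X * seq X) => p.1.1.1).
    by do 3 apply: PT_fst; apply: PT_id.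
  have K2 : PT (fun p : E * A * seq X * (X * seq X) => p.1.1.2).
    by apply: PT_snd; do 2 apply: PT_fst; apply: PT_id.
  have K3 : PT (fun p : E * A * seq X * (X * seq X) => p.2.1).
    by apply: PT_fst; apply: PT_snd; apply: PT_id.
  have K4 : PT (fun p : E * A * seq X * (X * seq X) => p.2.2).
    by do 2 apply: PT_snd; apply: PT_id.
  exact: (PT_pair (PT_pair K1 (PT_app3 Hf K1 K2 K3)) K4).
have [c Hc] : PB (fun e => esz e + F e + esz (l e) + 2).
  by do 2!(apply: PB_add; last by [exact: PB_const | exact: PB_PT]); apply: PB_add => //;
    apply: PB_self.
have Hi := PT_iter (N := fun e => size (l e)) (c := c) Hh Htest Hstep.
have {Hi} : PT (fun e => iter (size (l e)) step (h e)).
  apply: Hi => [e i Hi|e|e|e i Hi].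
  - rewrite Hit; last exact: ltnW.
    by rewrite /test /=; case Ed : (drop i (l e)) => //; move: (size_drop i (l e));
      rewrite Ed /=; lia.
  - by rewrite Hit // drop_size.
  - apply: leq_trans (Hc e); generalize (size_esz (l e)); lia.
  rewrite Hit //; apply: leq_trans (Hc e); rewrite !esz_pair.
  by have := Hbd e i Hi; generalize (esz_drop i (l e)); lia.
move=> Hi; apply: PT_ext (PT_snd (PT_fst Hi)) => e.
by rewrite Hit //= take_size.
Qed.

(** If each item adds an amount that is polynomial in environment and item and independent of the
    accumulator, the growth over the whole list is polynomial. *)
Lemma PT_foldl A X `{Enc A} `{Enc X} (f : E -> A -> X -> A) (a : E -> A) (l : E -> seq X)
    (G : E * X -> nat) :
  PB G -> (forall e b x, esz (f e b x) <= esz b + G (e, x)) ->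
  PT (fun p : E * A * X => f p.1.1 p.1.2 p.2) -> PT a -> PT l ->
  PT (fun e => foldl (f e) (a e) (l e)).
Proof.
move=> [c HG] Hg Hf Ha Hl.
pose (F := fun e : E => esz (a e) + esz (l e) * (esz e + esz (l e) + 2) ^ c).
apply: (PT_foldl_bd (F := F)) => //.
  apply: PB_add; first exact: PB_PT.
  apply: PB_mul; first exact: PB_PT.
  apply: PB_pow; apply: PB_add; [exact: PB_self | exact: PB_PT].
move=> e i Hi; rewrite /F.
set K := (esz e + esz (l e) + 2) ^ c.
(* Every item is smaller than the list it occurs in, so the single value [K] bounds all
   increments. *)
have main s b : (forall x s1 s2, s = s1 ++ x :: s2 -> esz x < esz (l e)) -> 
    esz (foldl (f e) b s) <= esz b + size s * K.
  elim: s b => [|x s IH] b Hs /=; first by rewrite addn0.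
  apply: leq_trans (IH _ _) _.
    by move=> y s1 s2 E1; apply: (Hs y (x :: s1) s2); rewrite E1.
  rewrite mulSn addnA leq_add2r; apply: leq_trans (Hg _ _ _) _.
  rewrite leq_add2l; apply: leq_trans (HG _) _; rewrite esz_pair.
  apply: pow_mono; have := Hs x [::] s erefl; lia.
apply: leq_trans (main _ _ _) _.
  move=> x s1 s2 E1; apply: leq_trans (esz_take i (l e)).
  rewrite E1; generalize (esz_cat s1 (x :: s2)); rewrite esz_cons.
  by generalize (esz_gt0 s1); generalize (esz_gt0 s2); lia.
rewrite leq_add2l leq_mul2r size_take_min; apply/orP; right.
generalize (size_esz (l e)); lia.
Qed.

End Ctx.
End Library.

(** * List functions *)

Lemma foldl_cons_rev A B (f : A -> B) (l : seq A) acc :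
  foldl (fun s x => f x :: s) acc l = rev [seq f x | x <- l] ++ acc.
Proof. by elim: l acc => //= x l IH acc; rewrite IH rev_cons cat_rcons. Qed.

Lemma foldl_has A (p : A -> bool) (l : seq A) b :
  foldl (fun b x => b || p x) b l = b || has p l.
Proof. by elim: l b => [|x l IH] b /=; rewrite ?orbF // IH orbA. Qed.

Lemma foldl_succ A (l : seq A) k : foldl (fun k _ => k.+1) k l = k + size l.
Proof. by elim: l k => [|x l IH] k /=; rewrite ?addn0 // IH addnS. Qed.

Lemma foldl_nseq A (f : A -> A) (a : A) k :
  foldl (fun a _ => f a) a (nseq k tt) = iter k f a.
Proof. by elim: k a => //= k IH a; rewrite IH -iterSr. Qed.

Lemma foldl_flatten A B (f : A -> seq B) (l : seq A) acc :
  foldl (fun s x => s ++ f x) acc l = acc ++ flatten [seq f x | x <- l].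
Proof. by elim: l acc => [|x l IH] acc /=; rewrite ?cats0 // IH catA. Qed.

Definition find_step A (p : A -> bool) (st : bool * nat) (x : A) : bool * nat :=
  if st.1 then st else if p x then (true, st.2) else (false, st.2.+1).

Lemma foldl_find A (p : A -> bool) (l : seq A) b k :
  (foldl (find_step p) (b, k) l).2 = if b then k else k + find p l.
Proof.
elim: l b k => [|x l IH] b k /=; first by rewrite addn0 if_same.
case: b; first by rewrite /find_step /= IH.
by rewrite /find_step /=; case: (p x); rewrite IH ?addn0 // addnS addSn.
Qed.

Definition dedup (T : eqType) (s : seq T) : seq T :=
  foldl (fun acc x => if x \in acc then acc else x :: acc) [::] s.

Lemma dedupP (T : eqType) (s : seq T) : uniq (dedup s) /\ dedup s =i s.
Proof.
rewrite /dedup.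
have H acc : uniq acc ->
   uniq (foldl (fun acc x => if x \in acc then acc else x :: acc) acc s) /\
   foldl (fun acc x => if x \in acc then acc else x :: acc) acc s =i acc ++ s.
  elim: s acc => [|x s IH] acc /= Ha; first by split=> // y; rewrite cats0.
  case: ifP => Hx.
    have [H1 H2] := IH acc Ha; split=> // y; rewrite H2 !mem_cat in_cons.
    by case: eqP => [->|//]; rewrite Hx.
  have [|H1 H2] := IH (x :: acc); first by rewrite /= Hx.
  by split=> // y; rewrite H2 !(mem_cat, in_cons) /= orbCA orbA.
by have [H1 H2] := H [::] isT.
Qed.

Lemma dedup_uniq (T : eqType) (s : seq T) : (size (dedup s) == size s) = uniq s.
Proof.
have [H1 H2] := dedupP s.
have E : size (dedup s) = size (undup s).
  by apply: perm_size; apply: uniq_perm => // [|x]; rewrite ?undup_uniq ?H2 ?mem_undup.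
rewrite E; apply/idP/idP => [/eqP E2|/undup_id -> //].
by apply/negPn; rewrite -ltn_size_undup E2 ltnn.
Qed.

Section Library.
Variable n : nat.
Local Notation PT := (@PT n _ _ _ _).

Ltac pt0 := repeat first
 [ assumption | exact (PT_id n) | refine (PT_const n _) | exact (PT_fst_ n) | exact (PT_snd_ n)
 | refine (PT_fst _) | refine (PT_snd _) | refine (PT_pair _ _) | refine (PT_cons _ _)
 | refine (PT_and _ _) | refine (PT_or _ _) | refine (PT_neg _) | refine (PT_impl _ _)
 | refine (PT_if _ _ _)
 | refine (PT_S _) | refine (PT_pred _) | refine (PT_nseq _) | refine (PT_eq _ _) ].

Section Ctx.
Context {E : Type} `{Enc E}.

Lemma PT_rev X `{Enc X} (l : E -> seq X) : PT l -> PT (fun e => rev (l e)).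
Proof.
move=> Hl; apply: (@PT_ext _ _ _ _ _ (fun e => foldl (fun s x => x :: s) [::] (l e))).
  by move=> e; have := foldl_cons_rev id (l e) [::]; rewrite cats0 map_id.
apply: (PT_foldl (f := fun _ s x => x :: s) (G := fun p => esz p)); [exact: PB_self| |pt0..].
by move=> e b x; rewrite esz_cons esz_pair; lia.
Qed.

Lemma PT_cat X `{Enc X} (s t : E -> seq X) : PT s -> PT t -> PT (fun e => s e ++ t e).
Proof.
move=> Hs Ht; apply: (@PT_ext _ _ _ _ _ (fun e => foldl (fun s x => x :: s) (t e) (rev (s e)))).
  by move=> e; have := foldl_cons_rev id (rev (s e)) (t e); rewrite map_id revK.
apply: (PT_foldl (f := fun _ s x => x :: s) (G := fun p => esz p));
  [exact: PB_self| |pt0|pt0|exact: PT_rev].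
by move=> e b x; rewrite esz_cons esz_pair; lia.
Qed.

Lemma PT_map X Y `{Enc X} `{Enc Y} (f : E -> X -> Y) (l : E -> seq X) :
  PT (fun p : E * X => f p.1 p.2) -> PT l -> PT (fun e => [seq f e x | x <- l e]).
Proof.
move=> Hf Hl; apply: (@PT_ext _ _ _ _ _ (fun e => rev (foldl (fun s x =>
  f e x :: s) [::] (l e)))).
  by move=> e; rewrite foldl_cons_rev cats0 revK.
apply: PT_rev.
apply: (PT_foldl (f := fun e s x => f e x :: s) (G := fun p => esz (f p.1 p.2) + 1));
  [| |pt0..].
- by apply: PB_add; [exact: PB_PT Hf|exact: PB_const].
- by move=> e b x /=; rewrite esz_cons; lia.
apply: (PT_app2 (f := f)) => //; pt0.
Qed.

Lemma PT_has X `{Enc X} (p : E -> X -> bool) (l : E -> seq X) :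
  PT (fun q : E * X => p q.1 q.2) -> PT l -> PT (fun e => has (p e) (l e)).
Proof.
move=> Hf Hl; apply: (@PT_ext _ _ _ _ _ (fun e => foldl (fun b x => b || p e x) false (l e))).
  by move=> e; rewrite foldl_has.
apply: (PT_foldl (f := fun e b x => b || p e x) (G := fun=> 3)); [exact: PB_const| |pt0..].
- by move=> e b x; generalize (esz_bool (b || p e x)); lia.
by apply: (PT_app2 (f := p)) => //; pt0.
Qed.

Lemma PT_size X `{Enc X} (l : E -> seq X) : PT l -> PT (fun e => size (l e)).
Proof.
move=> Hl; apply: (@PT_ext _ _ _ _ _ (fun e => foldl (fun k _ => k.+1) 0 (l e))).
  by move=> e; rewrite foldl_succ.
apply: (PT_foldl (f := fun _ k _ => k.+1) (G := fun=> 2)); [exact: PB_const| |pt0..].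
by move=> e b x; rewrite !esz_nat; lia.
Qed.

Lemma PT_add (a b : E -> nat) : PT a -> PT b -> PT (fun e => a e + b e).
Proof.
move=> Ha Hb; apply: (@PT_ext _ _ _ _ _ (fun e => size (nseq (a e) tt ++ nseq (b e) tt))).
  by move=> e; rewrite size_cat !size_nseq.
by apply/PT_size/PT_cat; apply: PT_nseq.
Qed.

Lemma PT_sub (a b : E -> nat) : PT a -> PT b -> PT (fun e => a e - b e).
Proof.
move=> Ha Hb; apply: (@PT_ext _ _ _ _ _ (fun e => foldl (fun k _ =>
  k.-1) (a e) (nseq (b e) tt))).
  by move=> e; rewrite foldl_nseq; elim: (b e) => [|k IH] /=; rewrite ?subn0 // IH subnS.
apply: (PT_foldl (f := fun _ k _ => k.-1) (G := fun=> 2)); [exact: PB_const| |pt0..].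
by move=> e c x; rewrite !esz_nat; lia.
Qed.

Lemma PT_drop X `{Enc X} (a : E -> nat) (l : E -> seq X) :
  PT a -> PT l -> PT (fun e => drop (a e) (l e)).
Proof.
move=> Ha Hl; apply: (@PT_ext _ _ _ _ _ (fun e => foldl (fun s _ =>
  behead s) (l e) (nseq (a e) tt))).
  move=> e; rewrite foldl_nseq; elim: (a e) => [|k IH] /=; first by rewrite drop0.
  by rewrite IH -drop1 drop_drop.
apply: (PT_foldl (f := fun _ s _ => behead s) (G := fun=> 0)); [exact: PB_const| |pt0..].
- by move=> e [|c s] x //=; rewrite esz_cons; lia.
apply: PT_ext (PT_case_seq (l := fun p : E * seq X * unit =>
  p.1.2) (f := fun=> [::]) (g := fun _ _ s => s) _ _ _); pt0.
by move=> [[e [|x s]] u].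
Qed.

End Ctx.

Section Ctx.
Context {E : Type} `{Enc E}.

Lemma PT_mul (a b : E -> nat) : PT a -> PT b -> PT (fun e => a e * b e).
Proof.
move=> Ha Hb; apply: (@PT_ext _ _ _ _ _ (fun e => foldl (fun k _ =>
  k + a e) 0 (nseq (b e) tt))).
  by move=> e; rewrite foldl_nseq mulnC; elim: (b e) => //= k ->; rewrite mulSn addnC.
apply: (PT_foldl (f := fun e k _ => k + a e) (G := fun p => esz (a p.1))); [| |idtac|pt0..].
- apply: (@PB_PT n _ _ _ _ (fun p : E * unit => a p.1)); apply: PT_app1; pt0.
- by move=> e k u /=; rewrite !esz_nat; lia.
by apply: PT_add; pt0; apply: PT_app1; pt0.
Qed.

Lemma PT_leq (a b : E -> nat) : PT a -> PT b -> PT (fun e => a e <= b e).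
Proof. by move=> Ha Hb; rewrite /leq; apply: PT_eq; [apply: PT_sub | pt0]. Qed.

Lemma PT_flatmap X Y `{Enc X} `{Enc Y} (f : E -> X -> seq Y) (l : E -> seq X) :
  PT (fun p : E * X => f p.1 p.2) -> PT l -> PT (fun e => flatten [seq f e x | x <- l e]).
Proof.
move=> Hf Hl; apply: (@PT_ext _ _ _ _ _ (fun e => foldl (fun s x => s ++ f e x) [::] (l e))).
  by move=> e; rewrite foldl_flatten.
apply: (PT_foldl (f := fun e s x => s ++ f e x) (G := fun p => esz (f p.1 p.2)));
  [| |idtac|pt0..].
- exact: PB_PT Hf.
- by move=> e s x; generalize (esz_cat s (f e x)) => /=; lia.
by apply: PT_cat; pt0; apply: (PT_app2 (f := f)) => //; pt0.
Qed.

Lemma PT_all X `{Enc X} (p : E -> X -> bool) (l : E -> seq X) :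
  PT (fun q : E * X => p q.1 q.2) -> PT l -> PT (fun e => all (p e) (l e)).
Proof.
move=> Hf Hl; apply: (@PT_ext _ _ _ _ _ (fun e => ~~ has (fun x => ~~ p e x) (l e))).
  by move=> e; rewrite has_predC negbK.
by apply/PT_neg/PT_has => //; apply: PT_neg.
Qed.

Lemma PT_mem {X : eqType} {eX : Enc X} {iX : EncInj X} (a : E -> X) (l : E -> seq X) :
  PT a -> PT l -> PT (fun e => a e \in l e).
Proof.
move=> Ha Hl; apply: (@PT_ext _ _ _ _ _ (fun e => has (fun x => x == a e) (l e))).
  by move=> e; rewrite has_pred1.
by apply: PT_has => //; apply: PT_eq; pt0; apply: PT_app1; pt0.
Qed.

Lemma PT_head X `{Enc X} (x0 : X) (l : E -> seq X) : PT l -> PT (fun e => head x0 (l e)).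
Proof.
by move=> Hl; apply: PT_ext (PT_case_seq (g := fun _ x _ => x) Hl (PT_const n x0) _);
  pt0 => e; case: (l e).
Qed.

Lemma PT_behead X `{Enc X} (l : E -> seq X) : PT l -> PT (fun e => behead (l e)).
Proof. by move=> Hl; apply: PT_ext (PT_drop (PT_const n 1) Hl) => e; rewrite drop1. Qed.

Lemma PT_find X `{Enc X} (p : E -> X -> bool) (l : E -> seq X) :
  PT (fun q : E * X => p q.1 q.2) -> PT l -> PT (fun e => find (p e) (l e)).
Proof.
move=> Hf Hl; apply: (@PT_ext _ _ _ _ _ (fun e =>
  (foldl (find_step (p e)) (false, 0) (l e)).2)).
  by move=> e; rewrite foldl_find.
apply: PT_snd; apply: (PT_foldl (f := fun e => find_step (p e)) (G := fun=> 5));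
  [exact: PB_const| |idtac|pt0..].
  move=> e [b k] x; rewrite /find_step /=; case: b => /=; first lia.
  by case: (p e x); rewrite !esz_pair !esz_nat /esz /=; lia.
by rewrite /find_step; pt0; apply: (PT_app2 (f := p)) => //; pt0.
Qed.

Lemma PT_iota (a b : E -> nat) : PT a -> PT b -> PT (fun e => iota (a e) (b e)).
Proof.
move=> Ha Hb.
apply: (@PT_ext _ _ _ _ _ (fun e => [seq a e + x | x <- rev (foldl (fun s _ =>
  size s :: s) [::] (nseq (b e) tt))])).
  move=> e; rewrite foldl_nseq (_ : iter (b e) _ _ = rev (iota 0 (b e))); last first.
    elim: (b e) => // k IH; rewrite iterS IH size_rev size_iota -[k.+1]addn1 iotaD rev_cat //=.
  by rewrite revK -iotaDl addn0.
apply: PT_map; first by apply: PT_add; pt0; apply: PT_app1; pt0.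
apply: PT_rev.
(* After [i] rounds the accumulator lists the unary numbers below [i], of total size quadratic in
   [i]. *)
pose (F := fun e : E => (esz (b e) + 2) * (esz (b e) + 2)).
apply: (PT_foldl_bd (f := fun _ s _ => size s :: s) (F := F)); [|pt0..| |].
- by apply: PT_cons; pt0; apply: PT_size; pt0.
- by apply: PB_mul; apply: PB_add; try exact: PB_const; exact: (PB_PT Hb).
move=> e i; rewrite size_nseq => Hi.
rewrite take_nseq // foldl_nseq /F esz_nat.
have [H1 _] : esz (iter i (fun s =>
  size s :: s) [::]) <= i * (i.*2.+2) + 1 /\ size (iter i (fun s => size s :: s) [::]) = i.
  elim: i {Hi} => [|i [IH1 IH2]] //; rewrite iterS esz_cons /= IH2 esz_nat; split=> //; nia.
by apply: leq_trans H1 _; nia.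
Qed.

Lemma PT_nth X `{Enc X} (x0 : X) (a : E -> nat) (l : E -> seq X) :
  PT l -> PT a -> PT (fun e => nth x0 (l e) (a e)).
Proof.
move=> Hl Ha; apply: PT_ext (PT_head x0 (PT_drop Ha Hl)) => e.
by rewrite -nth0 nth_drop addn0.
Qed.

Lemma PT_filter X `{Enc X} (p : E -> X -> bool) (l : E -> seq X) :
  PT (fun q : E * X => p q.1 q.2) -> PT l -> PT (fun e => [seq x <- l e | p e x]).
Proof.
move=> Hf Hl; apply: (@PT_ext _ _ _ _ _ (fun e =>
  flatten [seq if p e x then [:: x] else [::] | x <- l e])).
  by move=> e; elim: (l e) => //= x s <-; case: (p e x).
by apply: PT_flatmap => //; pt0.
Qed.

End Ctx.

Section Ctx.
Context {E : Type} `{Enc E}.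

Lemma PT_dedup {X : eqType} {eX : Enc X} {iX : EncInj X} (l : E -> seq X) :
  PT l -> PT (fun e => dedup (l e)).
Proof.
move=> Hl; rewrite /dedup.
apply: (PT_foldl (f := fun _ (acc : seq X) (x : X) =>
  if x \in acc then acc else x :: acc) (G := fun p => esz p)); [exact: PB_self| |idtac|pt0..].
- by move=> e b x; case: ifP => _; rewrite ?esz_cons esz_pair; lia.
by pt0; apply: PT_mem; pt0.
Qed.

Lemma PT_uniq {X : eqType} {eX : Enc X} {iX : EncInj X} (l : E -> seq X) :
  PT l -> PT (fun e => uniq (l e)).
Proof.
move=> Hl; apply: (@PT_ext _ _ _ _ _ (fun e => size (dedup (l e)) == size (l e))).
  by move=> e; rewrite dedup_uniq.
by apply: PT_eq; apply: PT_size => //; apply: PT_dedup.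
Qed.

Lemma PT_index {X : eqType} {eX : Enc X} {iX : EncInj X} (a : E -> X) (l : E -> seq X) :
  PT a -> PT l -> PT (fun e => index (a e) (l e)).
Proof.
move=> Ha Hl; apply: (@PT_ext _ _ _ _ _ (fun e => find (fun x => x == a e) (l e))) => //.
by apply: PT_find => //; apply: PT_eq; pt0; apply: PT_app1; pt0.
Qed.

Lemma PT_nseqc X `{Enc X} (x : X) (a : E -> nat) : PT a -> PT (fun e => nseq (a e) x).
Proof.
move=> Ha; apply: (@PT_ext _ _ _ _ _ (fun e => [seq x | _ <- nseq (a e) tt])).
  by move=> e; rewrite map_nseq.
by apply: PT_map; pt0.
Qed.

Lemma PT_flatten X `{Enc X} (l : E -> seq (seq X)) : PT l -> PT (fun e => flatten (l e)).
Proof.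
move=> Hl; apply: (@PT_ext _ _ _ _ _ (fun e => flatten [seq x | x <- l e])).
  by move=> e; rewrite map_id.
by apply: PT_flatmap; pt0.
Qed.

Lemma PT_last X `{Enc X} (x0 : X) (l : E -> seq X) : PT l -> PT (fun e => last x0 (l e)).
Proof.
move=> Hl; apply: (@PT_ext _ _ _ _ _ (fun e => head x0 (rev (l e)))).
  by move=> e; case/lastP: (l e) => // s x; rewrite rev_rcons last_rcons.
by apply/PT_head/PT_rev.
Qed.

End Ctx.
End Library.

(** A hook inside [pt], redefined whenever further functions have been shown to be in [PT]. *)
Ltac pt_ext := fail.
Ltac pt := repeat first
 [ assumption | exact (PT_id _) | refine (PT_const _ _) | exact (PT_fst_ _) | exact (PT_snd_ _)
 | refine (PT_fst _) | refine (PT_snd _) | refine (PT_pair _ _)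
 | pt_ext
 | match goal with H : PT ?n ?b |- PT ?n (fun e => ?b (@?a e)) => refine (PT_app1 H _) end
 | refine (PT_uniq _)
 | refine (PT_and _ _) | refine (PT_or _ _) | refine (PT_neg _) | refine (PT_impl _ _)
 | refine (PT_if _ _ _)
 | refine (PT_nseq _) | refine (PT_nseqc _ _)
 | refine (PT_S _) | refine (PT_pred _)
 | refine (PT_flatmap _ _) | refine (PT_flatten _)
 | refine (PT_cat _ _) | refine (PT_cons _ _) | refine (PT_map _ _) | refine (PT_filter _ _)
 | refine (PT_has _ _) | refine (PT_all _ _) | refine (PT_mem _ _)
 | refine (PT_size _) | refine (PT_iota _ _) | refine (PT_nth _ _ _)
 | refine (PT_head _ _) | refine (PT_behead _) | refine (PT_last _ _) | refine (PT_rev _)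
 | refine (PT_dedup _) | refine (PT_index _ _)
 | refine (PT_leq _ _) | refine (PT_eq _ _)
 | refine (PT_add _ _) | refine (PT_mul _ _) ].

(** * Binary numbers and parsing *)

Definition bval (s : seq bool) : nat := foldr (fun (b : bool) v => b + v.*2) 0 s.
Definition canon (s : seq bool) : bool := last true s.

Lemma binrevP f m : m <= f -> bval (binrev f m) = m /\ canon (binrev f m).
Proof.
elim: f m => [|f IH] [|m] //= Hm.
have [|H1 H2] := IH (uphalf m).
  by rewrite uphalf_half; move: (odd_double_half m); lia.
rewrite H1; split; first by rewrite uphalf_half; move: (odd_double_half m);
  case: (odd m) => /=; lia.
move: H2 H1; rewrite /canon /=; case: (binrev f (uphalf m)) => //= _.
by move=> H1; case: m H1 {Hm}.
Qed.

Lemma bitsK : cancel bits bval.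
Proof. by move=> m; case: (binrevP (leqnn m)). Qed.

Lemma canon_bits m : canon (bits m).
Proof. by case: (binrevP (leqnn m)). Qed.

Lemma canon_cons b s : canon (b :: s) -> canon s.
Proof. by rewrite /canon /=; case: s. Qed.

Lemma bval_eq0 s : canon s -> bval s = 0 -> s = [::].
Proof.
elim: s => // b s IH Hs; have {}IH := IH (canon_cons Hs).
case: b Hs => /= Hs E; first lia.
have /IH Es : bval s = 0 by lia.
by rewrite Es in Hs.
Qed.

Lemma bval_inj s t : canon s -> canon t -> bval s = bval t -> s = t.
Proof.
elim: s t => [|b s IH] t Hs Ht E; first by rewrite (bval_eq0 Ht).
case: t Ht E => [|c t] Ht E; first exact: bval_eq0 Hs E.
have Hs' := canon_cons Hs; have Ht' := canon_cons Ht.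
have Eb : b = c by move: E; rewrite /= => /(congr1 odd); rewrite !oddD !odd_double !addbF;
  case: b {Hs}; case: c {Ht}.
by congr cons => //; apply: IH => //; move: E; rewrite /= Eb; lia.
Qed.

Lemma bvalK s : canon s -> bits (bval s) = s.
Proof. by move=> H; apply: bval_inj; rewrite ?canon_bits ?bitsK. Qed.

Fixpoint inc (s : seq bool) : seq bool :=
  match s with
  | [::] => [:: true]
  | true :: s => false :: inc s
  | false :: s => true :: s
  end.

Lemma incP s : canon s -> canon (inc s) /\ bval (inc s) = (bval s).+1.
Proof.
elim: s => // -[] s IH /= Hs.
  have [H1 H2] := IH (canon_cons Hs); rewrite H2; split; last lia.
  by move: H1; rewrite /canon; case: (s) => //= -[].
by split; [move: Hs; rewrite /canon /=; case: (s) | lia].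
Qed.

(** Since [m] is unary, that many increments are affordable. *)
Lemma bits_iter m : bits m = iter m inc [::].
Proof.
elim: m => // m IH; rewrite iterS -IH.
have [H1 H2] := incP (canon_bits m).
by apply: bval_inj; rewrite ?canon_bits // H2 !bitsK.
Qed.

Definition inc_step (st : bool * seq bool) (b : bool) : bool * seq bool :=
  (st.1 && b, (st.1 != b) :: st.2).

Lemma inc_foldl s : inc s =
  let st := foldl inc_step (true, [::]) s in rev (if st.1 then true :: st.2 else st.2).
Proof.
have H t : forall acc, rev (let st := foldl inc_step (false,
  acc) t in if st.1 then true :: st.2 else st.2) = rev acc ++ t.
  elim: t => [|b t IH] acc /=; first by rewrite cats0.
  by rewrite /inc_step /= IH rev_cons cat_rcons; case: b.
have H2 t : forall acc, rev (let st := foldl inc_step (true,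
  acc) t in if st.1 then true :: st.2 else st.2) = rev acc ++ inc t.
  elim: t => [|b t IH] acc /=; first by rewrite rev_cons cats1.
  rewrite {2}/inc_step /=; case: b => /=; first by rewrite IH rev_cons cat_rcons.
  by rewrite H rev_cons cat_rcons.
by rewrite /= H2.
Qed.

Lemma esz_inc s : esz (inc s) <= esz s + 4.
Proof.
elim: s => // -[] s IH /=; rewrite !esz_cons /esz /= -!/(esz _); last by rewrite /esz; lia.
by move: IH; rewrite /esz; lia.
Qed.

Lemma esz_bits_size (s : seq bool) : esz s <= 4 * size s + 1.
Proof. by elim: s => // b s IH; rewrite esz_cons /=; generalize (esz_bool b); lia. Qed.

Definition encb (s : seq bool) : seq bool := enc_list (fun b => [:: b]) s.

Lemma enc_natE m : enc_nat m = encb (bits m).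
Proof. by rewrite /enc_nat /encb /enc_list; congr (flatten _ ++ _); apply: eq_map. Qed.

Lemma encb_nat s : canon s -> encb s = enc_nat (bval s).
Proof. by move=> H; rewrite enc_natE bvalK. Qed.

Lemma enc_list_cons A (enc : A -> seq bool) a l :
  enc_list enc (a :: l) = true :: enc a ++ enc_list enc l.
Proof. by rewrite /enc_list /= -catA. Qed.

Lemma eq_enc_list (A : eqType) (e1 e2 : A -> seq bool) l : {in l, e1 =1 e2} ->
  enc_list e1 l = enc_list e2 l.
Proof.
elim: l => // a l IH H; rewrite !enc_list_cons H ?mem_head // IH //.
by move=> b Hb; apply: H; rewrite in_cons Hb orbT.
Qed.

Lemma enc_list_map A B (e : B -> seq bool) (f : A -> B) l :
  enc_list e [seq f x | x <- l] = enc_list (fun x => e (f x)) l.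
Proof. by elim: l => // a l IH; rewrite /= !enc_list_cons IH. Qed.

(* The final 1 makes the string the binary expansion of a number. *)
Definition code (l : seq nat) : seq bool :=
  flatten [seq nseq a true ++ [:: false] | a <- l] ++ [:: true].

Lemma code_canon l : canon (code l).
Proof. by rewrite /canon /code last_cat. Qed.

Lemma code_inj : injective code.
Proof.
have H1 a b (s t : seq bool) : nseq a true ++ false :: s = nseq b true ++ false :: t ->
  a = b /\ s = t.
  by elim: a b => [|a IH] [|b] //= [] // /IH [-> ->].
have H2 a l : code (a :: l) = nseq a true ++ false :: code l by rewrite /code /= -!catA.
have H3 a l : code (a :: l) <> [:: true] by rewrite H2; case: a => [|[|a]].
elim=> [|a l IH] [|b m] // E; [by case: (H3 b m) | by case: (H3 a l) |].
by move: E; rewrite !H2 => /H1 [-> /IH ->].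
Qed.

Section Parse.
Variable n : nat.
Local Notation PT := (@PT n _ _ _ _).

Section Ctx.
Context {E : Type} `{Enc E}.

Lemma PT_inc (a : E -> seq bool) : PT a -> PT (fun e => inc (a e)).
Proof.
move=> Ha; apply: (@PT_ext _ _ _ _ _ (fun e => 
   let st := foldl inc_step (true, [::]) (a e) in rev (if st.1 then true :: st.2 else st.2))).
  by move=> e; rewrite inc_foldl.
have Hst : PT (fun e => foldl inc_step (true, [::]) (a e)).
  apply: (PT_foldl (f := fun _ => inc_step) (G := fun=> 10));
    [exact: PB_const| |rewrite /inc_step; pt..].
  move=> e [b s] x; rewrite /inc_step /= !esz_pair esz_cons.
  by generalize (esz_bool (b && x)) (esz_bool (b != x)); lia.
by move=> /=; pt.
Qed.

End Ctx.

Section Ctx.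
Context {E : Type} `{Enc E}.

Lemma PT_bits (a : E -> nat) : PT a -> PT (fun e => bits (a e)).
Proof.
move=> Ha; apply: (@PT_ext _ _ _ _ _ (fun e => foldl (fun s _ => inc s) [::] (nseq (a e) tt))).
  by move=> e; rewrite foldl_nseq bits_iter.
apply: (PT_foldl (f := fun _ s _ => inc s) (G := fun=> 4)); [exact: PB_const| |idtac|pt..].
- by move=> e s x; apply: esz_inc.
by apply: PT_inc; pt.
Qed.

Lemma PT_code (l : E -> seq nat) : PT l -> PT (fun e => code (l e)).
Proof. by move=> Hl; rewrite /code; pt. Qed.

Lemma PT_canon (l : E -> seq bool) : PT l -> PT (fun e => canon (l e)).
Proof. by move=> Hl; rewrite /canon; pt. Qed.

Lemma PT_enc_list X `{Enc X} (f : E -> X -> seq bool) (l : E -> seq X) :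
  PT (fun p : E * X => f p.1 p.2) -> PT l -> PT (fun e => enc_list (f e) (l e)).
Proof.
move=> Hf Hl; rewrite /enc_list; by pt.
Qed.

Lemma PT_encb (l : E -> seq bool) : PT l -> PT (fun e => encb (l e)).
Proof. by move=> Hl; apply: PT_enc_list; pt. Qed.
End Ctx.

(* Parsers are total; their answers are meaningful only on well-formed input,  *)
(* which is recognised afterwards by encoding the answer again.                *)
Definition parser T `{Enc T} (enc : T -> seq bool) (p : seq bool -> T * seq bool) :=
  [/\ PT p, forall s, size (p s).2 <= size s & forall a r, p (enc a ++ r) = (a, r)].

Definition p_bit (s : seq bool) := (head false s, behead s).
Definition p_unit (s : seq bool) := (tt, s).
Definition p_pair S T (p : seq bool -> S * seq bool) (q : seq bool -> T * seq bool) s :=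
  (((p s).1, (q (p s).2).1), (q (p s).2).2).

Definition pl_step T (p : seq bool -> T * seq bool) (st : seq T * seq bool * bool) (_ : bool) :=
  if st.2 then
    if head false st.1.2 then
      ((p (behead st.1.2)).1 :: st.1.1, (p (behead st.1.2)).2, true)
    else (st.1.1, behead st.1.2, false)
  else st.

(** The input also serves as fuel. The flag in the state drops when the end mark has been read, and
    the remaining rounds are idle. *)
Definition p_list T (p : seq bool -> T * seq bool) s :=
  (rev (foldl (pl_step p) ([::], s, true) s).1.1, (foldl (pl_step p) ([::], s, true) s).1.2).

Lemma parser_bit : parser (fun b => [:: b]) p_bit.
Proof. by split=> [|s|b r] //; [rewrite /p_bit; pt | rewrite size_behead leq_pred]. Qed.

Lemma parser_unit : parser (fun _ => [::]) p_unit.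
Proof. by split=> [|s|[] r] //; rewrite /p_unit; pt. Qed.

Lemma parser_pair S T `{Enc S} `{Enc T} (e1 : S -> seq bool) (e2 : T -> seq bool) p q :
  parser e1 p -> parser e2 q -> parser (fun a => e1 a.1 ++ e2 a.2) (p_pair p q).
Proof.
case=> Hp Sp Cp [Hq Sq Cq]; split=> [|s|[a b] r].
- have Hq' : PT (fun s => q (p s).2) by apply: (PT_app1 Hq); apply: PT_snd.
  by rewrite /p_pair; pt.
- exact: leq_trans (Sq _) (Sp _).
by rewrite /p_pair -catA Cp /= Cq.
Qed.

Lemma parser_list T `{Enc T} (enc : T -> seq bool) p :
  parser enc p -> parser (enc_list enc) (p_list p).
Proof.
move=> [Hp Sp Cp]; split.
- have [c Hc] : PB (fun s => esz (p s)) by exact: (PB_PT Hp).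
  (* [B] bounds one parsed item and its list cell: the remaining input is never longer than [s], and
     a bit string of length m has a tree of size at most 4m+1. *)
  pose (B := fun s : seq bool => (4 * size s + 1 + 2) ^ c + 1).
  have Hst : PT (fun s => foldl (pl_step p) ([::], s, true) s).
    pose (F := fun s : seq bool => (esz s + 1) * B s + 4 * size s + 10).
    apply: (PT_foldl_bd (f := fun _ => pl_step p) (F := F)); last first.
    - move=> s i _.
      have main : forall st, size (foldl (pl_step p) st (take i s)).1.2 <= size st.1.2 /\
         (size st.1.2 <= size s -> esz (foldl (pl_step p) st
           (take i s)).1.1 <= esz st.1.1 + size (take i s) * B s); last first.
        have [/= H1 /(_ (leqnn _)) H2] := main ([::], s, true).
        move: H1 H2; case: (foldl _ _ _) => [[acc u] b] /= H1 H2.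
        rewrite !esz_pair /F; generalize (esz_bits_size u) (esz_bool b).
        rewrite esz_nil in H2; have : size (take i s) * B s <= esz s * B s.
          rewrite leq_mul2r; apply/orP; right; rewrite size_take_min.
          by generalize (size_esz s); lia.
        by rewrite mulnDl mul1n; lia.
      elim: (take i s) => [|x w IH] st /=; first by rewrite mul0n addn0.
      have [H1 H2] := IH (pl_step p st x).
      have Hs : size (pl_step p st x).1.2 <= size st.1.2.
        rewrite /pl_step; case: (st) => [[acc u] []] //=.
        case: ifP => _ /=; last by rewrite size_behead; lia.
        by apply: leq_trans (Sp _) _; rewrite size_behead; lia.
      split; first exact: leq_trans H1 Hs.
      move=> H3; apply: leq_trans (H2 (leq_trans Hs H3)) _.
      rewrite mulSn addnA leq_add2r.
      move: H3; rewrite /pl_step; case: (st) => [[acc u] []] //=; last by lia.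
      case: ifP => _ /=; last by lia.
      move=> H3; rewrite esz_cons.
      move: (Hc (behead u)); case: (p (behead u)) => a u' /=; rewrite esz_pair.
      have : (esz (behead u) + 2) ^ c <= (4 * size s + 1 + 2) ^ c.
        apply: pow_mono; apply: leq_trans (esz_bits_size _) _.
        by rewrite size_behead; lia.
      by rewrite /B; lia.
    - have [HE1 HE2] : PB (fun s : seq bool => esz s) /\ PB (fun s : seq bool => size s).
        split; first exact: PB_self.
        by apply: PB_le (@PB_self _ _) => s; apply: ltnW; apply: size_esz.
      rewrite /F /B.
      by do ![apply: PB_add | apply: PB_mul | apply: PB_pow | exact: PB_const | exact: HE1 |
        exact: HE2].
    - by pt.
    - by pt.
    have K : PT (fun q : seq bool * (seq T * seq bool * bool) * bool => p (behead q.1.2.1.2)).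
      by apply: (PT_app1 Hp); pt.
    by rewrite /pl_step; pt.
  by rewrite /p_list; pt.
- move=> s; rewrite /p_list /=.
  suff H1 : forall w st, size (foldl (pl_step p) st w).1.2 <= size st.1.2 by apply: (H1 s
    ([::], s, true)).
  elim=> //= x w IH st; apply: leq_trans (IH _) _.
  rewrite /pl_step; case: st => [[acc u] []] //=.
  case: ifP => _ /=; last by rewrite size_behead; lia.
  by apply: leq_trans (Sp _) _; rewrite size_behead; lia.
move=> l r; rewrite /p_list.
(* One round per item and one for the end mark; the encoding itself is long enough to pay for
   them. *)
suff H1 : forall w acc, size l < size w ->
  foldl (pl_step p) (acc, enc_list enc l ++ r, true) w = (rev l ++ acc, r, false).
  rewrite H1 /=; first by rewrite cats0 revK.
  rewrite size_cat; have : size l < size (enc_list enc l).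
    by elim: (l) => // a m IH; rewrite enc_list_cons /= size_cat; lia.
  lia.
elim: l => [|a l IH] [|x w] acc // Hw.
  by rewrite /=; elim: w {Hw} => //= y w IH.
have Ea : pl_step p (acc, enc_list enc (a :: l) ++ r, true) x = (a :: acc,
  enc_list enc l ++ r, true).
  by rewrite /pl_step enc_list_cons /= -catA Cp.
by rewrite [LHS]/= Ea IH // rev_cons cat_rcons.
Qed.

Lemma parser_inj T `{Enc T} (enc : T -> seq bool) p : parser enc p ->
  forall a b r s, enc a ++ r = enc b ++ s -> a = b /\ r = s.
Proof. by case=> _ _ C a b r s /(congr1 p); rewrite !C => -[-> ->]. Qed.

Lemma parser_encb : parser encb (p_list p_bit).
Proof. exact/parser_list/parser_bit. Qed.

End Parse.

(** * Formulas and databases over bit strings *)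

Section Weighted.
Variable V : eqType.
Implicit Types (phi : seq (seq (seq (V * bool)))) (T : seq V).

Definition vars_of phi : seq V := map fst (flatten (flatten phi)).

Definition sat_by T phi : bool :=
  all (fun D => has (fun C => all (fun l => (l.1 \in T) == l.2) C) D) phi.

Definition wsat phi k :=
  exists T, [/\ uniq T, size T = k, {subset T <= vars_of phi} & sat_by T phi].

Lemma mem_vars_of phi D C l : D \in phi -> C \in D -> l \in C -> l.1 \in vars_of phi.
Proof.
move=> HD HC Hl; apply: map_f; apply/flattenP; exists C => //.
by apply/flattenP; exists D.
Qed.

Lemma mem_vars_ofP phi v : v \in vars_of phi ->
  exists D C l, [/\ D \in phi, C \in D, l \in C & l.1 = v].
Proof.
case/mapP=> l /flattenP [C /flattenP [D HD HC] Hl] ->.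
by exists D, C, l.
Qed.
End Weighted.

Definition map_vars V W (f : V -> W) (phi : seq (seq (seq (V * bool)))) :=
  [seq [seq [seq (f l.1, l.2) | l <- C] | C <- D] | D <- phi].


Lemma sat_map_vars (V W : eqType) (f : V -> W) T phi : injective f ->
  sat_by (map f T) (map_vars f phi) = sat_by T phi.
Proof.
move=> Hf; rewrite /sat_by all_map; apply: eq_all => D /=; rewrite has_map.
apply: eq_has => C /=; rewrite all_map; apply: eq_all => l /=.
by rewrite mem_map.
Qed.

Lemma wsat_map_vars (V W : eqType) (f : V -> W) phi k : injective f ->
  wsat (map_vars f phi) k <-> wsat phi k.
Proof.
move=> Hf; have Hv : vars_of (map_vars f phi) =i map f (vars_of phi).
  move=> w; apply/idP/mapP.
    case/mem_vars_ofP=> _ [_ [_ [/mapP [D HD ->] /mapP [C HC ->] /mapP [l Hl ->] <-]]].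
    by exists l.1 => //; apply: mem_vars_of HD HC Hl.
  case=> v /mem_vars_ofP [D [C [l [HD HC Hl <-]]]] ->.
  have HD' := map_f (map (map (fun l => (f l.1, l.2)))) HD.
  have HC' := map_f (map (fun l => (f l.1, l.2))) HC.
  exact: mem_vars_of HD' HC' (map_f (fun l => (f l.1, l.2)) Hl).
split=> -[T [H1 H2 H3 H4]].
  (* Only variables occurring in the formula may be chosen, so preimages are found among them. *)
  pose T' := [seq v <- undup (vars_of phi) | f v \in T].
  have ET : perm_eq (map f T') T.
    apply: uniq_perm => [|//|w]; first by rewrite map_inj_uniq // filter_uniq // undup_uniq.
    apply/mapP/idP => [[v]|Hw]; first by rewrite mem_filter => /andP [H _] ->.
    have := H3 w Hw; rewrite Hv => /mapP [v Hvv Ev]; exists v => //.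
    by rewrite mem_filter -Ev Hw mem_undup.
  exists T'; split.
  - by rewrite filter_uniq // undup_uniq.
  - by rewrite -H2 -(perm_size ET) size_map.
  - by move=> v; rewrite mem_filter mem_undup => /andP [].
  rewrite -(sat_map_vars _ _ Hf); move: H4; congr is_true; apply: eq_all => D;
    apply: eq_has => C.
  by apply: eq_all => l; rewrite (perm_mem ET).
exists (map f T); split.
- by rewrite map_inj_uniq.
- by rewrite size_map.
- by move=> w /mapP [v /H3 Hvv ->]; rewrite Hv map_f.
by rewrite sat_map_vars.
Qed.

(** Variables are kept as bit strings: the value of a binary name may be exponential in its length,
    so it cannot be converted to a unary number. *)
Definition formulab := seq (seq (seq (seq bool * bool))).
Definition enc_litb (l : seq bool * bool) := encb l.1 ++ [:: l.2].
Definition enc_fb : formulab -> seq bool := enc_list (enc_list (enc_list enc_litb)).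
Definition canon_fb (phi : formulab) := all (all (all (fun l => canon l.1))) phi.

Lemma enc_fb_map phi : enc_fb (map_vars bits phi) = enc_formula3 phi.
Proof.
rewrite /enc_fb /enc_formula3 /map_vars enc_list_map; apply: eq_enc_list => D _.
rewrite enc_list_map; apply: eq_enc_list => C _.
rewrite enc_list_map; apply: eq_enc_list => l _.
by rewrite /enc_litb /enc_lit enc_natE.
Qed.

Lemma canon_fb_map phi : canon_fb (map_vars bits phi).
Proof.
rewrite /canon_fb all_map; apply/allP => D _ /=; rewrite all_map; apply/allP => C _ /=.
by rewrite all_map; apply/allP => l _ /=; apply: canon_bits.
Qed.

Lemma canon_fbK phi : canon_fb phi -> map_vars bits (map_vars bval phi) = phi.
Proof.
move=> H; rewrite /map_vars -map_comp -[RHS]map_id; apply/eq_in_map => D /(allP H) HD /=.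
rewrite -map_comp -[RHS]map_id; apply/eq_in_map => C /(allP HD) HC /=.
rewrite -map_comp -[RHS]map_id; apply/eq_in_map => l /(allP HC) Hl /=.
by rewrite bvalK //; case: l {Hl}.
Qed.

Lemma WSat3E x k :
  WSat3 x k <-> exists phi, [/\ x = enc_fb phi, canon_fb phi & wsat phi k].
Proof.
split=> [[phi [-> H]]|[phi [-> H1 H2]]].
  exists (map_vars bits phi); rewrite enc_fb_map canon_fb_map; split=> //.
  by apply/wsat_map_vars; first exact: can_inj bitsK.
exists (map_vars bval phi); rewrite -enc_fb_map canon_fbK //; split=> //.
by apply/(wsat_map_vars _ _ (can_inj bitsK)); rewrite canon_fbK.
Qed.

Definition dbb := seq (seq (seq bool)).
Definition enc_dbb : dbb -> seq bool := enc_list (enc_list encb).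
Definition canon_db (d : dbb) := all (all canon) d.
Definition db_val (d : dbb) : seq (seq nat) := [seq [seq bval c | c <- row] | row <- d].
Definition db_bits (d : seq (seq nat)) : dbb := [seq [seq bits c | c <- row] | row <- d].

Lemma db_bitsK d : db_val (db_bits d) = d.
Proof.
rewrite /db_val /db_bits -map_comp -[RHS]map_id; apply: eq_map => row /=.
by rewrite -map_comp -[RHS]map_id; apply: eq_map => c /=; rewrite bitsK.
Qed.

Lemma canon_db_bits d : canon_db (db_bits d).
Proof.
rewrite /canon_db all_map; apply/allP => row _ /=; rewrite all_map.
by apply/allP => c _ /=; apply: canon_bits.
Qed.

Lemma enc_db_bits d : enc_dbb (db_bits d) = enc_db d.
Proof.
rewrite /enc_dbb /enc_db enc_list_map; apply: eq_enc_list => row _.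
by rewrite enc_list_map; apply: eq_enc_list => c _; rewrite enc_natE.
Qed.

Lemma canon_dbK d : canon_db d -> db_bits (db_val d) = d.
Proof.
move=> H; rewrite /db_val /db_bits -map_comp -[RHS]map_id;
  apply/eq_in_map => row /(allP H) Hr /=.
by rewrite -map_comp -[RHS]map_id; apply/eq_in_map => c /(allP Hr) Hc /=; rewrite bvalK.
Qed.

Definition wf_dbb (n : seq bool) (d : dbb) :=
  [&& canon n, canon_db d, n != [::], uniq d & all (fun r => bits (size r) == n) d].

Lemma wf_db_bits n d : wf_dbb (bits n) (db_bits d) = db_wf n d.
Proof.
rewrite /wf_dbb /db_wf canon_bits canon_db_bits -andbA /=; congr [&& _, _ & _].
- by case: n.
- by rewrite map_inj_uniq //; apply/inj_map/can_inj/bitsK.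
by rewrite all_map; apply: eq_all => r /=; rewrite size_map (can_eq bitsK).
Qed.

Lemma wf_db_val n d : wf_dbb n d -> db_wf (bval n) (db_val d).
Proof.
move=> H; rewrite -wf_db_bits; case/and5P: (H) => H1 H2 _ _ _.
by rewrite bvalK // canon_dbK.
Qed.

Section Parsers.
Variable n : nat.

Definition p_fb := p_list (p_list (p_list (p_pair (p_list p_bit) p_bit))).
Definition p_db := p_list (p_list (p_list p_bit)).

Lemma parser_fb : parser n enc_fb p_fb.
Proof.
do 3 apply: parser_list.
exact: (@parser_pair n _ _ _ _ encb (fun b => [:: b]) _ _ (parser_encb n) (parser_bit n)).
Qed.

Lemma parser_db : parser n enc_dbb p_db.
Proof. exact/parser_list/parser_list/parser_encb. Qed.
End Parsers.

(** * From inclusion dependencies to formulas *)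

(* The flag restricts column maps to the identity. *)
Definition pairs (ident : bool) (N M : nat) : seq (nat * nat) :=
  [seq p <- [seq (a, b) | a <- iota 0 N, b <- iota 0 M] | ident ==> (p.1 == p.2)].

Definition clash (p q : nat * nat) : bool := (p != q) && ((p.1 == q.1) || (p.2 == q.2)).

Lemma mem_pairs (ident : bool) N M p :
  (p \in pairs ident N M) = [&& p.1 < N, p.2 < M & ident ==> (p.1 == p.2)].
Proof.
rewrite mem_filter andbC andbA; congr (_ && _).
apply/allpairsP/andP => [[q [H1 H2 ->]]|[H1 H2]].
  by move: H1 H2; rewrite !mem_iota.
by exists p; rewrite !mem_iota; split=> //; case: p {H1 H2}.
Qed.

Lemma uniq_pairs (ident : bool) N M : uniq (pairs ident N M).
Proof.
by apply: filter_uniq; apply: allpairs_uniq; rewrite ?iota_uniq // => -[a b] [c d] _ _.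
Qed.

(** [T] is the graph of the column map. Absence of clashes says both that it is a function and that
    it is injective. *)
Definition has_ind (C : eqType) (ident : bool) N M (c0 : C) (r s : seq (seq C)) k :=
  exists T : seq (nat * nat),
  [/\ uniq T, size T = k, {subset T <= pairs ident N M},
      {in T &, forall p q, ~~ clash p q} &
      forall row, row \in r -> exists2 row', row' \in s &
        all (fun p => nth c0 row p.1 == nth c0 row' p.2) T].

Lemma has_ind_IND (ident : bool) N M (r s : seq (seq nat)) (X : {set 'I_N}) (sigma : 'I_N ->
  'I_M) :
  is_IND r s X sigma -> (ident -> {in X, forall a, sigma a = a :> nat}) ->
  has_ind ident N M 0 r s #|X|.
Proof.
move=> [Hinj Hrow] Hid; exists [seq (val a, val (sigma a)) | a <- enum X]; split.
- by rewrite map_inj_uniq ?enum_uniq // => a b [/val_inj].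
- by rewrite size_map cardE.
- move=> _ /mapP [a Ha ->]; rewrite mem_pairs /= !ltn_ord /=.
  by apply/implyP => /Hid -> //; rewrite -mem_enum.
- move=> _ _ /mapP [a Ha ->] /mapP [b Hb ->]; rewrite /clash /= negb_and negbK orbC -implybE.
  rewrite !mem_enum in Ha Hb; apply/implyP => /orP [/eqP/val_inj -> //|/eqP/val_inj E].
  by rewrite (Hinj a b).
move=> row /Hrow [row' Hr' Hag]; exists row' => //.
by apply/allP => _ /mapP [a Ha ->] /=; apply/eqP/Hag; rewrite -mem_enum.
Qed.

Lemma IND_has_ind (ident : bool) N M (r s : seq (seq nat)) k : 0 < M ->
  has_ind ident N M 0 r s k ->
  exists (X : {set 'I_N}) (sigma : 'I_N -> 'I_M),
    [/\ #|X| = k, is_IND r s X sigma & ident -> {in X, forall a, sigma a = a :> nat}].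
Proof.
case: M => // M _ [T [Tu Tk Ts Tc Tr]].
(* The pair of [T] that starts in column [a], unique because pairs do not clash. *)
pose at_ (a : 'I_N) := nth (0, 0) T (find (fun p : nat * nat => p.1 == a :> nat) T).
pose X := [set a : 'I_N | has (fun p : nat * nat => p.1 == a :> nat) T].
pose sigma a : 'I_M.+1 := inord (at_ a).2.
have atP a : a \in X -> at_ a \in T /\ (at_ a).1 = a.
  rewrite inE => Ha; split; first by rewrite mem_nth // -has_find.
  by apply/eqP; apply: (nth_find (0, 0) Ha).
have sigmaP a : a \in X -> sigma a = (at_ a).2 :> nat.
  by move=> /atP [/Ts H _]; move: H; rewrite mem_pairs => /and3P [_ H _]; rewrite inordK.
have pairP p : p \in T -> exists2 a, a \in X & p = at_ a.
  move=> Hp; have := Ts p Hp; rewrite mem_pairs => /and3P [H1 _ _].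
  have Ha : Ordinal H1 \in X by rewrite inE; apply/hasP; exists p => /=.
  exists (Ordinal H1) => //; have [H2 H3] := atP _ Ha.
  by have := Tc _ _ Hp H2; rewrite /clash H3 /= eqxx andbT negbK => /eqP.
exists X, sigma; split.
- rewrite -Tk cardE -(size_map val) -(size_map (fun p : nat * nat => p.1) T).
  apply: perm_size; apply: uniq_perm.
  + by rewrite map_inj_uniq ?enum_uniq //; apply: val_inj.
  + rewrite map_inj_in_uniq // => p q Hp Hq E; have := Tc _ _ Hp Hq.
    by rewrite /clash E eqxx andbT negbK => /eqP.
  move=> a; apply/mapP/mapP => [[b Hb ->]|[p /pairP [b Hb ->] ->]].
    by rewrite mem_enum in Hb; have [H1 H2] := atP b Hb; exists (at_ b).
  by exists b; rewrite ?mem_enum //; case: (atP b Hb).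
- split.
    move=> a b Ha Hb /(congr1 val) /=; rewrite !sigmaP // => E.
    have [H1 H2] := atP a Ha; have [H3 H4] := atP b Hb.
    have := Tc _ _ H1 H3; rewrite /clash E eqxx orbT andbT negbK => /eqP E2.
    by apply: val_inj; rewrite /= -H2 -H4 E2.
  move=> row /Tr [row' Hr' /allP Hag]; exists row' => // a Ha.
  have [H1 H2] := atP a Ha; have /eqP := Hag _ H1.
  by rewrite H2 sigmaP.
move=> Hi a Ha; rewrite sigmaP //; have [H1 H2] := atP a Ha.
by have := Ts _ H1; rewrite mem_pairs Hi => /and3P [_ _ /eqP <-].
Qed.

(** [bval] is injective on canonical strings and sends the default cell [[::]] to the default cell
    0, so agreement of cells is the same in both readings. *)
Lemma has_ind_val (ident : bool) N M (r s : dbb) k : canon_db r -> canon_db s ->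
  has_ind ident N M 0 (db_val r) (db_val s) k <-> has_ind ident N M [::] r s k.
Proof.
move=> Hr Hs.
have nth_val row a : nth 0 [seq bval c | c <- row] a = bval (nth [::] row a).
  case: (ltnP a (size row)) => H; first by rewrite (nth_map [::]).
  by rewrite !nth_default ?size_map.
have canon_nth (row : seq (seq bool)) a : all canon row -> canon (nth [::] row a).
  move=> H; case: (ltnP a (size row)) => H1; last by rewrite nth_default.
  by rewrite (allP H) // mem_nth.
have agree (row row' : seq (seq bool)) T : all canon row -> all canon row' ->
    all (fun p => nth 0 [seq bval c | c <- row] p.1 == nth 0 [seq bval c | c <- row'] p.2) T =
    all (fun p => nth [::] row p.1 == nth [::] row' p.2) T.
  move=> H1 H2; apply: eq_all => p; rewrite !nth_val.
  apply/eqP/eqP => [|-> //]; exact: bval_inj (canon_nth _ _ H1) (canon_nth _ _ H2).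
split=> -[T [H1 H2 H3 H4 H5]]; exists T; split=> // row Hrow.
  have [_ /mapP [row' Hrow' ->] Ha] := H5 _ (map_f _ Hrow).
  by exists row' => //; rewrite -agree //; [apply: (allP Hr) | apply: (allP Hs)].
case/mapP: Hrow => {}row Hrow ->; have [row' Hrow' Ha] := H5 _ Hrow.
exists [seq bval c | c <- row']; first exact: map_f.
by rewrite agree //; [apply: (allP Hr) | apply: (allP Hs)].
Qed.

(** Without rows only the number of columns counts: both projections are injective on a set without
    clashes, and conversely diagonal pairs can be chosen. *)
Lemma has_ind_nil (C : eqType) (ident : bool) N M (c0 : C) s k : (ident -> N = M) ->
  has_ind ident N M c0 [::] s k <-> k <= N /\ k <= M.
Proof.
move=> Hid; split=> [[T [Tu <- Ts Tc _]]|[H1 H2]].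
  have inj (f : nat * nat -> nat) K : (forall p q, clash p q = false -> f p = f q -> p = q) ->
      (forall p, p \in T -> f p < K) -> size T <= K.
    move=> Hf HK; rewrite -(size_map f) -(size_iota 0 K); apply: uniq_leq_size.
      rewrite map_inj_in_uniq // => p q Hp Hq; apply: Hf; exact/negbTE/Tc.
    by move=> _ /mapP [p Hp ->]; rewrite mem_iota HK.
  split.
    apply: (inj (fun p => p.1)) => [p q|p /Ts]; last by rewrite mem_pairs => /and3P [].
    by rewrite /clash => H E; move: H; rewrite E eqxx andbT => /negbFE /eqP.
  apply: (inj (fun p => p.2)) => [p q|p /Ts]; last by rewrite mem_pairs => /and3P [].
  by rewrite /clash => H E; move: H; rewrite E eqxx orbT andbT => /negbFE /eqP.
exists [seq (i, i) | i <- iota 0 k]; split=> //.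
- by rewrite map_inj_uniq ?iota_uniq // => i j [].
- by rewrite size_map size_iota.
- move=> _ /mapP [i Hi ->]; rewrite mem_iota /= in Hi; rewrite mem_pairs /= eqxx implybT.
  by rewrite (leq_trans Hi H1) (leq_trans Hi H2).
move=> _ _ /mapP [i _ ->] /mapP [j _ ->]; rewrite /clash /= orbb.
by case: (eqVneq i j) => [->|]; rewrite ?eqxx // andbF.
Qed.

Definition vcode (p : nat * nat) : seq bool := code [:: p.1; p.2].

Lemma vcode_inj : injective vcode.
Proof. by move=> [a b] [c d] /code_inj [-> ->]. Qed.

(** The inner conjunction forbids exactly the pairs of columns on which [row] and [row'] differ. *)
Definition row_clauses (ident : bool) N M (r s : dbb) : formulab :=
  [seq [seq [seq (vcode p, false) | p <- [seq p <- pairs ident N M | nth [::] row p.1 != nth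
    [::] row' p.2]]
    | row' <- s] | row <- r].

Definition clash_clauses (ident : bool) N M : formulab :=
  [seq [:: [:: (vcode pq.1, false)]; [:: (vcode pq.2, false)]]
    | pq <- [seq pq <- [seq (p, q) | p <- pairs ident N M,
      q <- pairs ident N M] | clash pq.1 pq.2]].

(* Tautologies, present only to make every variable occur in the formula. *)
Definition var_clauses (ident : bool) N M : formulab :=
  [seq [:: [:: (vcode p, true)]; [:: (vcode p, false)]] | p <- pairs ident N M].

Definition ind_formula (ident : bool) N M r s : formulab :=
  row_clauses ident N M r s ++ clash_clauses ident N M ++ var_clauses ident N M.

Lemma vars_ind_formula (ident : bool) N M r s :
  vars_of (ind_formula ident N M r s) =i map vcode (pairs ident N M).
Proof.
move=> v; apply/idP/idP => [/mem_vars_ofP [D [C [l [HD HC Hl <-]]]]|/mapP [p Hp ->]].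
  move: HD; rewrite !mem_cat => /or3P [] /mapP.
  - case=> row _ ED; rewrite ED in HC; case/mapP: HC => row' _ EC; rewrite EC in Hl.
    by case/mapP: Hl => p; rewrite mem_filter => /andP [_ Hp] ->; apply: map_f.
  - case=> -[p q]; rewrite mem_filter => /andP [_ /allpairsP [[p' q'] [Hp Hq [-> ->]]]] ED.
    by move: HC; rewrite ED !inE => /orP [] /eqP EC; move: Hl; rewrite EC inE => /eqP ->;
      apply: map_f.
  case=> p Hp ED; move: HC; rewrite ED !inE => /orP [] /eqP EC;
  by move: Hl; rewrite EC inE => /eqP ->; apply: map_f.
apply: (@mem_vars_of _ _ [:: [:: (vcode p, true)];
  [:: (vcode p, false)]] [:: (vcode p, true)] (vcode p, true)).
- rewrite !mem_cat; apply/or3P/Or33.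
  exact: (map_f (fun p => [:: [:: (vcode p, true)]; [:: (vcode p, false)]]) Hp).
- by rewrite mem_head.
- by rewrite mem_head.
Qed.

Lemma canon_ind_formula (ident : bool) N M r s : canon_fb (ind_formula ident N M r s).
Proof.
apply/allP => D HD; apply/allP => C HC; apply/allP => l Hl.
have := mem_vars_of HD HC Hl; rewrite vars_ind_formula => /mapP [p _ ->].
exact: code_canon.
Qed.

Lemma sat_ind_formula (ident : bool) N M r s T : {subset T <= pairs ident N M} ->
  sat_by (map vcode T) (ind_formula ident N M r s) <->
  {in T &, forall p q, ~~ clash p q} /\
  (forall row, row \in r -> exists2 row', row' \in s &
    all (fun p => nth [::] row p.1 == nth [::] row' p.2) T).
Proof.
move=> HT; rewrite /sat_by !all_cat.
have Hmem p : (vcode p \in map vcode T) = (p \in T) by rewrite (mem_map vcode_inj).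
have -> : all [eta has (all (fun l => (l.1 \in map vcode T) == l.2))] (var_clauses ident N M).
  by apply/allP => _ /mapP [p _ ->] /=; rewrite !andbT orbF; case: (_ \in _).
rewrite andbT; split=> [/andP [/allP H1 /allP H2]|[H1 H2]].
  split=> [p q Hp Hq|row Hrow].
    apply/negP => Hc.
    have := H2 [:: [:: (vcode p, false)]; [:: (vcode q, false)]].
    rewrite /= !Hmem Hp Hq /= => H; apply: notF; apply: H.
    apply: (map_f (fun pq => [:: [:: (vcode pq.1, false)];
      [:: (vcode pq.2, false)]]) (x := (p, q))).
    by rewrite mem_filter /= Hc; apply/allpairsP; exists (p, q); split=> //; apply: HT.
  have /hasP [_ /mapP [row' Hrow' ->] /allP Hall] := H1 _ (map_f _ Hrow).
  exists row' => //; apply/allP => p Hp; apply/negPn/negP => Hne.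
  have /Hall : (vcode p, false) \in [seq (vcode p,
    false) | p <- [seq p <- pairs ident N M | nth [::] row p.1 != nth [::] row' p.2]].
    by apply: (map_f (fun p => (vcode p, false))); rewrite mem_filter Hne HT.
  by rewrite /= Hmem Hp.
apply/andP; split; apply/allP => D /mapP [].
  move=> row Hrow ->; have [row' Hrow' /allP Hag] := H2 row Hrow.
  apply/hasP; exists [seq (vcode p,
    false) | p <- [seq p <- pairs ident N M | nth [::] row p.1 != nth [::] row' p.2]].
    exact: (map_f (fun row' => [seq (vcode p,
      false) | p <- [seq p <- pairs ident N M | nth [::] row p.1 != nth [::] row' p.2]]) Hrow').
  apply/allP => x /mapP [p]; rewrite mem_filter => /andP [Hne _] -> /=.
  by rewrite Hmem; apply/eqP/negbTE; apply: contra Hne => /Hag.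
move=> [p q]; rewrite mem_filter => /andP [Hc _] -> /=; rewrite !Hmem !andbT orbF.
case Hp: (p \in T); case Hq: (q \in T) => //=.
by have := H1 _ _ Hp Hq; rewrite Hc.
Qed.

Lemma wsat_ind_formula (ident : bool) N M r s k :
  wsat (ind_formula ident N M r s) k <-> has_ind ident N M [::] r s k.
Proof.
split=> [[TV [Hu Hk Hs Hsat]]|[T [Hu Hk Hs Hc Hr]]].
  pose T := [seq p <- pairs ident N M | vcode p \in TV].
  have HT : {subset T <= pairs ident N M} by move=> p; rewrite mem_filter => /andP [].
  have ET : perm_eq (map vcode T) TV.
    apply: uniq_perm => [|//|v].
      by rewrite (map_inj_uniq vcode_inj) /T filter_uniq ?uniq_pairs.
    apply/mapP/idP => [[p]|Hv]; first by rewrite mem_filter => /andP [H _] ->.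
    have := Hs v Hv; rewrite vars_ind_formula => /mapP [p Hp Ep]; exists p => //.
    by rewrite mem_filter -Ep Hv.
  have : sat_by (map vcode T) (ind_formula ident N M r s).
    move: Hsat; congr is_true; apply: eq_all => D; apply: eq_has => C.
    by apply: eq_all => l; rewrite (perm_mem ET).
  case/(sat_ind_formula _ _ HT) => H1 H2; exists T; split=> //.
    by rewrite filter_uniq ?uniq_pairs.
  by rewrite -Hk -(perm_size ET) size_map.
exists (map vcode T); split.
- by rewrite (map_inj_uniq vcode_inj).
- by rewrite size_map.
- by move=> _ /mapP [p /Hs Hp ->]; rewrite vars_ind_formula map_f.
exact/sat_ind_formula.
Qed.

(** A non-empty database reveals its number of columns in unary through its first row. For empty [r]
    the binary numbers [nb] and [mb] may be exponentially large and are only compared with [k]. The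
    string [[:: false]] encodes the empty formula, a yes-instance of weight 0, and [[::]] encodes no
    formula. *)
Definition ind_red (ident : bool) (k : nat) (nb mb : seq bool) (r s : dbb) : seq bool * nat :=
  if r == [::] then
    if (nb \notin [seq bits j | j <- iota 0 k]) && (mb \notin [seq bits j | j <- iota 0 k])
    then ([:: false], 0) else ([::], 0)
  else if s == [::] then ([::], 0)
  else (enc_fb (ind_formula ident (size (head [::] r)) (size (head [::] s)) r s), k).

Lemma WSat3_nil k : ~ WSat3 [::] k.
Proof. by case=> phi []; case: phi. Qed.

Lemma notin_bits b k : canon b -> (b \notin [seq bits j | j <- iota 0 k]) = (k <= bval b).
Proof.
move=> Hb; rewrite leqNgt; congr negb; apply/mapP/idP => [[j]|H].
  by rewrite mem_iota /= => Hj ->; rewrite bitsK.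
by exists (bval b); rewrite ?bvalK // mem_iota.
Qed.

Lemma wf_dbb_size nb r : wf_dbb nb r -> r != [::] -> bval nb = size (head [::] r).
Proof.
case/and5P=> _ _ _ _; case: r => //= row r /andP [/eqP <- _] _; exact: bitsK.
Qed.

Lemma ind_red_correct (ident : bool) k nb mb r s : wf_dbb nb r -> wf_dbb mb s -> (ident ->
  nb = mb) ->
  let y := ind_red ident k nb mb r s in
  has_ind ident (bval nb) (bval mb) 0 (db_val r) (db_val s) k <-> WSat3 y.1 y.2.
Proof.
move=> Hr Hs Hid /=; case/and5P: (Hr) => Cn Cr _ _ _; case/and5P: (Hs) => Cm Cs _ _ _.
rewrite has_ind_val // /ind_red; case: eqVneq => [->|Nr].
  rewrite has_ind_nil; last by move=> /Hid ->.
  rewrite !notin_bits //; split=> [[-> ->] /=|].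
    by exists [::]; split=> //; exists [::].
  by case: andP => // _ /WSat3_nil.
case: eqVneq => [Es|Ns] /=.
  split=> [[T [_ _ _ _ H]]|/WSat3_nil //].
  by case: r Nr H {Hr Cr} => // row r _ /(_ row (mem_head _ _)) []; rewrite Es.
rewrite -(wf_dbb_size Hr) // -(wf_dbb_size Hs) //.
split=> [H|/WSat3E [phi [E Cphi H]]].
  apply/WSat3E; exists (ind_formula ident (bval nb) (bval mb) r s).
  by rewrite canon_ind_formula; split=> //; apply/wsat_ind_formula.
apply/wsat_ind_formula; move: H.
by have [-> _] := parser_inj (parser_fb 0) (r := [::]) (s := [::]) (congr1 (cat^~ [::]) E).
Qed.

(** * Polynomial reductions *)

Ltac pt_ext ::= first
 [ refine (PT_encb _) | refine (PT_enc_list _ _) | refine (PT_bits _) | refine (PT_code _)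
 | refine (PT_canon _) ].

(** The function must be in [PT] for every alphabet size, because the alphabet will be dictated by
    the machine that is simulated before it. *)
Definition poly_reduction (Q Q' : pproblem) : Prop :=
  exists F : seq bool -> seq bool, (forall n, PT n F) /\
    forall x k, exists x' k', [/\ F (enc_pair x k) = enc_pair x' k', k' <= k.+1
      & Q x k <-> Q' x' k'].

Lemma enc_pair_list x k : enc_pair x k = enc_list (fun _ : unit => [::]) (nseq k tt) ++ x.
Proof.
rewrite /enc_pair; elim: k => // k IH.
by rewrite -[nseq k.+1 tt]/(tt :: nseq k tt) enc_list_cons /= -IH.
Qed.

Lemma poly_reduction_intro T `{Enc T} (enc : T -> seq bool) p (valid : T -> bool)
    (R : T -> nat -> Prop) (G : nat -> T -> seq bool * nat) (Q Q' : pproblem) :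
  (forall n, parser n enc p) -> (forall n, PT n enc) -> (forall n, PT n valid) ->
  (forall n, PT n (fun q : nat * T => G q.1 q.2)) ->
  (forall x k, Q x k <-> exists v, [/\ x = enc v, valid v & R v k]) ->
  (forall v k, valid v -> (R v k <-> Q' (G k v).1 (G k v).2) /\ (G k v).2 <= k.+1) ->
  ~ Q' [::] 0 -> poly_reduction Q Q'.
Proof.
move=> Hp He Hv HG HQ HR HN.
(* Input that is not reproduced by encoding the parsed value, or that is invalid, goes to the fixed
   no-instance [([::], 0)]. *)
pose y k (x : seq bool) := let v := (p x).1 in
  if (enc v == x) && valid v then G k v else ([::], 0).
exists (fun z => let u := p_list p_unit z in let y := y (size u.1) u.2 in enc_pair y.1 y.2).
split=> [n|x k].
  have [Hp1 _ _] := Hp n; have [Hu _ _] := parser_list (parser_unit n).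
  have {}He := He n; have {}Hv := Hv n; have {}HG := HG n.
  have Hd : PT n (fun z => (p (p_list p_unit z).2).1).
    by apply: PT_fst; apply: (PT_app1 Hp1); pt.
  have H1 : PT n (fun z => enc (p (p_list p_unit z).2).1) by apply: (PT_app1 He).
  have H2 : PT n (fun z => valid (p (p_list p_unit z).2).1) by apply: (PT_app1 Hv).
  have H3 : PT n (fun z => G (size (p_list p_unit z).1) (p (p_list p_unit z).2).1).
    by apply: (PT_app2 HG); pt.
  by rewrite /enc_pair /y; cbv zeta beta; pt.
have [_ _ Hu] := parser_list (parser_unit 0).
exists (y k x).1, (y k x).2.
split; first by cbv zeta; rewrite (enc_pair_list x k) Hu /= size_nseq.
  by rewrite /y; case: andP => // -[_ /(HR _ k)] [].
rewrite /y.
case: andP => [[/eqP E V]|Hn].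
  have [[H1 H2] _] := HR _ k V; split=> [/HQ [v [Ev Vv Rv]]|/H2 H3].
    apply: H1; have [_ _ C] := Hp 0.
    by have := C v [::]; rewrite cats0 -Ev => ->.
  by apply/HQ; exists (p x).1.
split=> [/HQ [v [Ev Vv Rv]]|/HN //]; case: Hn.
have [_ _ C] := Hp 0; have := C v [::]; rewrite cats0 -Ev => -> /=.
by rewrite -Ev eqxx.
Qed.

Section PTdb.
Variable n : nat.
Context {E : Type} `{Enc E}.

Lemma PT_enc_dbb (d : E -> dbb) : PT n d -> PT n (fun e => enc_dbb (d e)).
Proof. by move=> Hd; rewrite /enc_dbb; pt. Qed.

Lemma PT_enc_fb (d : E -> formulab) : PT n d -> PT n (fun e => enc_fb (d e)).
Proof. by move=> Hd; rewrite /enc_fb /enc_litb; pt. Qed.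

Lemma PT_wf_dbb (b : E -> seq bool) (d : E -> dbb) :
  PT n b -> PT n d -> PT n (fun e => wf_dbb (b e) (d e)).
Proof. by move=> Hb Hd; rewrite /wf_dbb /canon_db; pt. Qed.
End PTdb.

Section PTpairs.
Variable n : nat.
Context {E : Type} `{Enc E}.

Lemma PT_pairs ident (N M : E -> nat) : PT n N -> PT n M -> PT n (fun e =>
  pairs ident (N e) (M e)).
Proof.
by move=> HN HM; rewrite /pairs; pt.
Qed.
End PTpairs.

Ltac pt_ext ::= first
 [ refine (PT_encb _) | refine (PT_enc_fb _) | refine (PT_enc_dbb _)
 | refine (PT_wf_dbb _ _) | refine (PT_pairs _ _ _)
 | refine (PT_enc_list _ _) | refine (PT_bits _) | refine (PT_code _) | refine (PT_canon _) ].

Lemma PT_ind_red n ident :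
  PT n (fun q : nat * (seq bool * (seq bool * (dbb * dbb))) =>
    ind_red ident q.1 q.2.1 q.2.2.1 q.2.2.2.1 q.2.2.2.2).
Proof.
rewrite /ind_red /ind_formula /row_clauses /clash_clauses /var_clauses /vcode /clash.
by pt.
Qed.

Lemma wf_dbb_gt0 b d : wf_dbb b d -> 0 < bval b.
Proof. by move/wf_db_val => /andP [/andP []]. Qed.

(** * Both dependency problems in terms of bit strings, and their membership reductions *)

Definition id_input := (seq bool * (seq bool * (dbb * dbb)))%type.
Definition enc_id (v : id_input) :=
  encb v.1 ++ (encb v.2.1 ++ (enc_dbb v.2.2.1 ++ enc_dbb v.2.2.2)).
Definition wf_id (v : id_input) := wf_dbb v.1 v.2.2.1 && wf_dbb v.2.1 v.2.2.2.
Definition ind_id (v : id_input) k :=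
  exists (X : {set 'I_(bval v.1)}) (sigma : 'I_(bval v.1) -> 'I_(bval v.2.1)),
    #|X| = k /\ is_IND (db_val v.2.2.1) (db_val v.2.2.2) X sigma.

Definition idid_input := (seq bool * (dbb * dbb))%type.
Definition enc_idid (v : idid_input) := encb v.1 ++ (enc_dbb v.2.1 ++ enc_dbb v.2.2).
Definition wf_idid (v : idid_input) := wf_dbb v.1 v.2.1 && wf_dbb v.1 v.2.2.
Definition ind_idid (v : idid_input) k :=
  exists X : {set 'I_(bval v.1)}, #|X| = k /\ is_IND (db_val v.2.1) (db_val v.2.2) X id.

Lemma parser_id n : parser n enc_id
  (p_pair (p_list p_bit) (p_pair (p_list p_bit) (p_pair p_db p_db))).
Proof.
have H1 := parser_encb n; have H2 := parser_db n.
exact: (parser_pair H1 (parser_pair H1 (parser_pair H2 H2))).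
Qed.

Lemma parser_idid n : parser n enc_idid (p_pair (p_list p_bit) (p_pair p_db p_db)).
Proof.
have H1 := parser_encb n; have H2 := parser_db n.
exact: (parser_pair H1 (parser_pair H2 H2)).
Qed.

Lemma ID_problemE x k : ID_problem x k <-> exists v, [/\ x = enc_id v, wf_id v & ind_id v k].
Proof.
split=> [[n [m [r [s [Hr Hs -> H]]]]]|[v [-> /andP [Hr Hs] H]]].
  exists (bits n, (bits m, (db_bits r, db_bits s))).
  rewrite /enc_id /wf_id /ind_id /= -!enc_natE !enc_db_bits !wf_db_bits Hr Hs !bitsK !db_bitsK.
  by split.
case/andP: (Hr) => Cn /andP [Cr _]; case/andP: (Hs) => Cm /andP [Cs _].
exists (bval v.1), (bval v.2.1), (db_val v.2.2.1), (db_val v.2.2.2).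
by split; rewrite ?wf_db_val // -!encb_nat // -!enc_db_bits !canon_dbK.
Qed.

Lemma ID_identity_problemE x k :
  ID_identity_problem x k <-> exists v, [/\ x = enc_idid v, wf_idid v & ind_idid v k].
Proof.
split=> [[n [r [s [Hr Hs -> H]]]]|[v [-> /andP [Hr Hs] H]]].
  exists (bits n, (db_bits r, db_bits s)).
  rewrite /enc_idid /wf_idid /ind_idid /= -!enc_natE !enc_db_bits !wf_db_bits Hr Hs !bitsK
    !db_bitsK.
  by split.
case/andP: (Hr) => Cn /andP [Cr _]; case/andP: (Hs) => _ /andP [Cs _].
exists (bval v.1), (db_val v.2.1), (db_val v.2.2).
by split; rewrite ?wf_db_val // -!encb_nat // -!enc_db_bits !canon_dbK.
Qed.

Lemma ind_red_k ident k nb mb r s : (ind_red ident k nb mb r s).2 <= k.+1.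
Proof. by rewrite /ind_red; do 3?case: ifP => _ //=. Qed.

Lemma ID_reduces_to_WSat3 : poly_reduction ID_problem WSat3.
Proof.
apply: (@poly_reduction_intro _ _ enc_id _ wf_id ind_id
  (fun k v => ind_red false k v.1 v.2.1 v.2.2.1 v.2.2.2) _ _ parser_id).
- by move=> n; rewrite /enc_id; pt.
- by move=> n; rewrite /wf_id; pt.
- by move=> n; apply: PT_ind_red.
- exact: ID_problemE.
- move=> v k /andP [Hr Hs]; split; last exact: ind_red_k.
  rewrite -(ind_red_correct (ident := false) k Hr Hs) //; split.
    by case=> X [sigma [<- H]]; apply: has_ind_IND H _.
  by case/(IND_has_ind (wf_dbb_gt0 Hs)) => X [sigma [H1 H2 _]]; exists X, sigma.
exact: WSat3_nil.
Qed.

Lemma ID_identity_reduces_to_WSat3 : poly_reduction ID_identity_problem WSat3.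
Proof.
apply: (@poly_reduction_intro _ _ enc_idid _ wf_idid ind_idid
  (fun k v => ind_red true k v.1 v.1 v.2.1 v.2.2) _ _ parser_idid).
- by move=> n; rewrite /enc_idid; pt.
- by move=> n; rewrite /wf_idid; pt.
- move=> n; apply: (PT_app1 (PT_ind_red n true)
    (a := fun q : nat * idid_input => (q.1, (q.2.1, (q.2.1, (q.2.2.1, q.2.2.2)))))).
  by pt.
- exact: ID_identity_problemE.
- move=> v k /andP [Hr Hs]; split; last exact: ind_red_k.
  rewrite -(ind_red_correct (ident := true) k Hr Hs) //; split.
    by case=> X [<- H]; apply: has_ind_IND H _.
  case/(IND_has_ind (wf_dbb_gt0 Hs)) => X [sigma [H1 [H2 H3] H4]]; exists X; split=> //.
  split; first by move=> a b.
  move=> row /H3 [row' Hr' Ha]; exists row' => // a Hx.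
  by rewrite Ha // H4.
exact: WSat3_nil.
Qed.

(** * From formulas to inclusion dependencies *)

(* A column (i, j, j') says that the i-th chosen variable is the j-th one and   *)
(* that the next chosen variable is the j'-th one; 0 and N.+1 are sentinels.    *)
Definition col := (nat * nat * nat)%type.

Definition gaps (K N : nat) : seq col :=
  [seq c <- [seq (a, b) | a <- [seq (i, j) | i <- iota 0 K.+1, j <- iota 0 N.+1],
    b <- iota 0 N.+2]
    | [&& c.1.2 < c.2, (c.1.1 == 0) ==> (c.1.2 == 0) & (c.1.1 == K) ==> (c.2 == N.+1)]].

Lemma mem_gaps K N c : (c \in gaps K N) =
  [&& c.1.1 <= K, c.1.2 <= N, c.2 <= N.+1, c.1.2 < c.2,
      (c.1.1 == 0) ==> (c.1.2 == 0) & (c.1.1 == K) ==> (c.2 == N.+1)].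
Proof.
rewrite mem_filter; case: c => [[i j] j'].
set b := [&& _ < _, _ & _]; rewrite -/b andbC.
have -> : ((i, j, j') \in [seq (a, b) | a <- [seq (i, j) | i <- iota 0 K.+1,
  j <- iota 0 N.+1], b <- iota 0 N.+2])
  = [&& i <= K, j <= N & j' <= N.+1]; last by rewrite -!andbA.
apply/idP/and3P => [/allpairsP [[a c] [Ha Hc [Ea Ec]]]|[H1 H2 H3]].
  move: Ha; rewrite [_.1]/= -Ea => /allpairsP [[i1 j1] [H1 H2 [E1 E2]]].
  by move: H1 H2 Hc; rewrite !mem_iota E1 E2 Ec !add0n !ltnS.
apply/allpairsP; exists (i, j, j'); split; rewrite ?mem_iota //.
by apply/allpairsP; exists (i, j); rewrite !mem_iota.
Qed.

Lemma uniq_gaps K N : uniq (gaps K N).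
Proof.
apply: filter_uniq; apply: allpairs_uniq; rewrite ?iota_uniq //; last by move=> [a b] [c d] _ _.
by apply: allpairs_uniq; rewrite ?iota_uniq // => -[a b] [c d] _ _.
Qed.

(** Two distinct steps conflict if they claim the same index, or claim consecutive indices without
    meeting. *)
Definition incompat (c c' : col) : bool :=
  (c != c') && ((c.1.1 == c'.1.1) || ((c'.1.1 == c.1.1.+1) && (c.2 != c'.1.2))).

(* A column in which no row of the first database meets the second one; it     *)
(* keeps the rows of the second database pairwise distinct.                     *)
Definition bar (K : nat) : col := (K.+1, 0, 0).

(** Weighted satisfiability of an antimonotone formula: each C is the conjunction of the negated
    variables in C. *)
Definition avoidable (cols : seq col) (Ds : seq (seq (seq col))) k :=
  exists Y : seq col, [/\ uniq Y, size Y = k, {subset Y <= cols} &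
    forall D, D \in Ds -> exists2 C, C \in D & all (fun c => c \notin C) Y].

(** The column is part of the value, so different columns share no value; [d] confines a left row to
    the right rows of its own family. *)
Definition cell (d e : nat) (c : col) : seq bool := code [:: d; e; c.1.1; c.1.2; c.2].

Lemma cell_inj d e c d' e' c' : cell d e c = cell d' e' c' -> [/\ d = d', e = e' & c = c'].
Proof.
move/code_inj; case: c => [[? ?] ?]; case: c' => [[? ?] ?] /=.
by case=> -> -> -> -> ->.
Qed.

Definition left_row (cols : seq col) d := [seq cell d 0 c | c <- cols].

Definition right_row (cols : seq col) (Ds : seq (seq (seq col))) d e :=
  [seq cell d (if c \in nth [::] (nth [::] Ds d) e then e.+1 else 0) c | c <- cols].

Definition left_db cols (Ds : seq (seq (seq col))) : dbb :=
  [seq left_row cols d | d <- iota 0 (size Ds)].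

Definition right_db cols Ds : dbb :=
  [seq right_row cols Ds d e | d <- iota 0 (size Ds), e <- iota 0 (size (nth [::] Ds d))].

Section AvoidDB.
Variables (cols : seq col) (Ds : seq (seq (seq col))) (b : col).
Hypothesis b_cols : b \in cols.
Hypothesis b_Ds : forall D C, D \in Ds -> C \in D -> b \in C.
Hypothesis cols_uniq : uniq cols.

Lemma left_row_inj : injective (left_row cols).
Proof.
move=> d d'; case: cols b_cols => // c s _ [] /cell_inj [] //.
Qed.

(** Column [b] belongs to all sets, so its cell always records [e.+1] together with [d]. *)
Lemma right_row_inj d e d' e' : d < size Ds -> e < size (nth [::] Ds d) ->
  d' < size Ds -> e' < size (nth [::] Ds d') ->
  right_row cols Ds d e = right_row cols Ds d' e' -> d = d' /\ e = e'.
Proof.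
move=> Hd He Hd' He' E.
have Hb : index b cols < size cols by rewrite index_mem.
have := congr1 (fun s => nth [::] s (index b cols)) E.
rewrite !(nth_map b) // nth_index //.
rewrite (b_Ds (mem_nth _ Hd) (mem_nth _ He)) (b_Ds (mem_nth _ Hd') (mem_nth _ He')).
by case/cell_inj => -> [->].
Qed.

Lemma wf_left_db : wf_dbb (bits (size cols)) (left_db cols Ds).
Proof.
apply/and5P; split.
- exact: canon_bits.
- by apply/allP => _ /mapP [d _ ->]; apply/allP => _ /mapP [c _ ->]; apply: code_canon.
- by case: cols b_cols.
- by rewrite map_inj_uniq ?iota_uniq //; apply: left_row_inj.
by apply/allP => _ /mapP [d _ ->]; rewrite size_map.
Qed.

Lemma mem_right_db row : row \in right_db cols Ds ->
  exists d e, [/\ d < size Ds, e < size (nth [::] Ds d) & row = right_row cols Ds d e].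
Proof.
case/allpairsPdep => d [e [Hd He ->]]; exists d, e.
by rewrite !mem_iota in Hd He.
Qed.

Lemma wf_right_db : wf_dbb (bits (size cols)) (right_db cols Ds).
Proof.
apply/and5P; split.
- exact: canon_bits.
- apply/allP => row /mem_right_db [d [e [_ _ ->]]].
  by apply/allP => _ /mapP [c _ ->]; apply: code_canon.
- by case: cols b_cols.
- apply: (@allpairs_uniq_dep _ (fun _ => nat) _ (right_row cols Ds)) => [|d _|].
  + exact: iota_uniq.
  + exact: iota_uniq.
  move=> _ _ /allpairsPdep [d [e [Hd He ->]]] /allpairsPdep [d' [e' [Hd' He' ->]]] /=.
  rewrite !mem_iota in Hd He Hd' He'.
  by case/right_row_inj => // -> ->.
by apply/allP => row /mem_right_db [d [e [_ _ ->]]]; rewrite size_map.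
Qed.

Lemma avoidable_IND N k : N = size cols -> avoidable cols Ds k ->
  exists X : {set 'I_N}, #|X| = k /\
    is_IND (db_val (left_db cols Ds)) (db_val (right_db cols Ds)) X id.
Proof.
move=> HN [Y [Yu <- Ys HY]].
pose X := [set a : 'I_N | nth b cols a \in Y].
exists X; split.
  rewrite cardE -(size_map (fun a : 'I_N => nth b cols a)); apply: perm_size;
    apply: uniq_perm => //.
    rewrite map_inj_in_uniq ?enum_uniq // => i j _ _ /eqP; rewrite nth_uniq -?HN //.
    by move=> /eqP /val_inj.
  move=> c; apply/mapP/idP => [[a]|Hc]; first by rewrite mem_enum inE => H ->.
  have Hi : index c cols < N by rewrite HN index_mem Ys.
  by exists (Ordinal Hi); rewrite ?mem_enum ?inE /= nth_index ?Ys.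
split=> // row /mapP [_ /mapP [d Hd ->] ->]; rewrite mem_iota /= in Hd.
have [C HC Hav] := HY _ (mem_nth [::] Hd).
have He : index C (nth [::] Ds d) < size (nth [::] Ds d) by rewrite index_mem.
exists [seq bval x | x <- right_row cols Ds d (index C (nth [::] Ds d))].
  apply: map_f; apply/allpairsPdep; exists d, (index C (nth [::] Ds d)).
  by rewrite !mem_iota.
move=> a; rewrite inE => Ha.
rewrite !(nth_map [::]) ?size_map -?HN // !(nth_map b) -?HN // nth_index //.
by rewrite (negbTE (allP Hav _ Ha)).
Qed.

(** Equal cells name the same column and family and carry the same mark; the left mark is always 0,
    so the matched set contains no chosen column. *)
Lemma IND_avoidable N k (X : {set 'I_N}) (sigma : 'I_N -> 'I_N) : N = size cols -> 0 < k ->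
  #|X| = k -> is_IND (db_val (left_db cols Ds)) (db_val (right_db cols Ds)) X sigma ->
  avoidable cols Ds k.
Proof.
move=> HN k0 HX [_ HI].
(* At least one chosen column is needed to conclude that the matching right row belongs to the same
   family. *)
have [a0 Ha0] : exists a, a \in X by apply/set0Pn; rewrite -card_gt0 HX.
exists [seq nth b cols (nat_of_ord a) | a <- enum X]; split.
- rewrite map_inj_in_uniq ?enum_uniq // => i j _ _ /eqP; rewrite nth_uniq -?HN //.
  by move=> /eqP /val_inj.
- by rewrite size_map -cardE.
- by move=> _ /mapP [a _ ->]; rewrite mem_nth // -HN.
move=> D HD; set d := index D Ds.
have Hd : d < size Ds by rewrite index_mem.
have Hrow : [seq bval x | x <- left_row cols d] \in db_val (left_db cols Ds).
  by apply: map_f; apply: map_f; rewrite mem_iota.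
have [_ /mapP [row' /mem_right_db [d' [e [Hd' He ->]]] ->] Hag] := HI _ Hrow.
have Hcell a : a \in X -> d = d' /\ nth b cols a \notin nth [::] (nth [::] Ds d') e.
  move=> Ha; have := Hag a Ha.
  rewrite !(nth_map [::]) ?size_map -?HN // !(nth_map b) -?HN //.
  move/bval_inj; rewrite !code_canon => /(_ isT isT) /cell_inj [-> H ->]; split=> //.
  by move: H; case: ifP.
have [Ed _] := Hcell _ Ha0.
exists (nth [::] (nth [::] Ds d') e).
  by rewrite -[D](nth_index [::] HD) -/d Ed mem_nth.
by apply/allP => _ /mapP [a Ha ->]; rewrite mem_enum in Ha; case: (Hcell a Ha).
Qed.

End AvoidDB.

(** Positions start at 1, since 0 is the initial sentinel. A positive literal is refuted by a step
    over its position, a negative one by a step touching it. *)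
Definition violates (vs : seq (seq bool)) (l : seq bool * bool) (c : col) : bool :=
  let p := (index l.1 vs).+1 in
  if l.2 then (c.1.2 < p) && (p < c.2) else (c.1.2 == p) || (c.2 == p).

Definition var_list (phi : formulab) := dedup (vars_of phi).

(** The first families state that either [c] is not chosen or nothing incompatible with [c] is; the
    others translate the disjunctions of [phi]. *)
Definition avoid_sets K (phi : formulab) : seq (seq (seq col)) :=
  let vs := var_list phi in let cs := gaps K (size vs) in
  [seq [:: [:: bar K; c]; bar K :: [seq c' <- cs | incompat c c']] | c <- cs] ++
  [seq [seq bar K :: [seq c <- cs | has (fun l => violates vs l c) C] | C <- D] | D <- phi].

Definition avoid_cols K (phi : formulab) := bar K :: gaps K (size (var_list phi)).

Lemma bar_gaps K N : bar K \notin gaps K N.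
Proof. by rewrite mem_gaps /= ltnn. Qed.

Lemma uniq_avoid_cols K phi : uniq (avoid_cols K phi).
Proof. by rewrite /= bar_gaps uniq_gaps. Qed.

Lemma bar_avoid_sets K phi D C : D \in avoid_sets K phi -> C \in D -> bar K \in C.
Proof.
rewrite mem_cat => /orP [] /mapP [x _ ->].
  by rewrite !inE => /orP [] /eqP ->; rewrite mem_head.
by case/mapP => C' _ ->; rewrite mem_head.
Qed.

Definition gap_system K (phi : formulab) (Y : seq col) :=
  let vs := var_list phi in
  [/\ uniq Y, size Y = K.+1, {subset Y <= gaps K (size vs)},
     {in Y &, forall c c', ~~ incompat c c'} &
     forall D, D \in phi -> exists2 C, C \in D &
       forall c l, c \in Y -> l \in C -> ~~ violates vs l c].

(** Every set contains [bar K], so a solution cannot use it; apart from this column both sides state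
    the same conditions. *)
Lemma avoidable_gap_system K phi :
  avoidable (avoid_cols K phi) (avoid_sets K phi) K.+1 <-> exists Y, gap_system K phi Y.
Proof.
set vs := var_list phi; set cs := gaps K (size vs).
split=> -[Y]; last first.
  move=> [Yu Yk Ys Yc Yp]; exists Y; split=> //; first by move=> c /Ys Hc;
    rewrite in_cons -/vs -/cs Hc orbT.
  have barY c : c \in Y -> c != bar K.
    by move=> /Ys; apply: contraTneq => ->; apply: bar_gaps.
  move=> D; rewrite mem_cat => /orP [] /mapP [].
    move=> c Hc ->; case HcY: (c \in Y).
      exists (bar K :: [seq c' <- cs | incompat c c']); first by rewrite !inE eqxx orbT.
      apply/allP => c' Hc'; rewrite in_cons negb_or barY //= mem_filter negb_and.
      by rewrite Yc.
    exists [:: bar K; c]; first by rewrite mem_head.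
    apply/allP => c' Hc'; rewrite !inE negb_or barY //=.
    by apply: contraFneq HcY => <-.
  move=> E HE ->; have [C HC Hv] := Yp E HE.
  exists (bar K :: [seq c <- cs | has (fun l => violates vs l c) C]).
    exact: (map_f (fun C => bar K :: [seq c <- cs | has (fun l => violates vs l c) C]) HC).
  apply/allP => c Hc; rewrite in_cons negb_or barY //= mem_filter negb_and.
  by apply/orP; left; apply/hasPn => l Hl; apply: Hv.
case=> Yu Yk Ys Yp.
have HbarY c : c \in Y -> c != bar K.
  have [c0 Hc0] : exists c0, c0 \in cs.
    (* Some gap always exists, hence some family, whose avoided set excludes [bar K]. For [K == 0]
       the initial gap is also the last and must reach the final sentinel. *)
    exists (0, 0, if K == 0 then (size vs).+1 else 1).
    by rewrite mem_gaps; case: (K) => [|m] /=; rewrite ?ltnSn ?eqxx ?implybT.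
  have := Yp [:: [:: bar K; c0]; bar K :: [seq c' <- cs | incompat c0 c']].
  rewrite mem_cat (map_f (fun c => [:: [:: bar K; c];
    bar K :: [seq c' <- cs | incompat c c']]) Hc0) /=.
  case=> // C HC /allP Hav Hc; have := Hav _ Hc.
  by move: HC; rewrite !inE => /orP [] /eqP ->; rewrite in_cons negb_or => /andP [].
have Ys' : {subset Y <= cs}.
  by move=> c Hc; have := Ys c Hc; rewrite in_cons (negbTE (HbarY c Hc)).
exists Y; split=> //.
  move=> c c' Hc Hc'.
  have := Yp [:: [:: bar K; c]; bar K :: [seq c' <- cs | incompat c c']].
  rewrite mem_cat (map_f (fun c => [:: [:: bar K; c];
    bar K :: [seq c' <- cs | incompat c c']]) (Ys' c Hc)) /=.
  case=> // C HC /allP Hav; move: HC (Hav _ Hc) (Hav _ Hc').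
  rewrite !inE => /orP [] /eqP ->; first by rewrite !inE eqxx orbT.
  by move=> _; rewrite in_cons negb_or mem_filter Ys' // andbT => /andP [].
move=> D HD.
have := Yp [seq bar K :: [seq c <- cs | has (fun l => violates vs l c) C] | C <- D].
rewrite mem_cat (map_f (fun D => [seq bar K :: [seq c <- cs | has (fun l =>
  violates vs l c) C] | C <- D]) HD) orbT.
case=> // _ /mapP [C HC ->] /allP Hav; exists C => // c l Hc Hl.
have := Hav _ Hc; rewrite in_cons negb_or mem_filter Ys' // andbT => /andP [_ /hasPn]; exact.
Qed.

(** The sorted positions of the true variables, enclosed by the sentinels, form a strictly
    increasing chain [q]; [Y] consists of its consecutive steps. *)
Lemma wsat_gap_system K phi : wsat phi K -> exists Y, gap_system K phi Y.
Proof.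
case=> T [Tu Tk Ts Tsat]; set vs := var_list phi; set N := size vs.
have [vs_uniq vs_mem] := dedupP (vars_of phi).
pose pos v := (index v vs).+1.
have pos_le v : v \in vs -> pos v <= N by rewrite /pos -index_mem.
have Tvs v : v \in T -> v \in vs by move=> /Ts; rewrite -vs_mem.
have pos_inj v w : v \in vs -> w \in vs -> pos v = pos w -> v = w.
  by move=> Hv Hw [] E; rewrite -(nth_index [::] Hv) E nth_index.
pose ps := sort leq (map pos T); pose q := 0 :: rcons ps N.+1.
have psP p : p \in ps -> 0 < p <= N.
  by rewrite mem_sort => /mapP [v Hv ->]; rewrite pos_le // Tvs.
have size_ps : size ps = K by rewrite size_sort size_map.
have size_q : size q = K.+2 by rewrite /= size_rcons size_ps.
have q_sorted : sorted ltn q.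
  rewrite (sorted_pairwise ltn_trans) /= pairwise_rcons; apply/and3P; split.
  - by rewrite all_rcons /=; apply/allP => p /psP /andP [].
  - by apply/allP => p /psP /andP [_ H]; rewrite /= ltnS.
  rewrite -(sorted_pairwise ltn_trans) ltn_sorted_uniq_leq sort_sorted; last exact: leq_total.
  rewrite sort_uniq andbT map_inj_in_uniq // => v w Hv Hw; apply: pos_inj; exact: Tvs.
have q_mono i j : i < j -> j < K.+2 -> nth 0 q i < nth 0 q j.
  move=> Hij Hj; apply: (sorted_ltn_nth ltn_trans 0 q_sorted) => //; rewrite inE size_q //.
  exact: ltn_trans Hj.
have q_le i j : i <= j -> j < K.+2 -> nth 0 q i <= nth 0 q j.
  by rewrite leq_eqVlt => /orP [/eqP -> //|Hij Hj]; apply/ltnW/q_mono.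
have q_last : nth 0 q K.+1 = N.+1 by rewrite /= nth_rcons size_ps ltnn eqxx.
have mem_q v : v \in vs -> (pos v \in q) = (v \in T).
  move=> Hv; rewrite /q in_cons mem_rcons in_cons /= [pos v == N.+1]eqn_leq.
  rewrite [N.+1 <= _]ltnNge pos_le // andbF /= mem_sort.
  apply/mapP/idP => [[w Hw E]|H]; last by exists v.
  by rewrite (pos_inj v w Hv (Tvs w Hw) E).
pose Y := [seq (i, nth 0 q i, nth 0 q i.+1) | i <- iota 0 K.+1].
exists Y; split.
- by rewrite map_inj_uniq ?iota_uniq // => i j [].
- by rewrite size_map size_iota.
- move=> c /mapP [i Hi ->]; rewrite mem_iota /= add0n in Hi.
  rewrite mem_gaps [_.1.1]/= [_.1.2]/= [_.2]/=; apply/and5P; split.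
  + by rewrite -ltnS.
  + by have := q_mono i K.+1 Hi (leqnn _); rewrite q_last.
  + by have := q_le i.+1 K.+1 Hi (leqnn _); rewrite q_last.
  + exact: (q_mono i i.+1).
  apply/andP; split; apply/implyP => /eqP ->; first by [].
  exact/eqP/q_last.
- move=> c c' /mapP [i Hi ->] /mapP [j Hj ->]; rewrite /incompat.
  rewrite [(i, _, _).1.1]/= [(j, _, _).1.1]/= [(i, _, _).2]/= [(j, _, _).1.2]/=.
  apply/negP => /andP [Hne /orP [/eqP E|/andP [/eqP E]]]; first by rewrite E eqxx in Hne.
  by rewrite E eqxx.
move=> D HD; have /hasP [C HC /allP Hsat] := allP Tsat D HD.
exists C => // c l /mapP [i Hi ->] Hl; rewrite mem_iota /= add0n in Hi.
have Hv : l.1 \in vs by rewrite vs_mem; apply: mem_vars_of HD HC Hl.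
have /eqP := Hsat l Hl; rewrite -mem_q // /violates -/(pos _).
rewrite [(i, _, _).1.2]/= [(i, _, _).2]/=.
case: (l.2) => Hq.
  (* The position of a true variable is an entry of [q], and no entry lies strictly between two
     consecutive ones. *)
  apply/negP => /andP [H1 H2].
  have Ht : index (pos l.1) q < K.+2 by rewrite -size_q index_mem.
  rewrite -(nth_index 0 Hq) in H1 H2.
  case: (leqP (index (pos l.1) q) i) => Hti.
    by move: (leq_trans H1 (q_le _ _ Hti (ltnW Hi))); rewrite ltnn.
  by move: (leq_trans H2 (q_le i.+1 _ Hti Ht)); rewrite ltnn.
apply/negP => H; have /negP := negbT Hq; apply.
have Hm j : j < K.+2 -> nth 0 q j \in q by move=> Hj; apply: mem_nth; rewrite size_q.
by case/orP: H => /eqP <-; [apply: (Hm i); apply: ltnW | apply: (Hm i.+1)].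
Qed.

(** The gaps fit together to a chain from 0 to N+1; its K inner points are the positions of the true
    variables. *)
Lemma gap_system_wsat K phi : (exists Y, gap_system K phi Y) -> wsat phi K.
Proof.
case=> Y; set vs := var_list phi; case; rewrite -/vs; set N := size vs => Yu Yk Ys Yc Yp.
have [vs_uniq vs_mem] := dedupP (vars_of phi).
pose c0 : col := (0, 0, 0).
pose g i := nth c0 Y (find (fun c : col => c.1.1 == i) Y).
(* Compatible gaps have distinct indices, and K+1 of them exhaust the K+1 possible indices. *)
have Ylevels : map (fun c : col => c.1.1) Y =i iota 0 K.+1.
  have Hu : uniq (map (fun c : col => c.1.1) Y).
    rewrite map_inj_in_uniq // => c c' Hc Hc' E; have := Yc _ _ Hc Hc'.
    by rewrite /incompat E eqxx orTb andbT negbK => /eqP.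
  have Hs : {subset map (fun c : col => c.1.1) Y <= iota 0 K.+1}.
    move=> _ /mapP [c /Ys Hc ->]; move: Hc; rewrite mem_gaps mem_iota /= => /andP [].
    by rewrite add0n ltnS.
  by have [|_ H] := uniq_min_size Hu Hs; rewrite // size_map size_iota Yk.
have gP i : i <= K -> g i \in Y /\ (g i).1.1 = i.
  move=> Hi; have Hhas : has (fun c : col => c.1.1 == i) Y.
    have : i \in iota 0 K.+1 by rewrite mem_iota.
    by rewrite -Ylevels => /mapP [c Hc ->]; apply/hasP; exists c.
  by split; [rewrite mem_nth // -has_find | apply/eqP/(nth_find c0 Hhas)].
pose q i := if i <= K then (g i).1.2 else N.+1.
have gq i : i <= K -> (g i).2 = q i.+1.
  move=> Hi; have [H1 H2] := gP i Hi; rewrite /q; case: ltnP => HiK.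
    have [H3 H4] := gP i.+1 HiK; have := Yc _ _ H1 H3.
    rewrite /incompat H2 H4 eqxx /= negb_and !negb_or negbK => /orP [/eqP E|].
      by move: H2; rewrite E H4 => /esym /n_Sn.
    by rewrite negbK => /andP [_ /eqP].
  have Ei : i = K by apply/eqP; rewrite eqn_leq Hi HiK.
  by have := Ys _ H1; rewrite mem_gaps H2 Ei eqxx => /and5P [_ _ _ _ /andP [_ /eqP]].
have q0 : q 0 = 0.
  have [H1 H2] := gP 0 (leq0n K); have := Ys _ H1.
  by rewrite mem_gaps H2 => /and5P [_ _ _ _ /andP [/eqP H _]]; rewrite /q.
have q_step i : i <= K -> q i < q i.+1.
  move=> Hi; have [H1 _] := gP i Hi; have := Ys _ H1.
  by rewrite mem_gaps => /and5P [_ _ _ H _]; rewrite -gq // {1}/q Hi.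
have q_mono i j : i < j -> j <= K.+1 -> q i < q j.
  elim: j => // j IH; rewrite ltnS leq_eqVlt => /orP [/eqP ->|Hij] Hj; first exact: q_step.
  exact: ltn_trans (IH Hij (ltnW Hj)) (q_step _ Hj).
have qlast : q K.+1 = N.+1 by rewrite /q ltnn.
pose pos v := (index v vs).+1.
have pos_inj v w : v \in vs -> w \in vs -> pos v = pos w -> v = w.
  by move=> Hv Hw [] E; rewrite -(nth_index [::] Hv) E nth_index.
pose T := [seq v <- vs | has (fun i => q i == pos v) (iota 1 K)].
have Tvs v : v \in T -> v \in vs by rewrite mem_filter => /andP [].
exists T; split.
- exact: filter_uniq.
- rewrite -(size_map pos) -[RHS](size_iota 1 K) -(size_map q (iota 1 K)).
  apply: perm_size; apply: uniq_perm.
  + by rewrite map_inj_in_uniq ?filter_uniq // => v w /Tvs Hv /Tvs Hw; apply: pos_inj.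
  + rewrite map_inj_in_uniq ?iota_uniq // => i j; rewrite !mem_iota => Hi Hj E.
    case: (ltngtP i j) => // H.
      by have := q_mono i j H; rewrite E ltnn; lia.
    by have := q_mono j i H; rewrite E ltnn; lia.
  move=> p; apply/mapP/mapP => [[v]|[i Hi ->]].
    by rewrite mem_filter => /andP [/hasP [i Hi /eqP E] _] ->; exists i.
  have Hi2 := Hi; rewrite mem_iota in Hi2.
  have H1 : 0 < q i by rewrite -q0; apply: q_mono; lia.
  have H2 : q i < N.+1 by rewrite -qlast; apply: q_mono; lia.
  have Hlt : (q i).-1 < size vs by rewrite -/N; lia.
  have Ep : pos (nth [::] vs (q i).-1) = q i by rewrite /pos index_uniq //; lia.
  exists (nth [::] vs (q i).-1) => //; rewrite mem_filter mem_nth // andbT.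
  by apply/hasP; exists i; rewrite ?Ep.
- by move=> v /Tvs; rewrite vs_mem.
apply/allP => D HD; have [C HC Hv] := Yp D HD.
apply/hasP; exists C => //; apply/allP => l Hl.
have Hvs : l.1 \in vs by rewrite vs_mem; apply: mem_vars_of HD HC Hl.
have Hpos : pos l.1 < N.+1 by rewrite ltnS /pos -index_mem in Hvs *.
have Hviol i : i <= K -> ~~ (if l.2 then (q i < pos l.1) && (pos l.1 < q i.+1)
    else (q i == pos l.1) || (q i.+1 == pos l.1)).
  move=> Hi; have [H1 _] := gP i Hi; have := Hv _ _ H1 Hl.
  by rewrite /violates gq // (_ : q i = (g i).1.2) // /q Hi.
rewrite mem_filter Hvs andbT.
case El: (l.2) Hviol => Hviol; last first.
  apply/eqP/hasPn => i; rewrite mem_iota => Hi; have := Hviol i; rewrite negb_or => H.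
  have HiK : i <= K by lia.
  by case/andP: (H HiK).
(* The chain passes the position of the literal in some step; as that step may not jump over it, the
   position equals [q i], and [i] is positive because [q 0 = 0]. *)
have [i Hi /andP [H1 H2]] : exists2 i, i < K.+1 & q i <= pos l.1 < q i.+1.
  have : pos l.1 < q K.+1 by rewrite qlast.
  elim: (K.+1) => [|m IH]; first by rewrite q0.
  case: (ltnP (pos l.1) (q m)) => [/IH [i Hi H] _|H1 H2]; first by exists i => //; lia.
  by exists m; rewrite ?H1.
have := Hviol i Hi; rewrite H2 andbT -leqNgt => H3.
have Eq : q i = pos l.1 by lia.
apply/eqP/hasP; exists i; last by rewrite Eq.
by rewrite mem_iota; case: i Eq {H1 H2 H3 } Hi => [|i] //; rewrite q0.
Qed.

Section PTgaps.
Variable n : nat.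
Context {E : Type} `{Enc E}.

Lemma PT_incompat (c c' : E -> col) : PT n c -> PT n c' -> PT n (fun e =>
  incompat (c e) (c' e)).
Proof. by move=> Hc Hc'; rewrite /incompat; pt. Qed.

Lemma PT_violates (vs : E -> seq (seq bool)) (l : E -> seq bool * bool) (c : E -> col) :
  PT n vs -> PT n l -> PT n c -> PT n (fun e => violates (vs e) (l e) (c e)).
Proof. by move=> Hv Hl Hc; rewrite /violates; pt. Qed.

Lemma PT_gaps (K N : E -> nat) : PT n K -> PT n N -> PT n (fun e => gaps (K e) (N e)).
Proof. by move=> HK HN; rewrite /gaps; pt. Qed.

Lemma PT_var_list (phi : E -> formulab) : PT n phi -> PT n (fun e => var_list (phi e)).
Proof. by move=> H1; rewrite /var_list /vars_of; pt. Qed.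
End PTgaps.

Ltac pt_ext ::= first
 [ refine (PT_encb _) | refine (PT_enc_fb _) | refine (PT_enc_dbb _)
 | refine (PT_wf_dbb _ _) | refine (PT_incompat _ _) | refine (PT_violates _ _ _)
 | refine (PT_gaps _ _) | refine (PT_var_list _)
 | refine (PT_enc_list _ _) | refine (PT_bits _) | refine (PT_code _) | refine (PT_canon _) ].

Section PTavoid.
Variable n : nat.
Context {E : Type} `{Enc E}.

Lemma PT_avoid_sets (K : E -> nat) (phi : E -> formulab) : PT n K -> PT n phi ->
  PT n (fun e => avoid_sets (K e) (phi e)).
Proof. by move=> HK Hphi; rewrite /avoid_sets /bar; cbv zeta; pt. Qed.

Lemma PT_avoid_cols (K : E -> nat) (phi : E -> formulab) : PT n K -> PT n phi ->
  PT n (fun e => avoid_cols (K e) (phi e)).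
Proof. by move=> HK Hphi; rewrite /avoid_cols /bar; pt. Qed.

Lemma PT_left_db (cs : E -> seq col) (Ds : E -> seq (seq (seq col))) : PT n cs -> PT n Ds ->
  PT n (fun e => left_db (cs e) (Ds e)).
Proof. by move=> Hc HD; rewrite /left_db /left_row /cell; pt. Qed.

Lemma PT_right_db (cs : E -> seq col) (Ds : E -> seq (seq (seq col))) : PT n cs -> PT n Ds ->
  PT n (fun e => right_db (cs e) (Ds e)).
Proof. by move=> Hc HD; rewrite /right_db /right_row /cell; pt. Qed.
End PTavoid.

Ltac pt_ext ::= first
 [ refine (PT_encb _) | refine (PT_enc_fb _) | refine (PT_enc_dbb _)
 | refine (PT_left_db _ _) | refine (PT_right_db _ _)
 | refine (PT_avoid_sets _ _) | refine (PT_avoid_cols _ _)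
 | refine (PT_enc_list _ _) | refine (PT_bits _) | refine (PT_code _) | refine (PT_canon _) ].

Lemma wf_avoid_dbs K phi (cs := avoid_cols K phi) (Ds := avoid_sets K phi) :
  wf_dbb (bits (size cs)) (left_db cs Ds) && wf_dbb (bits (size cs)) (right_db cs Ds).
Proof.
apply/andP; split; first by apply: (@wf_left_db _ _ (bar K)); rewrite mem_head.
apply: (@wf_right_db _ _ (bar K)); first by rewrite mem_head.
  by move=> D C; apply: bar_avoid_sets.
Qed.

Lemma wsat_avoid K phi (cs := avoid_cols K phi) (Ds := avoid_sets K phi) N : N = size cs ->
  (wsat phi K <-> exists X : {set 'I_N}, #|X| = K.+1 /\
     is_IND (db_val (left_db cs Ds)) (db_val (right_db cs Ds)) X id) /\
  (wsat phi K <-> exists (X : {set 'I_N}) (sigma : 'I_N -> 'I_N), #|X| = K.+1 /\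
     is_IND (db_val (left_db cs Ds)) (db_val (right_db cs Ds)) X sigma).
Proof.
move=> HN.
have Ha : wsat phi K <-> avoidable cs Ds K.+1.
  rewrite avoidable_gap_system; split; [exact: wsat_gap_system | exact: gap_system_wsat].
have Hu : uniq cs := uniq_avoid_cols K phi.
have H1 := @avoidable_IND cs Ds (bar K) Hu N K.+1 HN.
have H2 X sigma := @IND_avoidable cs Ds (bar K) Hu N K.+1 X sigma HN isT.
split; split=> [/Ha /H1 [X HX]|].
- by exists X.
- by case=> X [HX HI]; apply/Ha/(H2 X id).
- by exists X, id.
by case=> X [sigma [HX HI]]; apply/Ha/(H2 X sigma).
Qed.

Lemma not_ID_nil k : ~ ID_problem [::] k.
Proof. by case/ID_problemE=> -[[|b v] w] []. Qed.

Lemma not_ID_identity_nil k : ~ ID_identity_problem [::] k.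
Proof. by case/ID_identity_problemE=> -[[|b v] w] []. Qed.

Lemma WSat3_reduces_to_ID : poly_reduction WSat3 ID_problem.
Proof.
pose inst k phi : id_input :=
  let cs := avoid_cols k phi in let Ds := avoid_sets k phi in let b := bits (size cs) in
  (b, (b, (left_db cs Ds, right_db cs Ds))).
apply: (@poly_reduction_intro _ _ enc_fb _ canon_fb (fun phi k => wsat phi k)
  (fun k phi => (enc_id (inst k phi), k.+1)) _ _ parser_fb).
- by move=> n; pt.
- by move=> n; rewrite /canon_fb; pt.
- by move=> n; rewrite /enc_id /inst; cbv zeta; pt.
- by move=> x k; rewrite WSat3E.
- move=> phi k Hphi; split=> //=; rewrite ID_problemE.
  have [_ H] := @wsat_avoid k phi _ (bitsK _).
  split=> [/H [X [sigma HI]]|[v [E _]]].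
    exists (inst k phi); split=> //; first exact: wf_avoid_dbs.
    by exists X, sigma.
  have [<- _] := parser_inj (parser_id 0) (r := [::]) (s := [::]) (congr1 (cat^~ [::]) E).
  by case=> X [sigma HI]; apply/H; exists X, sigma.
exact: not_ID_nil.
Qed.

Lemma WSat3_reduces_to_ID_identity : poly_reduction WSat3 ID_identity_problem.
Proof.
pose inst k phi : idid_input :=
  let cs := avoid_cols k phi in let Ds := avoid_sets k phi in
  (bits (size cs), (left_db cs Ds, right_db cs Ds)).
apply: (@poly_reduction_intro _ _ enc_fb _ canon_fb (fun phi k => wsat phi k)
  (fun k phi => (enc_idid (inst k phi), k.+1)) _ _ parser_fb).
- by move=> n; pt.
- by move=> n; rewrite /canon_fb; pt.
- by move=> n; rewrite /enc_idid /inst; cbv zeta; pt.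
- by move=> x k; rewrite WSat3E.
- move=> phi k Hphi; split=> //=; rewrite ID_identity_problemE.
  have [H _] := @wsat_avoid k phi _ (bitsK _).
  split=> [/H [X HI]|[v [E _]]].
    exists (inst k phi); split=> //; first exact: wf_avoid_dbs.
    by exists X.
  have [<- _] := parser_inj (parser_idid 0) (r := [::]) (s := [::]) (congr1 (cat^~ [::]) E).
  by case=> X HI; apply/H; exists X.
exact: not_ID_identity_nil.
Qed.

(** * Conversion to single-tape machines *)

Section ToTM.
Variables (n : nat) (M : mach n unit).
Local Notation Q := (mst M).
Local Notation FB := (FB n).

Definition state_rank (q : Q) : 'I_(#|Q|.-1).+1 := inord (index q (enum Q)).
(** The transposition moves the start state to number 0, as machines of type [TM] require. *)
Definition state_code (q : Q) := tperm ord0 (state_rank (m0 M)) (state_rank q).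
Definition state_decode (i : 'I_(#|Q|.-1).+1) : Q :=
  nth (m0 M) (enum Q) (tperm ord0 (state_rank (m0 M)) i).

Lemma state_codeK : cancel state_code state_decode.
Proof.
move=> q; rewrite /state_decode /state_code tpermK /state_rank inordK ?nth_index ?mem_enum //.
have : index q (enum Q) < #|Q| by rewrite cardE index_mem mem_enum.
by case: #|Q|.
Qed.

Lemma state_code_start : state_code (m0 M) = ord0.
Proof. by rewrite /state_code tpermR. Qed.

Definition TM_of : TM :=
  @mkTM #|Q|.-1 n.+2 (fun q a =>
    match md (state_decode q) a with
    | inl (q', a', mv) => Some (state_code q', a', mv)
    | inr _ => None
    end).

Definition config_of (q : Q) (t : tape n) : config TM_of :=
  @Config TM_of (state_code q) t.1 (head FB t.2) (behead t.2).

Lemma blank_symE : blank_sym TM_of = FB.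
Proof. by apply: val_inj; rewrite /= inordK. Qed.

Lemma bit_symE b : bit_sym TM_of b = bitsym n b.
Proof. by apply: val_inj; rewrite /= inordK; case: b. Qed.

Lemma step_config_of q (t : tape n) q' a mv : md q (head FB t.2) = inl (q', a, mv) ->
  step (config_of q t) = Some (config_of q' (act a mv t)).
Proof.
move=> E; rewrite /step /= state_codeK E; congr Some; rewrite /config_of.
by case: mv {E}; case: t => [[|b l] [|c [|d s]]] //=; rewrite ?blank_symE.
Qed.

Lemma ev_run q (t t' : tape n) k l : ev (M := M) q t k l t' ->
  exists2 q', run k (config_of q t) = config_of q' t' & step (config_of q' t') = None.
Proof.
elim=> {q t k l t'} [q t l E|q t q' a mv k l t' E _ [q2 H1 H2]].
  by exists q => //; rewrite /step /= state_codeK E.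
by exists q2 => //; rewrite [run _ _]/= (step_config_of E).
Qed.

(** A halted machine idles, so an exact running time may be replaced by any upper bound. *)
Lemma run_halted_add (N : TM) (c : config N) k j :
  step (run k c) = None -> run (k + j) c = run k c.
Proof.
elim: k c => [|k IH] c /=; first by case: j => //= j ->.
by case E: (step c) => [c'|] // /IH.
Qed.

Lemma ev_computes x y k T (t' : tape n) :
  ev (m0 M) ([::], map (bitsym n) x) k tt t' -> k <= T ->
  read_bits (M := TM_of) (head FB t'.2 :: behead t'.2) = y ->
  computes_within TM_of x T y.
Proof.
move=> H Hk Hy; have [q' H1 H2] := ev_run H.
have E0 : init_config TM_of x = config_of (m0 M) ([::], map (bitsym n) x).
  rewrite /init_config /config_of state_code_start; case: x {H H1} => [|b x] /=.
    by rewrite blank_symE.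
  by rewrite bit_symE; congr Config; apply: eq_map => c; rewrite bit_symE.
rewrite /computes_within E0.
have -> : run T (config_of (m0 M) ([::], map (bitsym n) x)) = config_of q' t'.
  by rewrite -(subnKC Hk) run_halted_add // H1.
by split=> //; rewrite /halted H2.
Qed.
End ToTM.

(** * Bringing the input into the registers and the output under the head *)

Section Wrap.
Variable n : nat.
Local Notation mach := (mach n).
Local Notation tape := (tape n).
Local Notation FB := (FB n).
Local Notation SEP := (SEP n).
Local Notation bitsym := (bitsym n).

Definition single (f : sym n -> sym n * move) : mach unit :=
  auto (fun (_ : unit) a => (f a, inr tt)) tt.

Lemma single_ev f (t : tape) :
  tev (single f) t 1 tt (act (f (head FB t.2)).1 (f (head FB t.2)).2 t).
Proof.
apply: ev_tev; case E: (f (head FB t.2)) => [a mv] /=.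
by apply: (ev_auto_stop (L := unit) (f := fun (_ : unit) a => (f a, inr tt))); rewrite E.
Qed.

Definition keep_left := single (fun a => (a, MoveL)).
Definition keep_right := single (fun a => (a, MoveR)).
Definition write_sep := single (fun _ => (SEP, MoveR)).

(** One separator before the input and three behind it make the input register 3, reversed, and
    leave the other registers empty. *)
Definition prologue : mach unit :=
  bind keep_left (fun _ => bind write_sep (fun _ => bind (go_right n) (fun _ =>
  bind write_sep (fun _ => bind write_sep (fun _ => write_sep))))).

Lemma bitsym_content b : content (bitsym b).
Proof. by case: b. Qed.

Lemma bitsyms_content x : all (@content n) (map bitsym x).
Proof. by rewrite all_map; apply/allP => b _; apply: bitsym_content. Qed.

Lemma prologue_ev x : exists2 t, tev prologue ([::], map bitsym x) (size x + 20) tt t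
  & rep t [:: [::]; [::]; [::]; rev (map bitsym x)].
Proof.
exists ([:: SEP, SEP, SEP & rev (map bitsym x) ++ [:: SEP]], [::]); last first.
  by split; rewrite /= ?all_rev ?bitsyms_content // /flat /= cats0.
apply: (@tev_le n _ _ _ (1 + (1 + ((size (map bitsym x)).+1 + (1 + (1 + 1).+1).+1).+1).+1).+1).
  by rewrite size_map; lia.
apply: tev_bind; first exact: single_ev.
apply: tev_bind; first exact: single_ev.
apply: tev_bind.
  apply: tev_teql; last first.
    have := @go_right_ev n [:: SEP] (map bitsym x) [::]; rewrite cats0; apply=> //.
    by rewrite all_map; apply/allP => -[].
  by split.
apply: tev_bind; first exact: single_ev.
apply: tev_bind; first exact: single_ev.
exact: single_ev.
Qed.

(** Register 0 is the rightmost block, so from its first cell on the tape holds the reversed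
    register followed by blanks. *)
Definition epilogue : mach unit := bind (skip_left n) (fun _ => keep_right).

Lemma epilogue_ev t A V B C : rep t [:: A; V; B; C] ->
  exists l s, tev epilogue t (size A + 5) tt (l, rev A ++ s) /\ all (pred1 FB) s.
Proof.
case: t => [l s] [/= -> Hs /andP [HA _]].
exists (SEP :: flat [:: V; B; C]), (head FB s :: behead s); split; last by case: (s) Hs.
apply: (@tev_le _ _ _ _ ((size A).+2 + 1).+1); first lia.
rewrite flat_cons; apply: tev_bind; first exact: skip_left_ev.
exact: single_ev.
Qed.

Definition framed (M : mach unit) := bind prologue (fun _ => bind M (fun _ => epilogue)).

Definition time_bound s k := (k + 3) * (10 * (s + k) + 100).

Lemma framed_computes M x y k T V B C :
  runs M [:: [::]; [::]; [::]; rev (map bitsym x)] k tt [:: rev (map bitsym y); V; B; C] ->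
  time_bound (size x) k <= T -> computes_within (TM_of (framed M)) x T y.
Proof.
move=> HM HT.
have [t1 H1 R1] := prologue_ev x.
have S1 : size (flat [:: [::]; [::]; [::]; rev (map bitsym x)]) = size x + 4.
  by rewrite /flat /= !size_cat /= size_rev size_map; lia.
have [|t2 [k2 [H2 R2 T2 S2]]] := HM (size x + 4 + k) t1 R1; first by rewrite S1.
have [l [s [H3 Hs]]] := epilogue_ev R2.
have := tev_bind (M2 := fun _ => bind M (fun _ => epilogue)) H1
  (tev_bind (M2 := fun _ => epilogue) (ev_tev H2) H3).
case=> t' [k' [Hk' Hev [_ Et]]].
apply: (ev_computes Hev).
  apply: leq_trans Hk' _; apply: leq_trans HT.
  have Sy : size y <= size x + 4 + k.
    by move: S2; rewrite S1 /flat /= !size_cat size_rev size_map /=; lia.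
  rewrite size_rev size_map /time_bound; nia.
rewrite Et revK.
elim: (y) => [|[] y' IH] /=; last first.
- by congr cons; move: IH; case: (map _ y' ++ s).
- by congr cons; move: IH; case: (map _ y' ++ s).
case: s Hs {H3 Et} => //= a s /andP [/eqP -> _] //.
Qed.
End Wrap.

(** * Simulating an arbitrary machine *)

Section Convert.
Variable n : nat.
Local Notation mach := (mach n).
Local Notation b0 := (b0 n).
Local Notation b1 := (b1 n).
Local Notation ret := (@ret n _).
Local Notation push := (@push n).
Local Notation pop := (@pop n).
Local Notation pol := (@pol n).
Local Notation bitsym := (@bitsym n).

(** Register 3 delivers the last bit first, the order in which a list is built. The nodes are pushed
    from right to left: a true bit gives [b1 b1 b0 b0], a false one [b1 b0], where the first [b1] is
    the list cell. *)
Definition read_bit_loop : mach unit :=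
  iterm (fun _ : unit => bind (pop 3) (fun o =>
    if o is Some a then
      if a == b1 then
        bind (push 1 b0) (fun _ => bind (push 1 b0) (fun _ =>
        bind (push 1 b1) (fun _ => bind (push 1 b1) (fun _ => ret (inl tt)))))
      else bind (push 1 b0) (fun _ => bind (push 1 b1) (fun _ => ret (inl tt)))
    else ret (inr tt))) tt.

Definition string_to_tree : mach unit := bind (push 1 b0) (fun _ => read_bit_loop).

Lemma read_bit_loop_runs w y A V B :
  runs read_bit_loop [:: A; pol (tenc y) ++ V; B; map bitsym w] (20 * (size w).+1) tt
    [:: A; pol (tenc (catrev w y)) ++ V; B; [::]].
Proof.
elim: w y => [|b w IH] y.
  rle; first apply: runs_iter_stop.
    rb (@runs_pop n [:: A; pol (tenc y) ++ V; B; [::]] 3 isT); exact: runs_ret.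
  by [].
have {}IH := IH (b :: y).
case: b IH => IH; rle.
- apply: runs_iter_step IH.
  rb (@runs_pop n [:: A; pol (tenc y) ++ V; B; b1 :: map bitsym w] 3 isT).
  rb (@runs_push n [:: A; pol (tenc y) ++ V; B; map bitsym w] 1 b0 isT isT).
  rb (@runs_push n [:: A; b0 :: pol (tenc y) ++ V; B; map bitsym w] 1 b0 isT isT).
  rb (@runs_push n [:: A; b0 :: b0 :: pol (tenc y) ++ V; B; map bitsym w] 1 b1 isT isT).
  rb (@runs_push n [:: A; b1 :: b0 :: b0 :: pol (tenc y) ++ V; B; map bitsym w] 1 b1 isT isT).
  exact: runs_ret.
- by rewrite /=; lia.
- apply: runs_iter_step IH.
  rb (@runs_pop n [:: A; pol (tenc y) ++ V; B; b0 :: map bitsym w] 3 isT).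
  rb (@runs_push n [:: A; pol (tenc y) ++ V; B; map bitsym w] 1 b0 isT isT).
  rb (@runs_push n [:: A; b0 :: pol (tenc y) ++ V; B; map bitsym w] 1 b1 isT isT).
  exact: runs_ret.
by rewrite /=; lia.
Qed.

Lemma string_to_tree_runs x V :
  runs string_to_tree [:: [::]; V; [::]; rev (map bitsym x)] (20 * size x + 30) tt
    (state (pol (tenc x) ++ V)).
Proof.
rle.
  rb (@runs_push n [:: [::]; V; [::]; rev (map bitsym x)] 1 b0 isT isT).
  have := @read_bit_loop_runs (rev x) [::] [::] V [::].
  rewrite -/(rev (rev x)) revK map_rev; exact.
rewrite size_rev; lia.
Qed.

Definition tree_to_string : mach unit :=
  iterm (fun _ : unit => bind (pop 1) (fun o =>
    if o == Some b1 then
      bind (pop 1) (fun o' =>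
        if o' == Some b1 then bind (pop 1) (fun _ => bind (pop 1) (fun _ =>
           bind (push 0 b1) (fun _ => ret (inl tt))))
        else bind (push 0 b0) (fun _ => ret (inl tt)))
    else ret (inr tt))) tt.

Lemma tree_to_string_runs x A V B C :
  runs tree_to_string [:: A; pol (tenc x) ++ V; B; C] (20 * (size x).+1) tt
    [:: rev (map bitsym x) ++ A; V; B; C].
Proof.
elim: x A => [|b x IH] A.
  rle; first apply: runs_iter_stop.
    rb (@runs_pop n [:: A; b0 :: V; B; C] 1 isT); exact: runs_ret.
  by [].
have {}IH := IH (bitsym b :: A).
rewrite [map _ _]/= rev_cons cat_rcons.
case: b IH => IH; rle.
- apply: runs_iter_step IH.
  rb (@runs_pop n [:: A; b1 :: b1 :: b0 :: b0 :: pol (tenc x) ++ V; B; C] 1 isT).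
  rb (@runs_pop n [:: A; b1 :: b0 :: b0 :: pol (tenc x) ++ V; B; C] 1 isT).
  rb (@runs_pop n [:: A; b0 :: b0 :: pol (tenc x) ++ V; B; C] 1 isT).
  rb (@runs_pop n [:: A; b0 :: pol (tenc x) ++ V; B; C] 1 isT).
  rb (@runs_push n [:: A; pol (tenc x) ++ V; B; C] 0 b1 isT isT).
  exact: runs_ret.
- by rewrite /=; lia.
- apply: runs_iter_step IH.
  rb (@runs_pop n [:: A; b1 :: b0 :: pol (tenc x) ++ V; B; C] 1 isT).
  rb (@runs_pop n [:: A; b0 :: pol (tenc x) ++ V; B; C] 1 isT).
  rb (@runs_push n [:: A; pol (tenc x) ++ V; B; C] 0 b0 isT isT).
  exact: runs_ret.
by rewrite /=; lia.
Qed.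
End Convert.

Section Simulate.
Variable M : TM.
Local Notation n := (tm_nsyms M).
Local Notation mach := (mach n).
Local Notation ret := (@ret n _).
Local Notation push := (@push n).
Local Notation pop := (@pop n).
Local Notation pol := (@pol n).
Local Notation bitsym := (@bitsym n).

(* The blank of M is shifted to 4, and its work symbols past it, so that 0 and *)
(* 3 remain free for the blank and the separator of the simulating tape.        *)
Definition embed (a : tm_sym M) : sym n :=
  inord (if a == 0 :> nat then 4 else if a < 3 then a : nat else a.+2).
Definition unembed (a : sym n) : tm_sym M :=
  inord (if a == 4 :> nat then 0 else if a < 3 then a : nat else a.-2).

Lemma val_embed a : embed a = (if a == 0 :> nat then 4 else if a < 3 then a : nat else a.+2)
  :> nat.
Proof.
rewrite inordK //; have := ltn_ord a.
by case: (nat_of_ord a) => [|[|[|m]]] //=; rewrite !ltnS.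
Qed.

Lemma embedK : cancel embed unembed.
Proof.
move=> a; apply: val_inj; rewrite /unembed val_embed /= inordK; have := ltn_ord a.
  by case: (nat_of_ord a) => [|[|[|[|m]]]].
by case: (nat_of_ord a) => [|[|[|[|m]]]].
Qed.

Lemma embed_content a : content (embed a).
Proof.
by apply/andP; split; apply/eqP => /(congr1 (@nat_of_ord _)); rewrite val_embed /=;
  case: (nat_of_ord a) => [|[|[|m]]].
Qed.

Lemma embed_bit b : embed (bit_sym M b) = bitsym b.
Proof. by apply: ord_inj; rewrite val_embed inordK; case: b. Qed.

Definition unhead (o : option (sym n)) : tm_sym M := if o is Some x then unembed x else
  blank_sym M.

(** Register 0 holds the cells left of the simulated head and register 2 those from the head on.
    Register 1, the stack of trees, is not touched, so the simulation can serve as a subprogram. *)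
Definition sim_step (q : tm_state M) : mach (tm_state M + unit) :=
  bind (pop 2) (fun o =>
    match tm_delta q (unhead o) with
    | None => bind (push 2 (embed (unhead o))) (fun _ => ret (inr tt))
    | Some (q', b, Stay) => bind (push 2 (embed b)) (fun _ => ret (inl q'))
    | Some (q', b, MoveR) => bind (push 0 (embed b)) (fun _ => ret (inl q'))
    | Some (q', b, MoveL) => bind (push 2 (embed b)) (fun _ => bind (pop 0) (fun o' =>
        bind (push 2 (embed (unhead o'))) (fun _ => ret (inl q'))))
    end).

Definition sim_loop : mach unit := iterm sim_step ord0.

(** An empty register 2 stands for an implicit blank under the head. *)
Definition represents (c : config M) (s : seq (tm_sym M)) :=
  c_head c = head (blank_sym M) s /\ c_right c = behead s.

Lemma unhead_embed (s : seq (tm_sym M)) : unhead (ohead (map embed s)) = head (blank_sym M) s.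
Proof. by case: s => //= a s; rewrite embedK. Qed.

Lemma sim_step_runs c c' s V C : represents c s -> step c = Some c' ->
  exists2 s', represents c' s' &
    runs (sim_step (c_state c)) [:: map embed (c_left c); V; map embed s; C] 10
      (inl (c_state c')) [:: map embed (c_left c'); V; map embed s'; C].
Proof.
case: c => q l h r [/= Hh Hr]; rewrite /step /=.
have Hpop := @runs_pop n [:: map embed l; V; map embed s; C] 2 isT.
rewrite /= behead_map -Hr in Hpop.
case E: (tm_delta q h) => [[[q' b] mv]|] // [<-].
have Ek : unhead (ohead (map embed s)) = h by rewrite unhead_embed.
case: mv E => E.
- exists (head (blank_sym M) l :: b :: r); first by case: (l).
  rle.
    rb Hpop; rewrite Ek E.
    rb (@runs_push n [:: map embed l; V; map embed r; C] 2 (embed b) isT (embed_content b)).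
    rb (@runs_pop n [:: map embed l; V; embed b :: map embed r; C] 0 isT).
    rb (@runs_push n [:: behead (map embed l); V; embed b :: map embed r; C] 2
      (embed (unhead (ohead (map embed l)))) isT (embed_content _)).
    have -> : c_state (match l with
         | [::] => @Config M q' [::] (blank_sym M) (b :: r)
         | b' :: l' => @Config M q' l' b' (b :: r) end) = q' by case: (l).
    have := @runs_ret n _ (inl q' : tm_state M + unit) [:: behead (map embed l); V;
      embed (unhead (ohead (map embed l))) :: embed b :: map embed r; C].
    by rewrite unhead_embed behead_map; case: (l); exact.
  by [].
- exists r; first by case: (r).
  have El : map embed (c_left (match r with
         | [::] => @Config M q' (b :: l) (blank_sym M) [::]
         | b' :: r' => @Config M q' (b :: l) b' r' end)) = embed b :: map embed l by case: (r).
  have Eq : c_state (match r with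
         | [::] => @Config M q' (b :: l) (blank_sym M) [::]
         | b' :: r' => @Config M q' (b :: l) b' r' end) = q' by case: (r).
  rewrite El Eq; rle.
    rb Hpop; rewrite Ek E.
    rb (@runs_push n [:: map embed l; V; map embed r; C] 0 (embed b) isT (embed_content b)).
    exact: runs_ret.
  by [].
exists (b :: r); first by [].
rle.
  rb Hpop; rewrite Ek E.
  rb (@runs_push n [:: map embed l; V; map embed r; C] 2 (embed b) isT (embed_content b)).
  exact: runs_ret.
by [].
Qed.

Lemma sim_halt_runs c s V C : represents c s -> step c = None ->
  runs (sim_step (c_state c)) [:: map embed (c_left c); V; map embed s; C] 10
      (inr tt) [:: map embed (c_left c); V; map embed (c_head c :: c_right c); C].
Proof.
case: c => q l h r [/= Hh Hr]; rewrite /step /=.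
have Hpop := @runs_pop n [:: map embed l; V; map embed s; C] 2 isT.
rewrite /= behead_map -Hr in Hpop.
have Ek : unhead (ohead (map embed s)) = h by rewrite unhead_embed.
case E: (tm_delta q h) => [[[q' b] mv]|] // _.
rle.
  rb Hpop; rewrite Ek E.
  rb (@runs_push n [:: map embed l; V; map embed r; C] 2 (embed h) isT (embed_content h)).
  exact: runs_ret.
by [].
Qed.

Lemma sim_loop_runs T c s V C : represents c s -> halted (run T c) ->
  runs (iterm sim_step (c_state c)) [:: map embed (c_left c); V; map embed s; C]
    (11 * T + 11) tt
    [:: map embed (c_left (run T c)); V; map embed (c_head (run T c) :: c_right (run T c)); C].
Proof.
elim: T c s => [|T IH] c s Hs /=.
  rewrite /halted; case E: (step c) => // _.
  rle; first by apply: runs_iter_stop; apply: sim_halt_runs E.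
  by [].
case E: (step c) => [c'|] H.
  have [s' Hs' H1] := @sim_step_runs _ _ _ V C Hs E.
  rle; first exact: runs_iter_step H1 (IH _ _ Hs' H).
  lia.
rle; first by apply: runs_iter_stop; apply: sim_halt_runs E.
lia.
Qed.

Lemma step_size (c c' : config M) : step c = Some c' ->
  size (c_left c') + size (c_right c') <= (size (c_left c) + size (c_right c)).+1.
Proof.
rewrite /step; case: (tm_delta _ _) => [[[q b] mv]|] // [<-].
by case: mv; [case: (c_left c) => [|x l] | case: (c_right c) => [|x l] |] => /=; lia.
Qed.

Lemma run_size T (c : config M) :
  size (c_left (run T c)) + size (c_right (run T c)) <= size (c_left c) + size (c_right c) + T.
Proof.
elim: T c => [|T IH] c /=; first by rewrite addn0.
case E: (step c) => [c'|]; last by rewrite leq_addr.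
by have := IH c'; have := step_size E; lia.
Qed.

Definition output_loop : mach unit :=
  iterm (fun _ : unit => bind (pop 2) (fun o =>
    if o is Some a then
      if (a == b0 n) || (a == b1 n) then bind (push 3 a) (fun _ =>
        ret (inl tt)) else ret (inr tt)
    else ret (inr tt))) tt.

Lemma output_loop_runs s A V C :
  exists2 r, runs output_loop [:: A; V; map embed s; C] (10 * (size s).+1) tt
    [:: A; V; map embed r; rev (map bitsym (read_bits s)) ++ C] & size r <= size s.
Proof.
elim: s C => [|a s IH] C.
  exists [::] => //; rle; first apply: runs_iter_stop.
    rb (@runs_pop n [:: A; V; [::]; C] 2 isT); exact: runs_ret.
  by [].
have step_bit b : a = (if b then 2 else 1) :> nat -> exists2 r, runs output_loop [:: A; V;
  map embed (a :: s); C] (10 * (size s).+2) tt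
    [:: A; V; map embed r; rev (map bitsym (b :: read_bits s)) ++ C] & size r <= (size s).+1.
  move=> Ea; have Eb : embed a = bitsym b.
    by apply: ord_inj; rewrite val_embed Ea; case: b {Ea}.
  have [r H Hr] := IH (bitsym b :: C); exists r; last exact: leqW.
  rewrite [map _ (b :: _)]/= rev_cons cat_rcons; rle; first apply: runs_iter_step H.
    rb (@runs_pop n [:: A; V; map embed (a :: s); C] 2 isT); rewrite /= Eb.
    rewrite (_ : _ || _ = true); last by case: b {Ea Eb}.
    rb (@runs_push n [:: A; V; map embed s; C] 3 (bitsym b) isT (bitsym_content _ b)).
    exact: runs_ret.
  lia.
rewrite [read_bits _]/=; case: eqP => [Ea|N1]; first exact: (step_bit false).
case: eqP => [Ea|N2]; first exact: (step_bit true).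
exists s; last exact: leqW.
rle; first apply: runs_iter_stop.
  rb (@runs_pop n [:: A; V; map embed (a :: s); C] 2 isT) => /=.
  have -> : (embed a == b0 n) || (embed a == b1 n) = false.
    by apply/negP => /orP [] /eqP /(congr1 (@nat_of_ord _)); rewrite val_embed /=;
      move: N1 N2; case: (nat_of_ord a) => [|[|[|k]]].
  exact: runs_ret.
rewrite /=; lia.
Qed.

Definition sim_prog : mach unit :=
  bind (@tree_to_string n) (fun _ => bind (pour n 0 2) (fun _ => bind sim_loop (fun _ =>
  bind output_loop (fun _ => bind (clear n 2) (fun _ => bind (clear n 0) (fun _ =>
  @string_to_tree n)))))).

Lemma sim_prog_runs x y T V : computes_within M x T y ->
  runs sim_prog (state (pol (tenc x) ++ V)) (100 * (size x + T) + 200) tt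
    (state (pol (tenc y) ++ V)) /\ size y <= (size x + T).+1.
Proof.
case=> Hh Ho.
have Hrep : represents (init_config M x) (map (bit_sym M) x) by case: (x).
have El : c_left (init_config M x) = [::] by case: (x).
have Eq : c_state (init_config M x) = ord0 by case: (x).
have := @sim_loop_runs T _ _ V [::] Hrep Hh; have := run_size T (init_config M x).
rewrite El Eq; set c := run T _ in Ho *; move=> Hsz Hsim.
have Hin : size (c_right (init_config M x)) <= size x by case: (x) => //= ? ?; rewrite size_map.
have [r Hout Hr] := @output_loop_runs (c_head c :: c_right c) (map embed (c_left c)) V [::].
have Hrb (s : seq (tm_sym M)) : size (read_bits s) <= size s.
  by elim: s => //= a s IH; do 2?case: ifP => _ //=.
have Hy : size y <= (size (c_right c)).+1 by rewrite -Ho; apply: Hrb.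
have Hc (s : seq (tm_sym M)) : all (@content n) (map embed s).
  by rewrite all_map; apply/allP => a _; apply: embed_content.
split; last by move: Hsz Hin Hy => /=; lia.
have Eout : read_bits (c_head c :: c_right c) = y := Ho.
rewrite Eout cats0 in Hout.
rle.
  rb (@tree_to_string_runs n x [::] V [::] [::]); rewrite cats0.
  have Hx : all (@content n) (rev (map bitsym x)) by rewrite all_rev bitsyms_content.
  rb (@pour02_runs n _ V [::] [::] Hx); rewrite revK cats0.
  have Ex : map bitsym x = map embed (map (bit_sym M) x).
    by rewrite -map_comp; apply: eq_map => b /=; rewrite embed_bit.
  rewrite Ex; rb Hsim.
  rb Hout.
  rb (@clear2_runs n (map embed (c_left c)) V _ (rev (map bitsym y)) (Hc r)).
  rb (@clear0_runs n _ V [::] (rev (map bitsym y)) (Hc (c_left c))).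
  exact: string_to_tree_runs.
move: Hsz Hin Hy Hr; rewrite !size_rev !size_map /=; lia.
Qed.
End Simulate.

(** * Composition of reductions *)

Lemma time_bound_poly c S k : k <= 400 * ((4 * (S + 2)) ^ c + S + 2) ->
  time_bound S k <= (S + 2) ^ (4 + 2 * (3 * c + 11)).
Proof.
move=> Hk.
have HP : (4 * (S + 2)) ^ c <= (S + 2) ^ (3 * c).
  by rewrite expnM; case: c {Hk} => // c; rewrite leq_exp2r //; nia.
have HZ : k + S + 13 <= (S + 2) ^ (3 * c + 11).
  apply: leq_trans (_ : 2 ^ 9 * ((S + 2) ^ (3 * c) + (S + 2) ^ 1) <= _).
    by rewrite (_ : 2 ^ 9 = 512) // expn1; lia.
  apply: leq_trans (_ : 2 ^ 9 * (S + 2) ^ (3 * c + 1 + 1) <= _).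
    by rewrite leq_mul2l pow_add orbT.
  by apply: leq_trans (pow_mul _ _ _) _; apply: pow_le; lia.
apply: leq_trans (_ : 2 ^ 4 * ((S + 2) ^ (3 * c + 11)) ^ 2 <= _).
  rewrite /time_bound (_ : 2 ^ 4 = 16) //.
  apply: leq_trans (_ : 16 * (k + S + 13) ^ 2 <= _); first by rewrite -mulnn; nia.
  by rewrite leq_mul2l leq_exp2r.
by rewrite -expnM mulnC -mulnC; apply: leq_trans (pow_mul _ _ _) _; apply: pow_le; lia.
Qed.

Lemma sim_then_PT (M : TM) (F : seq bool -> seq bool) : PT (tm_nsyms M) F ->
  exists (N : TM) (C : nat), forall x y T, computes_within M x T y ->
  forall T', (size x + T + 2) ^ C <= T' -> computes_within N x T' (F y).
Proof.
case=> -[P [c HP]]; set n := tm_nsyms M in P HP *.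
pose prog : mach n unit := bind (@string_to_tree n) (fun _ => bind (sim_prog M) (fun _ =>
  bind P (fun _ => @tree_to_string n))).
exists (TM_of (framed prog)), (4 + 2 * (3 * c + 11)) => x y T Hc T' HT'.
have [Hsim Hy] := @sim_prog_runs M x y T [::] Hc.
(* The factor 4 inside the power comes from the tree size of a bit string; the intermediate output
   [y] is at most one bit longer than input length plus time. *)
have Hprog : runs prog [:: [::]; [::]; [::]; rev (map (@bitsym n) x)]
    (400 * ((4 * (size x + T + 2)) ^ c + (size x + T) + 2)) tt
    [:: rev (map (@bitsym n) (F y)) ++ [::]; [::]; [::]; [::]].
  rle.
    rb (@string_to_tree_runs n x [::]).
    rb Hsim; rb (HP y [::]); exact: tree_to_string_runs.
  have HF := PTm_out HP y.
  have Hey := esz_bits_size y.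
  have Hpow : (esz y + 2) ^ c <= (4 * (size x + T + 2)) ^ c.
    by case: (c) => // c'; rewrite leq_exp2r //; lia.
  generalize (size_esz (F y)); lia.
rewrite cats0 in Hprog.
apply: (framed_computes Hprog); apply: leq_trans HT'.
apply: leq_trans (time_bound_poly (leqnn _)).
by rewrite /time_bound leq_mul2l; apply/orP; right; lia.
Qed.

(** Time bounds of composed reductions must be computable again. The argument is duplicated first
    because the simulation consumes one copy. *)
Lemma computable_poly (f : nat -> nat) (phi : nat -> nat -> nat) : computable f ->
  (forall n, PT n (fun p : nat * nat => phi p.1 p.2)) -> computable (fun k => phi k (f k)).
Proof.
case=> M HM Hphi; set n := tm_nsyms M.
pose F (p : seq bool * seq bool) := nseq (phi (size p.2) (size p.1)) true.
have [[P [c HP]]] : PT n F.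
  by apply: PT_nseqc; apply: (PT_app2 (Hphi n)); pt.
pose prog : mach n unit := bind (@string_to_tree n) (fun _ => bind (@dup_tree n) (fun _ =>
  bind (sim_prog M) (fun _ => bind (push 1 (b1 n)) (fun _ => bind P (fun _ =>
    @tree_to_string n))))).
exists (TM_of (framed prog)) => k; set x := nseq k true.
have [t Ht] := HM k.
have [Hsim _] := @sim_prog_runs M x _ t (pol n (tenc x) ++ [::]) Ht.
have [K HK] : exists K, runs prog [:: [::]; [::]; [::]; rev (map (@bitsym n) x)] K tt
    [:: rev (map (@bitsym n) (nseq (phi k (f k)) true)) ++ [::]; [::]; [::]; [::]].
  eexists.
  rb (@string_to_tree_runs n x [::]).
  rb (@dup_tree_runs n (tenc x) [::]).
  rb Hsim.
  rb (@runs_push n (state (pol n (tenc (nseq (f k) true)) ++ pol n (tenc x) ++ [::])) 1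
    (b1 n) isT isT).
  have := HP (nseq (f k) true, x) [::].
  rewrite (_ : pol n (tenc (nseq (f k) true, x)) ++ [::] =
    b1 n :: pol n (tenc (nseq (f k) true)) ++ pol n (tenc x) ++ [::]); last by rewrite /= -catA.
  move=> H; rb H; rewrite /F /= !size_nseq; exact: tree_to_string_runs.
rewrite cats0 in HK.
exists (time_bound (size x) K); exact: framed_computes HK (leqnn _).
Qed.

Lemma PT_expn n E `{Enc E} (a : E -> nat) C : PT n a -> PT n (fun e => a e ^ C).
Proof.
move=> Ha; elim: C => [|C IH]; first by apply: PT_const.
by apply: PT_ext (PT_mul Ha IH) => e; rewrite expnS.
Qed.

Lemma fpt_poly_trans Q Q' Q'' : fpt_reduction Q Q' -> poly_reduction Q' Q'' ->
  fpt_reduction Q Q''.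
Proof.
move=> [M [f [g [c [Hf [Hg HM]]]]]] [F [HF Hred]].
have [N [C HN]] := sim_then_PT (HF (tm_nsyms M)).
(* The encoded input has k + 1 + |x| bits; together with the simulated time f(k) (|x|+1)^c and the
   constant 2 this is at most (k + 4 + f(k)) (|x|+1)^(c+1), which is then raised to the power
   [C]. *)
exists N, (fun k => (k + 4 + f k) ^ C), (fun k => (g k).+1), ((c + 1) * C).
split; first by apply: (computable_poly (phi := fun k m => (k + 4 + m) ^ C) Hf) => n;
  apply: PT_expn; pt.
split; first by apply: (computable_poly (phi := fun _ m => m.+1) Hg) => n; pt.
move=> x k; have [x' [k' [Hc [Hk' HQ]]]] := HM x k.
have [x'' [k'' [E Hk'' HQ']]] := Hred x' k'.
exists x'', k''; split; last split.
- rewrite -E; apply: HN Hc _ _.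
  rewrite expnM -expnMn; case: (C) => // C';
    rewrite leq_exp2r // /enc_pair size_cat size_nseq /=.
  rewrite addn1 expnSr; have : 0 < (size x).+1 ^ c by rewrite expn_gt0.
  nia.
- by apply: leq_trans Hk'' _; rewrite ltnS.
by rewrite HQ.
Qed.

(** A machine that halts at once leaves its input as output. Following this reduction by a
    polynomial one turns the latter into a parameterized reduction. *)
Lemma fpt_refl Q : fpt_reduction Q Q.
Proof.
pose M := @mkTM 0 0 (fun _ _ => None).
have HM x t : computes_within M x t x.
  rewrite /computes_within (_ : run t _ = init_config M x); last by case: t.
  split=> //; rewrite /output.
  have Hread y : read_bits (map (bit_sym M) y) = y.
    by elim: y => //= -[] y IH; rewrite /bit_sym !inordK //= IH.
  by case: x => [|b x]; [rewrite /= inordK | exact: (Hread (b :: x))].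
have Hid : computable id by exists M => k; exists 0; apply: HM.
by exists M, id, id, 0; split=> //; split=> // x k; exists x, k.
Qed.

Theorem theorem2 : W3_complete ID_problem /\ W3_complete ID_identity_problem.
Proof.
split; split.
- exact: fpt_poly_trans (fpt_refl _) ID_reduces_to_WSat3.
- by move=> Q HQ; apply: fpt_poly_trans HQ WSat3_reduces_to_ID.
- exact: fpt_poly_trans (fpt_refl _) ID_identity_reduces_to_WSat3.
by move=> Q HQ; apply: fpt_poly_trans HQ WSat3_reduces_to_ID_identity.
Qed.
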